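(* There exists a constant $c>0$, which depends only on $L$ and $L_0$ (in particular not on $\bar\varepsilon\in\mathcal{U}_e$), such that for all $(\tau,\eta)\in\mathcal{H}_s\times\mathcal{H}_e$: $$0\le\mathcal{J}_c(\tau_{\mathcal{S}})+\mathcal{J}(\eta_{\mathcal{E}_0})\le c\,\mathcal{P}(\tau,\eta),$$ where $(\tau_{\mathcal{S}},\eta_{\mathcal{E}_0})\in\mathcal{S}\times\mathcal{E}_0$ are the statically and kinematically admissible components of $(\tau,\eta)$, i.e. the orthogonal projection $\tau_{\mathcal{S}}$ of $\tau$ onto $\mathcal{S}$ in $\mathcal{H}_s$ and the orthogonal projection $\eta_{\mathcal{E}_0}=P_{\mathcal{E}_0}\eta$ of $\eta$ onto $\mathcal{E}_0$ in $\mathcal{H}_e$.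
   Context: Let $\mathcal{V}\subset\mathbb{R}^d$ be a unit cell that tiles $\mathbb{R}^d$ by translation along a lattice $\mathcal{R}$ generated by $d$ vectors. ''Periodic'' means $\mathcal{R}$-periodic. $L^2_{\mathrm{per}}(\mathcal{V})$ is the space of periodic functions in $L^2_{\mathrm{loc}}(\mathbb{R}^d)$, and $H^1_{\mathrm{per}}(\mathcal{V})$ the space of periodic functions in $H^1_{\mathrm{loc}}(\mathbb{R}^d)$. All fields are real-valued. Write $\langle f\rangle=\frac1{|\mathcal{V}|}\int_{\mathcal{V}}f\,dx$ and $s:e=\sum_{i,j}s_{ij}e_{ij}$. $L_0$ is a uniform (constant in $x$) positive definite fourth-order tensor with major and minor symmetries; it acts on second-order tensors, $(L_0\eta)_{ij}=\sum_{k,l}(L_0)_{ijkl}\eta_{kl}$, and it is thus an invertible, symmetric positive definite linear map on symmetric $d\times d$ matrices. $L=L(x)$ is the periodic fourth-order elasticity tensor field of the composite, with major and minor symmetries, components in $L^\infty(\mathcal{V})$, and uniformly positive definite (there is $\mu>0$ with $L(x)e:e\ge\mu\, e:e$ for a.e. $x$ and all symmetric $e$); it acts pointwise, $(L\eta)(x)=L(x)\eta(x)$, and $L^{-1}$ is its pointwise inverse on symmetric matrices. $\mathcal{H}_e$ (strain fields) is the space of symmetric second-order tensor fields with components in $L^2_{\mathrm{per}}(\mathcal{V})$, with energetic scalar product $(\eta,\tilde\eta)_{\mathcal{H}_e}=\langle L_0\eta:\tilde\eta\rangle$. $\mathcal{H}_s$ (stress fields) is the same set of tensor fields, with energetic scalar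 product $(\tau,\tilde\tau)_{\mathcal{H}_s}=\langle\tau:L_0^{-1}\tilde\tau\rangle$. $\|\cdot\|_{\mathcal{H}_e}$, $\|\cdot\|_{\mathcal{H}_s}$ are the associated norms and $I$ is the identity operator. $\mathcal{U}_e\subset\mathcal{H}_e$ is the subspace of uniform (constant) fields; $\bar\varepsilon\in\mathcal{U}_e$ is a given macroscopic strain. $\mathcal{E}_0=\{e^*\in\mathcal{H}_e:\ \exists\,w^*\in H^1_{\mathrm{per}}(\mathcal{V})^d,\ e^*=\frac12(\nabla w^*+(\nabla w^* )^{\top})\}$. $\mathcal{S}$ is the space of $s\in\mathcal{H}_s$ such that $\operatorname{div}s=0$ in $\mathcal{V}$ and $s\cdot n$ is anti-periodic on $\partial\mathcal{V}$ ($n$ the unit outward normal), i.e. the periodic field $s$ is divergence-free on $\mathbb{R}^d$ in the sense of distributions. $P_{\mathcal{E}_0}$ is the orthogonal projector of $\mathcal{H}_e$ onto $\mathcal{E}_0$; $P_{\mathcal{S}^\perp}$ is the orthogonal projector of $\mathcal{H}_s$ onto the orthogonal complement $\mathcal{S}^\perp$ of $\mathcal{S}$ in $\mathcal{H}_s$ (orthogonality for the respective energetic scalar products), so that $\tau_{\mathcal{S}}=\tau-P_{\mathcal{S}^\perp}\tau$. Functionals: for $(\tau,\eta)\in\mathcal{H}_s\times\mathcal{H}_e$, $r(x,\tau,\eta)=\frac12(\tau-L\eta):L^{-1}(\tau-L\eta)$ and $$\mathcal{P}(\tau,\eta)=\tfrac12\|(I-P_{\mathcal{E}_0})\eta-\bar\varepsilon\|^2_{\mathcal{H}_e}+\langle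 r(\cdot,\tau,\eta)\rangle+\tfrac12\|P_{\mathcal{S}^\perp}\tau\|^2_{\mathcal{H}_s}.$$ $\mathcal{J}:\mathcal{E}_0\to\mathbb{R}$, $\mathcal{J}(e^* )=\frac12\langle L(\bar\varepsilon+e^* ):(\bar\varepsilon+e^* )\rangle$. $\mathcal{J}_c:\mathcal{S}\to\mathbb{R}$, $\mathcal{J}_c(s)=\frac12\langle s:L^{-1}s\rangle-\langle s\rangle:\bar\varepsilon$. *)

(* Defs.v *)
From HB Require Import structures.
From mathcomp Require Import all_boot all_order all_algebra.
From mathcomp Require Import all_classical all_reals all_analysis.

Set Implicit Arguments.
Unset Strict Implicit.
Unset Printing Implicit Defensive.

Import Order.TTheory GRing.Theory Num.Theory.
Import numFieldNormedType.Exports.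

Local Open Scope classical_set_scope.
Local Open Scope ring_scope.

Definition rV_display : measure_display.
Proof. exact. Qed.

Section measurable_rV.
Context (R : realType) (n : nat).

Definition rV_coord (i : 'I_n) (x : 'rV[R]_n) : measurableTypeR R := x 0 i.

Let rV_set0 : g_sigma_preimage rV_coord set0.
Proof. exact: sigma_algebra0. Qed.

Let rV_setC A : g_sigma_preimage rV_coord A -> g_sigma_preimage rV_coord (~` A).
Proof. exact: sigma_algebraC. Qed.

Let rV_bigcup (F : (set 'rV[R]_n)^nat) :
  (forall i, g_sigma_preimage rV_coord (F i)) ->
  g_sigma_preimage rV_coord (\bigcup_i (F i)).
Proof. exact: sigma_algebra_bigcup. Qed.

(* The Borel sigma-algebra of R^n, as the one generated by the coordinates. *)
HB.instance Definition _ := @isMeasurable.Build rV_display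
  'rV[R]_n (g_sigma_preimage rV_coord) rV_set0 rV_setC rV_bigcup.

Lemma measurable_rV_coord (i : 'I_n) :
  measurable_fun [set: 'rV[R]_n] (rV_coord i).
Proof.
move=> _ Y mY; rewrite setTI; apply: sub_sigma_algebra => /=.
rewrite -bigcup_seq/=; exists i => /=; first by rewrite mem_index_enum.
by exists Y => //; rewrite setTI.
Qed.

Lemma measurable_fun_rVP d (T : measurableType d) (f : T -> 'rV[R]_n) :
  measurable_fun [set: T] f <->
  forall i, measurable_fun [set: T] (rV_coord i \o f).
Proof.
split=> [mf i|mf]; first exact: (measurableT_comp (measurable_rV_coord i)).
pose G : set (set 'rV[R]_n) :=
  \big[setU/set0]_(i < n) preimage_set_system setT (rV_coord i) measurable.
apply: (@measurability _ _ _ _ setT f G) => //.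
move=> _ [B + <-]; rewrite /G -bigcup_seq/= => -[i /= _ [A mA <-]].
by rewrite [X in _ `&` (f @^-1` X)]setTI; exact: mf.
Qed.

End measurable_rV.

Section lebesgue_rV.
Context (R : realType).

Definition rV_cons n (p : measurableTypeR R * 'rV[R]_n) : 'rV[R]_n.+1 :=
  \row_j if unlift ord0 j is Some k then p.2 0 k else p.1.

Definition rV_uncons n (x : 'rV[R]_n.+1) : measurableTypeR R * 'rV[R]_n :=
  (x 0 ord0, \row_j x 0 (lift ord0 j)).

Lemma rV_consE0 n (p : measurableTypeR R * 'rV[R]_n) : rV_cons p 0 ord0 = p.1.
Proof. by rewrite mxE unlift_none. Qed.

Lemma rV_consES n (p : measurableTypeR R * 'rV[R]_n) j :
  rV_cons p 0 (lift ord0 j) = p.2 0 j.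
Proof. by rewrite mxE liftK. Qed.

Lemma rV_consK n : cancel (@rV_cons n) (@rV_uncons n).
Proof.
move=> [a v]; rewrite /rV_uncons rV_consE0; congr pair.
by apply/rowP => j; rewrite mxE rV_consES.
Qed.

Lemma measurable_rV_cons n : measurable_fun setT (@rV_cons n).
Proof.
apply/measurable_fun_rVP => i; rewrite /rV_coord.
have [->|[j ->]] : i = ord0 \/ exists j, i = lift ord0 j.
  by case: (unliftP ord0 i) => [j ->|->]; [right; exists j|left].
- rewrite (_ : _ \o _ = fst); first exact: measurable_fst.
  by apply/funext => p /=; exact: rV_consE0.
- rewrite (_ : _ \o _ = rV_coord j \o snd); last first.
    by apply/funext => p /=; exact: rV_consES.
  exact: (measurableT_comp (measurable_rV_coord j) measurable_snd).
Qed.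

Lemma measurable_rV_uncons n : measurable_fun setT (@rV_uncons n).
Proof.
apply/measurable_fun_pairP; split.
  exact: (measurable_rV_coord (ord0 : 'I_n.+1)).
apply/measurable_fun_rVP => i.
rewrite (_ : _ \o _ = rV_coord (lift ord0 i)); first exact: measurable_rV_coord.
by apply/funext => x; rewrite /rV_coord /= mxE.
Qed.

Section step.
Context (n : nat) (mu : {sigma_finite_measure set 'rV[R]_n -> \bar R}).

Definition lebesgue_rVS : set 'rV[R]_n.+1 -> \bar R :=
  pushforward (@lebesgue_measure R \x mu)%E (@rV_cons n).

Let lebesgue_rVS0 : lebesgue_rVS set0 = 0%E.
Proof. by rewrite /lebesgue_rVS /pushforward preimage_set0 measure0. Qed.

Let lebesgue_rVS_ge0 A : (0 <= lebesgue_rVS A)%E.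
Proof. exact: (measure_ge0 (@lebesgue_measure R \x mu)%E). Qed.

Let lebesgue_rVS_sigma_additive : semi_sigma_additive lebesgue_rVS.
Proof.
have mcons A : measurable A -> measurable (@rV_cons n @^-1` A).
  by move=> mA; rewrite -[X in measurable X]setTI; exact: measurable_rV_cons.
move=> F mF tF mUF; rewrite /lebesgue_rVS /pushforward preimage_bigcup.
apply: measure_semi_sigma_additive.
- by move=> k; exact: mcons.
- apply/trivIsetP => /= i j _ _ ij; rewrite -preimage_setI.
  by move/trivIsetP : tF => /(_ _ _ _ _ ij) ->//; rewrite preimage_set0.
- by rewrite -preimage_bigcup; exact: mcons.
Qed.

HB.instance Definition _ := isMeasure.Build _ _ _
  lebesgue_rVS lebesgue_rVS0 lebesgue_rVS_ge0 lebesgue_rVS_sigma_additive.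

Let lebesgue_rVS_sigma_finite : sigma_finite setT lebesgue_rVS.
Proof.
have /sigma_finiteP[F [TF ndF mF]] := sigma_finiteT (@lebesgue_measure R).
have /sigma_finiteP[G [TG ndG mG]] := sigma_finiteT mu.
exists (fun k => @rV_uncons n @^-1` (F k `*` G k)).
  rewrite -preimage_bigcup (_ : \bigcup_k (F k `*` G k) = setT) ?preimage_setT//.
  rewrite -setXTT TF TG predeqE => -[x y]; split.
    by move=> [k _ []/= ? ?]; split; exists k.
  move=> [/= [k _ Fkx] [l _ Gly]]; exists (maxn k l) => //; split.
  - by move: x Fkx; exact/subsetPset/ndF/leq_maxl.
  - by move: y Gly; exact/subsetPset/ndG/leq_maxr.
move=> k; have [mFk Fk] := mF k; have [mGk Gk] := mG k; split.
  rewrite -[X in measurable X]setTI; apply: measurable_rV_uncons => //.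
  exact: measurableX.
rewrite /lebesgue_rVS /pushforward -comp_preimage.
rewrite (_ : _ \o _ = id); last by apply/funext => p /=; exact: rV_consK.
by rewrite preimage_id product_measure1E// lte_mul_pinfty// ge0_fin_numE.
Qed.

HB.instance Definition _ := Measure_isSigmaFinite.Build _ _ _
  lebesgue_rVS lebesgue_rVS_sigma_finite.
End step.

(* Lebesgue measure on R^n: the image of lambda (x) lambda^(n-1) under
   R x R^(n-1) ~ R^n, and the unit mass when n = 0. *)
Fixpoint lebesgue_rV (n : nat) :
    {sigma_finite_measure set 'rV[R]_n -> \bar R} :=
  match n with
  | 0%N => \d_(0 : 'rV[R]_0)
  | m.+1 => lebesgue_rVS (lebesgue_rV m)
  end.

Lemma lebesgue_rV_box n (E : 'I_n -> set R) :
  (forall i, measurable (E i : set (measurableTypeR R))) ->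
  lebesgue_rV n [set x | forall i, E i (x 0 i)] =
  (\prod_(i < n) lebesgue_measure (E i : set (measurableTypeR R)))%E.
Proof.
elim: n E => [|n ih] E mE.
  by rewrite big_ord0 /= diracE mem_set// => -[].
rewrite big_ord_recl -(ih (fun i => E (lift ord0 i)))//.
have mB : measurable [set x : 'rV[R]_n | forall i, E (lift ord0 i) (x 0 i)].
  rewrite (_ : [set _ | _] = \bigcap_(i in [set: 'I_n])
    (rV_coord i @^-1` (E (lift ord0 i)))); last first.
    by apply/seteqP; split => x /= h i => [_|]; exact: h.
  apply: fin_bigcap_measurable => // i _.
  rewrite -[X in measurable X]setTI; exact: measurable_rV_coord.
rewrite -product_measure1E//=; congr (product_measure1 _ _ _).
apply/seteqP; split => [[a v] /= h|[a v] /= [h1 h2] i].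
- split=> [|i]; first by have := h ord0; rewrite rV_consE0.
  by have := h (lift ord0 i); rewrite rV_consES.
- by case: (unliftP ord0 i) => [j ->|->]; rewrite ?rV_consES ?rV_consE0.
Qed.
End lebesgue_rV.

Section fields.
Context (R : realType) (d : nat).

Local Notation point := 'rV[R]_d.
Local Notation field := (point -> 'M[R]_d).
Local Notation mu := (lebesgue_rV R d).

(* The rows of B are the generators of the lattice. *)
Definition lattice_vec (B : 'M[R]_d) (k : 'rV[int]_d) : point :=
  map_mx (fun z : int => z%:~R) k *m B.

(* No regularity of V is assumed: the cell may be open, closed or half-open,
   hence overlaps and gaps of zero measure are allowed. *)
Definition unit_cell (B : 'M[R]_d) (V : set point) : Prop :=
  [/\ measurable V,
      mu.-negligible (~` \bigcup_k [set x + lattice_vec B k | x in V]) &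
      forall k : 'rV[int]_d, k != 0 ->
        mu.-negligible (V `&` [set x + lattice_vec B k | x in V])].

(* Fields are represented by functions and are only meaningful up to
   almost everywhere equality; so is periodicity. *)
Definition lattice_periodic (B : 'M[R]_d) (T : Type) (f : point -> T) : Prop :=
  forall k, {ae mu, forall x, f (x + lattice_vec B k) = f x}.

Definition L2loc (f : point -> R) : Prop :=
  measurable_fun setT f /\
  forall K : set point, compact K ->
    mu.-integrable K (fun x => (f x ^+ 2)%:E).

Definition L2per (B : 'M[R]_d) (f : point -> R) : Prop :=
  L2loc f /\ lattice_periodic B f.

Definition partial (j : 'I_d) (f : point -> R) : point -> R :=
  fun x => 'D_(delta_mx 0 j) f x.

(* Infinitely differentiable: all iterated partial derivatives (of any order,
   taken in any sequence of directions) are differentiable. *)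
Definition smooth (f : point -> R) : Prop :=
  forall (s : seq 'I_d) (x : point), differentiable (foldr partial f s) x.

Definition test_function (phi : point -> R) : Prop :=
  smooth phi /\
  exists2 K : set point, compact K & forall x, ~ K x -> phi x = 0.

Definition weak_partial (j : 'I_d) (f g : point -> R) : Prop :=
  forall phi, test_function phi ->
    \int[mu]_x (f x * partial j phi x) = - \int[mu]_x (g x * phi x).

Definition H1loc (f : point -> R) : Prop :=
  L2loc f /\ forall j, exists2 g, L2loc g & weak_partial j f g.

Definition H1per (B : 'M[R]_d) (f : point -> R) : Prop :=
  H1loc f /\ lattice_periodic B f.

(* (weak_gradient w G) : G i j is the j-th partial derivative of w i. *)
Definition weak_gradient (w : point -> 'rV[R]_d) (G : field) : Prop :=
  forall i j, L2loc (fun x => G x i j) /\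
    weak_partial j (fun x => w x 0 i) (fun x => G x i j).

Definition ddot (s e : 'M[R]_d) : R := \sum_i \sum_j s i j * e i j.

Definition tensor4 := 'I_d -> 'I_d -> 'I_d -> 'I_d -> R.

Definition tapp (C : tensor4) (e : 'M[R]_d) : 'M[R]_d :=
  \matrix_(i, j) \sum_k \sum_l C i j k l * e k l.

(* Inverse of C as a linear map of the space of symmetric matrices (the value
   is 0 where there is no symmetric preimage). *)
Definition tinv (C : tensor4) (s : 'M[R]_d) : 'M[R]_d :=
  xget 0 [set e : 'M[R]_d | e^T = e /\ tapp C e = s].

Definition major_minor_symmetric (C : tensor4) : Prop :=
  forall i j k l, [/\ C i j k l = C j i k l, C i j k l = C i j l k &
                      C i j k l = C k l i j].

Definition positive_definite (C : tensor4) : Prop :=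
  forall e : 'M[R]_d, e^T = e -> e != 0 -> 0 < ddot (tapp C e) e.

Definition stiffness_field (B : 'M[R]_d) (V : set point)
    (L : point -> tensor4) : Prop :=
  [/\ forall i j k l, measurable_fun setT (fun x => L x i j k l),
      lattice_periodic B L,
      {ae mu, forall x, major_minor_symmetric (L x)},
      exists M : R,
        {ae mu, forall x, V x -> forall i j k l, `|L x i j k l| <= M} &
      exists2 m : R, 0 < m & {ae mu, forall x, forall e : 'M[R]_d, e^T = e ->
        m * ddot e e <= ddot (tapp (L x) e) e}].

(* The common underlying set of the spaces of strain and of stress fields. *)
Definition tensor_fields (B : 'M[R]_d) : set field :=
  [set eta : field | (forall i j, L2per B (fun x => eta x i j)) /\
             {ae mu, forall x, (eta x)^T = eta x}].

Definition average (V : set point) (f : point -> R) : R :=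
  (fine (mu V))^-1 * \int[mu]_(x in V) f x.

Definition average_mx (V : set point) (s : field) : 'M[R]_d :=
  \matrix_(i, j) average V (fun x => s x i j).

Definition strain_ip (V : set point) (L0 : tensor4) (eta eta' : field) : R :=
  average V (fun x => ddot (tapp L0 (eta x)) (eta' x)).

Definition stress_ip (V : set point) (L0 : tensor4) (tau tau' : field) : R :=
  average V (fun x => ddot (tau x) (tinv L0 (tau' x))).

Definition ip_norm (ip : field -> field -> R) (x : field) : R :=
  Num.sqrt (ip x x).

Definition orthogonal_complement (H : set field) (ip : field -> field -> R)
    (U : set field) : set field :=
  [set x : field | H x /\ forall z, U z -> ip x z = 0].

Definition orthogonal_projector (H : set field) (ip : field -> field -> R)
    (U : set field) (P : field -> field) : Prop :=
  forall x, H x -> U (P x) /\ forall z, U z -> ip (x \- P x) z = 0.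

Definition compatible_strains (B : 'M[R]_d) : set field :=
  [set e : field | tensor_fields B e /\
    exists (w : point -> 'rV[R]_d) (G : field),
      [/\ forall i, H1per B (fun x => w x 0 i), weak_gradient w G &
          {ae mu, forall x, e x = 2^-1 *: (G x + (G x)^T)}]].

(* The divergence (row by row) vanishes on R^d in the sense of distributions,
   which encodes both the equilibrium inside the cell and the anti-periodicity
   of the traction on its boundary. *)
Definition equilibrated_stresses (B : 'M[R]_d) : set field :=
  [set s : field | tensor_fields B s /\
    forall phi, test_function phi -> forall i,
      \int[mu]_x (\sum_j s x i j * partial j phi x) = 0].

Definition residual (L : point -> tensor4) (tau eta : field) (x : point) : R :=
  let t := tau x - tapp (L x) (eta x) in 2^-1 * ddot t (tinv (L x) t).

(* PE and PSc stand for the projectors onto the compatible strains and onto the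
   orthogonal complement of the equilibrated stresses. *)
Definition two_field_functional (V : set point) (L0 : tensor4)
    (L : point -> tensor4) (PE PSc : field -> field) (eps : 'M[R]_d)
    (tau eta : field) : R :=
  2^-1 * ip_norm (strain_ip V L0) ((eta \- PE eta) \- cst eps) ^+ 2
  + average V (residual L tau eta)
  + 2^-1 * ip_norm (stress_ip V L0) (PSc tau) ^+ 2.

Definition potential_energy (V : set point) (L : point -> tensor4)
    (eps : 'M[R]_d) (e : field) : R :=
  2^-1 * average V (fun x => ddot (tapp (L x) (eps + e x)) (eps + e x)).

Definition complementary_energy (V : set point) (L : point -> tensor4)
    (eps : 'M[R]_d) (s : field) : R :=
  2^-1 * average V (fun x => ddot (s x) (tinv (L x) (s x)))
  - ddot (average_mx V s) eps.
End fields.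

(* Main.v *)
From HB Require Import structures.
From mathcomp Require Import all_boot all_order all_algebra.
From mathcomp Require Import all_classical all_reals all_analysis.
From mathcomp Require Import measurable_realfun ring lra.
Require Import Defs.
Import Order.TTheory GRing.Theory Num.Theory.
Import numFieldNormedType.Exports.
Local Open Scope classical_set_scope.
Local Open Scope ring_scope.

(** Write [s] and [e] for the projections of [tau] and [eta] on the equilibrated
    stresses and on the compatible strains, and let
    [t = s - L (eps + e)].

    The Hill-Mandel lemma ([hill_mandel]) says that [s : e] has zero mean on a
    cell. It turns the duality gap into a square: the sum of the two energies
    is half the mean of [t : L^-1 t] ([energy_gapE]), hence is nonnegative.
    For the upper bound,
    [t = (tau - L eta) - (tau - s) + L (eta - e - eps)],
    so the square is at most three times the sum of the squares of the three
    terms ([ddot_inverse_tensor3]). The first one is the residual; the second is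
    controlled by the norm of [tau - s], which equals that of the projection of
    [tau] on the complement of the equilibrated stresses
    ([norm_projection_complement]); the third is controlled by the strain norm
    of [eta - e - eps]. The constants come from comparing the quadratic forms of
    [L], [L^-1], [L0] and [L0^-1] pointwise ([ddot_inverse_tensor_le],
    [ddot_le_inverse_tensor], [ddot_le_tapp]).

    The analytic core is the Hill-Mandel lemma for weak derivatives, where
    neither [s] nor the displacement [w] of [e] may be used as a test function.
    It is obtained from the correlation
    [C h = sum_ij int_Q s_ij(x) e_ij(x + h) dx] over a cell [Q].
    For a smooth bump [rho], Fubini gives two expressions of a smeared
    correlation of two functions: the average against [rho] may be moved onto
    either of them ([correlation_swap], [correlation_swap_reflected]).
    Moving it on [e] allows one to trade [e] for [w] and [rho] for its partial
    derivatives; moving it back on [s] then produces the divergence of [s]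
    tested against a translate of a reflection of [rho], which vanishes. Hence
    [rho C] has zero integral for every bump ([bump_correlation]), so [C] takes
    nonpositive and nonnegative values in every neighbourhood of the origin. As
    translations are weakly continuous in [L^2]
    ([translation_weak_continuity]), [C 0 = 0].

    The rest is groundwork: invariance of Lebesgue measure, obtained on boxes;
    independence of the integral of a periodic function from the tiling cell
    ([tiling_ge0_integral]), which also moves everything to a bounded cell;
    an explicit family of smooth bumps; and the measurability of the pointwise
    inverse of [L], obtained from Cramer's formula. *)

Set Implicit Arguments.
Unset Strict Implicit.
Unset Printing Implicit Defensive.

(** * Integrals of functions that agree almost everywhere *)

Section ae_insensitive.
Context d (T : measurableType d) (R : realType) (mu : {measure set T -> \bar R}).
Import HBNNSimple.
Local Open Scope ereal_scope.

(** The integral of a nonnegative function is a supremum over simple functions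
    below it, and multiplying a simple function by the indicator of a set of
    full measure does not change its integral. So this holds for functions that
    need not be measurable, such as those built from [tinv (L x)], whose values
    are unrelated to those of a measurable function where [L x] is degenerate. *)
Lemma ge0_le_integral_ae (f g : T -> \bar R) :
  (forall x, 0 <= f x) -> (forall x, 0 <= g x) ->
  {ae mu, forall x, f x <= g x} ->
  \int[mu]_x f x <= \int[mu]_x g x.
Proof.
move=> f0 g0 [N [mN N0 fgN]]; rewrite !ge0_integralTE//.
apply: ge_ereal_sup => _ [h hf <-].
have mNc : measurable (~` N) by exact: measurableC.
pose h' : {nnsfun T >-> R} := proj_nnsfun h mNc.
have -> : sintegral mu h = sintegral mu h'.
  have := integral_nnsfun mu measurableT h.
  have := integral_nnsfun mu measurableT h'.
  rewrite !patch_setT => <- <-.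
  apply: ae_eq_integral => //; [exact/measurable_EFinP|exact/measurable_EFinP|].
  exists N; split => // x /= nx; apply: contrapT => Nx; apply: nx => _.
  by rewrite /h' /proj_nnsfun /= mindicE mem_set// mulr1.
apply: ereal_sup_ubound => /=; exists h' => // x.
rewrite /h' /proj_nnsfun /= mindicE.
have [|_] := boolP (_ \in _); last by rewrite mulr0.
rewrite inE mulr1 => Nx; apply: (le_trans (hf x)).
by apply: contrapT => fg; apply: Nx; exact: fgN.
Qed.

Lemma eq_integral_ae (D : set T) (f g : T -> \bar R) :
  {ae mu, forall x, D x -> f x = g x} ->
  \int[mu]_(x in D) f x = \int[mu]_(x in D) g x.
Proof.
move=> fg; rewrite integral_mkcond [RHS]integral_mkcond integralE [RHS]integralE.
have ae : {ae mu, forall x, (f \_ D) x = (g \_ D) x}.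
  near=> x; rewrite !patchE; case: ifPn => // /set_mem; near: x; exact: fg.
by congr (_ - _); apply/eqP; rewrite eq_le; apply/andP; split;
  apply: ge0_le_integral_ae => //; near=> x; rewrite ?funeposE ?funenegE;
  (have -> : (f \_ D) x = (g \_ D) x by near: x).
Unshelve. all: by end_near. Qed.

End ae_insensitive.

Lemma eq_Rintegral_ae d (T : measurableType d) (R : realType)
    (mu : {measure set T -> \bar R}) (D : set T) (f g : T -> R) :
  {ae mu, forall x, D x -> f x = g x} ->
  \int[mu]_(x in D) f x = \int[mu]_(x in D) g x.
Proof.
move=> fg; congr fine; apply: eq_integral_ae.
by near=> x => Dx; congr EFin; move: Dx; near: x.
Unshelve. all: by end_near. Qed.

(** * Boxes generate the Borel sets *)

Section boxes.
Context (R : realType) (n : nat).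
Implicit Types (a b v x : 'rV[R]_n).

Definition obox a b : set 'rV[R]_n := [set x | forall i, a 0 i < x 0 i < b 0 i].

(** Empty boxes are not excluded, so that the open boxes form a pi-system. *)
Lemma oboxI a b a' b' : obox a b `&` obox a' b' =
  obox (\row_i Num.max (a 0 i) (a' 0 i)) (\row_i Num.min (b 0 i) (b' 0 i)).
Proof.
apply/seteqP; split => x /=.
  move=> [h1 h2] i; rewrite !mxE gt_max lt_min.
  by have /andP[-> ->] := h1 i; have /andP[-> ->] := h2 i.
move=> h; split=> i; have := h i; rewrite !mxE gt_max lt_min;
  by move=> /andP[/andP[p q] /andP[r s]]; rewrite ?p ?q ?r ?s.
Qed.

Lemma measurable_obox a b : measurable (obox a b).
Proof.
rewrite (_ : obox a b =
  \bigcap_(i in [set: 'I_n]) (rV_coord i @^-1` `]a 0 i, b 0 i[)); last first.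
  apply/seteqP; split => x /= h i => [_|].
    by rewrite /rV_coord /= in_itv; exact: h.
  by have := h i Logic.I; rewrite /rV_coord /= in_itv.
apply: fin_bigcap_measurable => // i _.
rewrite -[X in measurable X]setTI; exact: measurable_rV_coord.
Qed.

Definition oboxes : set (set 'rV[R]_n) := [set obox p.1 p.2 | p in setT].

Lemma oboxesI : setI_closed oboxes.
Proof. by move=> _ _ [[a b] _ <-] [[a' b'] _ <-]; rewrite oboxI; eexists (_, _). Qed.

Lemma obox_cover :
  \bigcup_k obox (const_mx (- k%:R)) (const_mx k%:R) = setT :> set 'rV[R]_n.
Proof.
apply/seteqP; split => // x _; have [k xk] : exists k : nat, forall i, `|x 0 i| < k%:R.
  exists (\sum_(i < n) (Num.truncn `|x 0 i|%R).+1)%N => i.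
  have := truncnS_gt `|x 0 i|; move/lt_le_trans; apply; rewrite ler_nat.
  by rewrite (bigD1 i)//= leq_addr.
by exists k => // i; rewrite !mxE -ltr_norml.
Qed.

Lemma measurable_rV_oboxes : @measurable _ 'rV[R]_n = <<s oboxes >>.
Proof.
apply/seteqP; split; last first.
  apply: smallest_sub; first exact: sigma_algebra_measurable.
  by move=> _ [[a b] _ <-]; exact: measurable_obox.
apply: smallest_sub; first exact: smallest_sigma_algebra.
have mcoord (i : 'I_n) : measurable_fun [set: g_sigma_algebraType oboxes]
    (rV_coord i : g_sigma_algebraType oboxes -> measurableTypeR R).
  apply: (measurability _ (RGenOInfty.measurableE R)) => _ [_ [x ->] <-].
  rewrite setTI (_ : _ @^-1` _ = \bigcup_k
    obox (\row_j if j == i then x else - k%:R) (const_mx k%:R)); last first.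
    apply/seteqP; split => y /=; last first.
      move=> [k _ /(_ i)]; rewrite !mxE eqxx => /andP[xy _].
      by rewrite /rV_coord /= in_itv /= xy.
    rewrite /rV_coord /= in_itv /= andbT => xy.
    have : [set: 'rV[R]_n] y by [].
    rewrite -obox_cover => -[k _ hk]; exists k => // j.
    rewrite !mxE; have := hk j; rewrite !mxE => /andP[h1 ->]; rewrite andbT.
    by case: eqP => // ->.
  apply: bigcup_measurable => k _; apply: sub_sigma_algebra.
  by exists (\row_j (if j == i then x else - k%:R), const_mx k%:R).
move=> A; rewrite -bigcup_seq => -[i _ [B mB <-]].
exact: mcoord.
Qed.

Lemma lebesgue_rV_obox a b : lebesgue_rV R n (obox a b) =
  (\prod_(i < n) lebesgue_measure (`]a 0%R i, b 0%R i[%classic : set (measurableTypeR R)))%E.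
Proof.
rewrite -lebesgue_rV_box; last by move=> i; exact: measurable_itv.
congr (lebesgue_rV R n _); apply/seteqP; split => x /= h i; have := h i;
  by rewrite /= in_itv.
Qed.

Lemma lebesgue_rV_obox_lty a b : (lebesgue_rV R n (obox a b) < +oo)%E.
Proof.
rewrite lebesgue_rV_obox.
suff : (0 <= \prod_(i < n) lebesgue_measure
    (`]a 0%R i, b 0%R i[%classic : set (measurableTypeR R)) < +oo)%E by move=> /andP[].
elim/big_ind: _ => [|x y /andP[x0 xoo] /andP[y0 yoo]|i _].
- by rewrite lee01 ltry.
- by rewrite mule_ge0//= lte_mul_pinfty// ge0_fin_numE.
- rewrite measure_ge0 lebesgue_measure_itv /=; case: ifP => _; rewrite ltry//.
Qed.

End boxes.

(** * Invariance of Lebesgue measure under translations and reflections *)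

Section invariance.
Context (R : realType) (n : nat).
Implicit Types (a b v x : 'rV[R]_n).
Local Notation mu := (lebesgue_rV R n).

Lemma measurable_funD_rV d (T : measurableType d) (f g : T -> 'rV[R]_n) :
  measurable_fun setT f -> measurable_fun setT g ->
  measurable_fun setT (fun t => f t + g t).
Proof.
move=> /measurable_fun_rVP mf /measurable_fun_rVP mg; apply/measurable_fun_rVP => i.
rewrite (_ : _ \o _ = (fun t => (rV_coord i \o f) t + (rV_coord i \o g) t)).
  exact: (measurable_funD (mf i) (mg i)).
by apply/funext => x; rewrite /rV_coord /= mxE.
Qed.

Lemma measurable_funN_rV d (T : measurableType d) (f : T -> 'rV[R]_n) :
  measurable_fun setT f -> measurable_fun setT (fun t => - f t).
Proof.
move=> /measurable_fun_rVP mf; apply/measurable_fun_rVP => i.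
rewrite (_ : _ \o _ = (fun t => - (rV_coord i \o f) t)).
  exact: (measurable_funN (mf i)).
by apply/funext => x; rewrite /rV_coord /= mxE.
Qed.

Lemma measurable_reflection v : measurable_fun setT (fun x => v - x).
Proof.
apply: measurable_funD_rV; first exact: measurable_cst.
by apply: measurable_funN_rV; exact: measurable_id.
Qed.

Lemma measurable_translation v : measurable_fun setT (fun x => x + v).
Proof.
apply: measurable_funD_rV; last exact: measurable_cst.
exact: measurable_id.
Qed.

(** Both measures agree on boxes, since lengths of intervals are invariant.
    Reflections are treated first because the composition of two of them is a
    translation. *)
Lemma lebesgue_rV_reflection v A : measurable A ->
  pushforward mu (fun x => v - x) A = mu A.
Proof.
move=> mA; apply/esym.
pose phi : {mfun 'rV[R]_n >-> 'rV[R]_n} :=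
  HB.pack (fun x => v - x) (isMeasurableFun.Build _ _ _ _ _ (measurable_reflection v)).
apply: (measure_unique (@oboxes R n) (fun k => obox (const_mx (- k%:R)) (const_mx k%:R))
  _ _ _ _ mu (pushforward mu phi)) => //.
- exact: measurable_rV_oboxes.
- exact: oboxesI.
- by move=> k; eexists (_, _).
- exact: obox_cover.
- move=> _ [[a b] _ <-] /=; rewrite /pushforward.
  rewrite (_ : _ @^-1` _ = obox (v - b) (v - a)); last first.
    apply/seteqP; split => x /= h i; have := h i; rewrite !mxE; lra.
  rewrite !lebesgue_rV_obox; apply: eq_bigr => i _.
  rewrite !lebesgue_measure_itv /= !mxE !lte_fin.
  have -> : (v 0 i - b 0 i < v 0 i - a 0 i) = (a 0 i < b 0 i) by apply/idP/idP; lra.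
  by case: ifP => // _; rewrite -!EFinD; congr EFin; lra.
- by move=> k; exact: lebesgue_rV_obox_lty.
Qed.

Local Open Scope ereal_scope.

Lemma ge0_integral_reflection v (f : 'rV[R]_n -> \bar R) :
  measurable_fun setT f -> (forall x, 0 <= f x) ->
  \int[mu]_x f (v - x)%R = \int[mu]_x f x.
Proof.
move=> mf f0.
have := @ge0_integral_pushforward _ _ _ _ R _ (measurable_reflection v) mu setT f
  measurableT mf (fun y _ => f0 y).
rewrite preimage_setT => <-.
apply: eq_measure_integral => [|? A mA _]; first exact: measurable_reflection.
exact: lebesgue_rV_reflection.
Qed.

Lemma ge0_integral_translation v (f : 'rV[R]_n -> \bar R) :
  measurable_fun setT f -> (forall x, 0 <= f x) ->
  \int[mu]_x f (x + v)%R = \int[mu]_x f x.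
Proof.
move=> mf f0; rewrite -(ge0_integral_reflection v mf f0).
rewrite -(ge0_integral_reflection 0).
- by apply: eq_integral => x _; rewrite sub0r addrC.
- exact: (measurableT_comp mf (measurable_translation v)).
- by move=> x; exact: f0.
Qed.

Lemma integral_reflection v (f : 'rV[R]_n -> \bar R) :
  measurable_fun setT f -> \int[mu]_x f (v - x)%R = \int[mu]_x f x.
Proof.
move=> mf; rewrite integralE [RHS]integralE.
rewrite -(ge0_integral_reflection v (measurable_funepos mf))//.
rewrite -(ge0_integral_reflection v (measurable_funeneg mf))//.
by congr (_ - _); apply: eq_integral => x _; rewrite ?funeposE ?funenegE.
Qed.

Lemma integral_translation v (f : 'rV[R]_n -> \bar R) :
  measurable_fun setT f -> \int[mu]_x f (x + v)%R = \int[mu]_x f x.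
Proof.
move=> mf; rewrite integralE [RHS]integralE.
rewrite -(ge0_integral_translation v (measurable_funepos mf))//.
rewrite -(ge0_integral_translation v (measurable_funeneg mf))//.
by congr (_ - _); apply: eq_integral => x _; rewrite ?funeposE ?funenegE.
Qed.

Lemma negligible_translation v (A : set 'rV[R]_n) :
  mu.-negligible A -> mu.-negligible [set x | A (x + v)%R].
Proof.
move=> [N [mN N0 AN]]; exists ((fun x => x + v)%R @^-1` N); split.
- by rewrite -[X in measurable X]setTI; exact: measurable_translation.
- have : \int[mu]_x (\1_N (x + v)%R)%:E = \int[mu]_x (\1_N x)%:E.
    apply: (@ge0_integral_translation v (fun x => (\1_N x)%:E)) => //.
    exact/measurable_EFinP.
  have -> : \int[mu]_x (\1_N (x + v)%R)%:E =
      \int[mu]_x (\1_((fun x => x + v)%R @^-1` N) x)%:E by [].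
  rewrite !integral_indic// ?setIT; first by move=> ->; exact: N0.
  by rewrite -[X in measurable X]setTI; exact: measurable_translation.
- by move=> x /AN.
Qed.

Lemma ae_translation v (P : 'rV[R]_n -> Prop) :
  {ae mu, forall x, P x} -> {ae mu, forall x, P (x + v)%R}.
Proof. by move=> /(negligible_translation v); apply: negligibleS => x. Qed.

End invariance.

(** * Tilings by a lattice *)

Section countable_ae.
Context d (T : measurableType d) (R : realType) (mu : {measure set T -> \bar R}).

Lemma ae_forall_count (I : countType) (P : I -> T -> Prop) :
  (forall i, {ae mu, forall x, P i x}) -> {ae mu, forall x, forall i, P i x}.
Proof.
move=> aeP.
have : {ae mu, forall x, forall n, oapp (P^~ x) True (@pickle_inv I n)}.
  apply/ae_foralln => n; case: (pickle_inv n) => [i|] /=; first exact: aeP.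
  exact: aeW.
apply: filterS => x Px i; have := Px (pickle i); by rewrite pickleK_inv.
Qed.

(** A series indexed by a countable type is enumerated by [pickle_inv], which
    reaches every index exactly once. *)
Lemma nneseries_countable1 (I : countType) (a : I -> \bar R) (k : I) :
  (forall l, 0 <= a l)%E -> (forall l, l != k -> a l = 0)%E ->
  (\sum_(n <oo) oapp a 0 (pickle_inv n) = a k)%E.
Proof.
move=> a0 ak; rewrite (@nneseriesD1 _ _ (pickle k) xpredT)//; last first.
  by move=> n _; case: (pickle_inv n) => /=.
rewrite pickleK_inv/= eseries0 ?adde0// => i _ ik.
have := @pickle_invK I i; case: (pickle_inv i) => //= l li; apply: ak.
by apply: contra ik => /eqP <-; rewrite -li.
Qed.

End countable_ae.

Section cell.
Context (R : realType) (d : nat).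
Local Notation mu := (lebesgue_rV R d).
Implicit Types (B : 'M[R]_d) (V : set 'rV[R]_d).

Lemma lattice_vecD B k l : lattice_vec B (k + l) = lattice_vec B k + lattice_vec B l.
Proof. by rewrite /lattice_vec map_mxD mulmxDl. Qed.

Lemma lattice_vecN B k : lattice_vec B (- k) = - lattice_vec B k.
Proof. by rewrite /lattice_vec map_mxN mulNmx. Qed.

(** Almost every point is moved into the cell by exactly one lattice vector. This
    form passes to translates of the cell, and holds at every point for the
    half-open lattice parallelepiped. *)
Definition tiling B V := measurable V /\
  {ae mu, forall x, exists k, V (x + lattice_vec B k) /\
    forall l, V (x + lattice_vec B l) -> l = k}.

(** The overlap hypothesis, stated for the cell itself, is transported along every
    lattice vector; countably many null sets are discarded. *)
Lemma unit_cell_tiling B V : unit_cell B V -> tiling B V.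
Proof.
move=> [mV cov disj]; split => //.
have aedisj : {ae mu, forall x, forall p : 'rV[int]_d * 'rV[int]_d, p.2 != 0 ->
    ~ (V `&` [set y + lattice_vec B p.2 | y in V]) (x + lattice_vec B p.1)}.
  apply: ae_forall_count => -[k m] /=; have [->|m0] := eqVneq m 0.
    by apply: aeW => x.
  have := negligible_translation (lattice_vec B k) (disj _ m0).
  by apply: negligibleS => x /= /not_implyP[_] /contrapT.
have aecov : {ae mu, forall x, (\bigcup_k [set y + lattice_vec B k | y in V]) x}.
  by apply: negligibleS cov => x.
near=> x.
have : (\bigcup_k [set y + lattice_vec B k | y in V]) x by near: x.
move=> [k _ [y Vy yx]]; exists (- k); rewrite lattice_vecN -yx addrK; split => //.
move=> l Vl; apply/eqP; apply: contrapT => /negP lk.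
have : forall p : 'rV[int]_d * 'rV[int]_d, p.2 != 0 ->
    ~ (V `&` [set y + lattice_vec B p.2 | y in V]) (x + lattice_vec B p.1) by near: x.
move=> /(_ (l, l + k)); rewrite /= addr_eq0 => /(_ lk); apply; rewrite -yx; split => //=.
by exists y => //; rewrite lattice_vecD addrCA addrC.
Unshelve. all: by end_near. Qed.

Local Open Scope ereal_scope.

(** The sum over the lattice of the indicators of the translates of [W]
    is 1 almost everywhere, so the integral over [V] is a sum of integrals over
    [V] cut by translates of [W]. Translating each term back gives the integral
    over [W] cut by the opposite translates of [V], and these cover [W]. *)
Lemma tiling_ge0_integral B V W (f : 'rV[R]_d -> \bar R) :
  tiling B V -> tiling B W -> measurable_fun setT f -> (forall x, 0 <= f x) ->
  lattice_periodic B f ->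
  \int[mu]_(x in V) f x = \int[mu]_(x in W) f x.
Proof.
move=> tV tW mf f0 pf; have [mV _] := tV; have [mW _] := tW.
have mtr k : measurable_fun setT (fun x : 'rV[R]_d => x + k)%R := measurable_translation k.
have mind (U : set 'rV[R]_d) k : measurable U ->
    measurable_fun setT (fun x : 'rV[R]_d => (\1_U (x + k)%R)%:E : \bar R).
  move=> mU; apply/measurable_EFinP.
  by apply: (measurableT_comp _ (mtr k)).
have E1 U : measurable U -> \int[mu]_(x in U) f x = \int[mu]_x (f x * (\1_U x)%:E).
  move=> mU; rewrite integral_mkcond; apply: eq_integral => x _.
  rewrite patchE indicE; case: ifP => _; by rewrite ?mule1 ?mule0.
have mind0 (U : set 'rV[R]_d) : measurable U ->
    measurable_fun setT (fun x : 'rV[R]_d => (\1_U x)%:E : \bar R).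
  by move=> mU; apply/measurable_EFinP.
pose g n := fun x => oapp (fun k => f x * (\1_V x)%:E * (\1_W (x + lattice_vec B k)%R)%:E) 0 (pickle_inv n).
pose h n := fun x => oapp (fun k => f x * (\1_W x)%:E * (\1_V (x - lattice_vec B k)%R)%:E) 0 (pickle_inv n).
rewrite !E1//.
have EV : \int[mu]_x (f x * (\1_V x)%:E) = \int[mu]_x \sum_(n <oo) g n x.
  apply: eq_integral_ae; have [_] := tW; apply: filterS => x [k [Wk kl]] _.
  rewrite (nneseries_countable1 (k := k)).
  + by rewrite [\1_W _]indicE mem_set// mule1.
  + by move=> l; rewrite !mule_ge0// ?f0// lee_fin.
  + move=> l lk; rewrite [\1_W _]indicE memNset ?mule0//.
    by move=> /kl /eqP; rewrite (negbTE lk).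
have EW : \int[mu]_x (f x * (\1_W x)%:E) = \int[mu]_x \sum_(n <oo) h n x.
  apply: eq_integral_ae; have [_] := tV; apply: filterS => x [k [Vk kl]] _.
  rewrite (nneseries_countable1 (k := (- k)%R)).
  + by rewrite lattice_vecN opprK [\1_V _]indicE mem_set// mule1.
  + by move=> l; rewrite !mule_ge0// ?f0// lee_fin.
  + move=> l lk; rewrite [\1_V _]indicE memNset ?mule0//.
    by rewrite -lattice_vecN => /kl /eqP; rewrite eqr_oppLR (negbTE lk).
have mg n : measurable_fun setT (g n).
  rewrite /g; case: (pickle_inv n) => //= k.
  apply: emeasurable_funM; last exact: mind.
  by apply: emeasurable_funM => //; exact: mind0.
have mh n : measurable_fun setT (h n).
  rewrite /h; case: (pickle_inv n) => //= k.
  apply: emeasurable_funM; last exact: mind.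
  by apply: emeasurable_funM => //; exact: mind0.
have g0 n x : 0 <= g n x.
  by rewrite /g; case: (pickle_inv n) => //= k; rewrite !mule_ge0// ?f0// lee_fin.
have h0 n x : 0 <= h n x.
  by rewrite /h; case: (pickle_inv n) => //= k; rewrite !mule_ge0// ?f0// lee_fin.
rewrite EV EW (integral_nneseries mu measurableT mg (fun n x _ => g0 n x)).
rewrite (integral_nneseries mu measurableT mh (fun n x _ => h0 n x)).
apply: eq_eseriesr => n _.
have := mg n; have := g0 n; rewrite /g /h; case: (pickle_inv n) => //= k gn0 mgn.
rewrite -(ge0_integral_translation (- lattice_vec B k) mgn gn0).
apply: eq_integral_ae.
have := pf (- k)%R; rewrite lattice_vecN; apply: filterS => x -> _.
by rewrite subrK muleAC.
Qed.

End cell.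

(** * Square-integrable functions, cubes and the lattice parallelepiped *)

Section square_integrable.
Context d (T : measurableType d) (R : realType) (mu : {measure set T -> \bar R}).
Variable D : set T.
Hypothesis mD : measurable D.
Implicit Types f g : T -> R.

(** Measurability is required on the whole space: the functions at hand are
    translated and restricted to various sets. *)
Definition square_integrable f := measurable_fun setT f /\
  mu.-integrable D (fun x => (f x ^+ 2)%:E).

Lemma le_integrable_ae f g : measurable_fun setT f ->
  mu.-integrable D (EFin \o g) -> {ae mu, forall x, D x -> `|f x| <= g x} ->
  mu.-integrable D (EFin \o f).
Proof.
move=> mf /integrableP[mg ig] fg; have mfD : measurable_fun D (EFin \o f).
  by apply/measurable_EFinP; apply: measurable_funTS.
apply/integrableP; split => //; apply: le_lt_trans ig.
apply: ae_ge0_le_integral => //.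
- exact: measurableT_comp.
- exact: measurableT_comp.
- apply: filterS fg => x /[apply] /= fg; rewrite lee_fin (le_trans fg)//.
  exact: ler_norm.
Qed.

Lemma square_integrable_mul f g : square_integrable f -> square_integrable g ->
  mu.-integrable D (EFin \o (fun x => f x * g x)).
Proof.
move=> [mf if2] [mg ig2].
apply: (@le_integrable_ae _ (fun x => f x ^+ 2 + g x ^+ 2)).
- exact: measurable_funM.
- rewrite (_ : _ \o _ = (fun x => (f x ^+ 2)%:E) \+ (fun x => (g x ^+ 2)%:E))%E //.
  exact: integrableD.
- apply: aeW => x _; rewrite ler_norml; nra.
Qed.

Lemma square_integrable_le (K : R) f g : measurable_fun setT f ->
  square_integrable g -> {ae mu, forall x, D x -> f x ^+ 2 <= K * g x ^+ 2} ->
  square_integrable f.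
Proof.
move=> mf [mg ig] fg; split => //.
apply: (@le_integrable_ae _ (fun x => K * g x ^+ 2)).
- exact: measurable_funX.
- rewrite (_ : _ \o _ = fun x => (K%:E * (g x ^+ 2)%:E)%E) //.
  exact: integrableZl.
- by apply: filterS fg => x /[apply]; rewrite ger0_norm ?sqr_ge0.
Qed.

Lemma square_integrableD f g : square_integrable f -> square_integrable g ->
  square_integrable (fun x => f x + g x).
Proof.
move=> [mf if2] [mg ig2]; split; first exact: measurable_funD.
apply: (@le_integrable_ae _ (fun x => 2 * (f x ^+ 2 + g x ^+ 2))).
- by apply: measurable_funX; exact: measurable_funD.
- rewrite (_ : _ \o _ = fun x => (2%:E * ((fun x => (f x ^+ 2)%:E) \+ (fun x => (g x ^+ 2)%:E)) x)%E) //.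
  by apply: integrableZl => //; exact: integrableD.
- apply: aeW => x _; rewrite ger0_norm ?sqr_ge0//; have := sqr_ge0 (f x - g x); nra.
Qed.

Lemma square_integrableZ (k : R) f : square_integrable f ->
  square_integrable (fun x => k * f x).
Proof.
move=> fL; apply: (square_integrable_le (K := k ^+ 2) _ fL).
  by apply: measurable_funM => //; exact: fL.1.
by apply: aeW => x _; rewrite exprMn.
Qed.

Lemma square_integrableB f g : square_integrable f -> square_integrable g ->
  square_integrable (fun x => f x - g x).
Proof.
move=> fL /(square_integrableZ (-1)) gL; have := square_integrableD fL gL.
by under eq_fun do rewrite mulN1r.
Qed.

Lemma square_integrable_cst (k : R) : (mu D < +oo)%E ->
  square_integrable (fun=> k).
Proof.
move=> Doo; split; first exact: measurable_cst.
apply/integrableP; split; first exact: measurable_cst.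
by rewrite integral_cst//= lte_mul_pinfty// ?lee_fin.
Qed.

Lemma square_integrable_sum I (r : seq I) (F : I -> T -> R) :
  (forall i, square_integrable (F i)) -> square_integrable (fun x => \sum_(i <- r) F i x).
Proof.
move=> FL; elim: r => [|i r ih].
  rewrite (_ : (fun _ => _) = fun=> 0); last by apply/funext => x; rewrite big_nil.
  split; first exact: measurable_cst.
  by rewrite (_ : (fun _ => _) = cst 0%E) ?integrable0//; apply/funext => x; rewrite expr0n.
rewrite (_ : (fun _ => _) = fun x => F i x + \sum_(i <- r) F i x).
  exact: square_integrableD.
by apply/funext => x; rewrite big_cons.
Qed.

End square_integrable.

Section cell2.
Context (R : realType) (d : nat).
Local Notation mu := (lebesgue_rV R d).
Implicit Types (B : 'M[R]_d) (V : set 'rV[R]_d).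

Definition cube (M : R) : set 'rV[R]_d := [set x | forall i, `|x 0 i| <= M].

Lemma cube_compact M : compact (cube M).
Proof.
rewrite (_ : cube M = [set x : 'rV[R]_d | forall i, `[(- M), M]%classic (x 0 i)]).
  apply: (@rV_compact _ _ (fun=> `[(- M), M]%classic)) => i.
  exact: segment_compact.
by apply/seteqP; split => x /= h i; have := h i; rewrite /= in_itv /= ler_norml.
Qed.

Lemma measurable_cube M : measurable (cube M).
Proof.
rewrite (_ : cube M =
  \bigcap_(i in [set: 'I_d]) (rV_coord i @^-1` `[(- M), M])); last first.
  apply/seteqP; split => x /= h i => [_|].
    by rewrite /rV_coord /= in_itv /= -ler_norml; exact: h.
  by have := h i Logic.I; rewrite /rV_coord /= in_itv /= -ler_norml.
apply: fin_bigcap_measurable => // i _.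
by rewrite -[X in measurable X]setTI; exact: measurable_rV_coord.
Qed.

Lemma cube_lty M : (mu (cube M) < +oo)%E.
Proof.
apply: le_lt_trans (lebesgue_rV_obox_lty (const_mx (- (M + 1))) (const_mx (M + 1))).
apply: le_measure; rewrite ?inE; [exact: measurable_cube|exact: measurable_obox|].
move=> x h i; have := h i; rewrite !mxE -ltr_norml => /le_lt_trans; apply; lra.
Qed.

Lemma cube_isometry (M c : R) (v x : 'rV[R]_d) : c ^+ 2 = 1 ->
  cube M (v + c *: x) -> cube (M + \sum_i `|v 0 i|) x.
Proof.
move=> c1 h i; have := h i; rewrite !mxE.
have vi : `|v 0 i| <= \sum_i `|v 0 i|.
  by rewrite (bigD1 i)//= lerDl; apply: sumr_ge0.
have -> : `|x 0 i| = `|c * x 0 i|.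
  by rewrite normrM (_ : `|c| = 1) ?mul1r//; apply/eqP; rewrite -sqrp_eq1// real_normK ?num_real// c1.
by move: vi; rewrite !ler_norml; move: (\sum_i _) => S; lra.
Qed.

Definition parallelepiped B : set 'rV[R]_d :=
  [set x | forall i, 0 <= (x *m invmx B) 0 i < 1].

Lemma measurable_parallelepiped B : measurable (parallelepiped B).
Proof.
rewrite (_ : parallelepiped B = \bigcap_(i in [set: 'I_d])
   ((fun x : 'rV[R]_d => (x *m invmx B) 0 i) @^-1` `[0, 1[)); last first.
  apply/seteqP; split => x /= h i => [_|].
    by rewrite /= in_itv /=; exact: h.
  by have := h i Logic.I; rewrite /= in_itv /=.
apply: fin_bigcap_measurable => // i _.
have mf : measurable_fun setT (fun x : 'rV[R]_d => (x *m invmx B) 0 i).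
  rewrite (_ : (fun _ => _) = fun x : 'rV[R]_d => \sum_j rV_coord j x * invmx B j i); last first.
    by apply/funext => x; rewrite mxE.
  apply: measurable_sum => j; apply: measurable_funM; last exact: measurable_cst.
  exact: measurable_rV_coord.
by rewrite -[X in measurable X]setTI; exact: mf.
Qed.

(** In lattice coordinates the parallelepiped is the half-open unit cube, and the
    unique lattice vector is given by the integer parts of the coordinates. *)
Lemma parallelepiped_tiling B : B \in unitmx -> tiling B (parallelepiped B).
Proof.
move=> uB; split; first exact: measurable_parallelepiped.
have E k x i : ((x + lattice_vec B k) *m invmx B) 0 i = (x *m invmx B) 0 i + (k 0 i)%:~R.
  by rewrite mulmxDl /lattice_vec mulmxK// !mxE.
apply: aeW => x; pose y := x *m invmx B; exists (\row_i - Num.floor (y 0 i)); split => [i|l hl].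
  have E2 : (\row_i - Num.floor (y 0 i)) 0 i = - Num.floor (y 0 i) by rewrite mxE.
  rewrite E E2 -/y.
  by have /andP[] := real_floor_itv (num_real (y 0 i)); rewrite mulrNz intrD; lra.
apply/rowP => i; rewrite mxE; apply/eqP; rewrite -eqr_oppLR; apply/eqP.
symmetry; apply: Num.Theory.floor_def.
by have /andP[h1 h2] := hl i; move: h1 h2; rewrite E intrD mulrNz; lra.
Qed.

Lemma parallelepiped_cube B : B \in unitmx -> exists2 M, 0 <= M & parallelepiped B `<=` cube M.
Proof.
move=> uB; exists (\sum_(i < d) \sum_(j < d) `|B j i|).
  by apply: sumr_ge0 => i _; apply: sumr_ge0.
move=> x hx i; rewrite (bigD1 i)//= ler_wpDr//.
  by apply: sumr_ge0 => j _; apply: sumr_ge0.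
rewrite -[x](mulmxKV uB) mxE (le_trans (ler_norm_sum _ _ _))//.
apply: ler_sum => j _; rewrite normrM ler_piMl//.
by have /andP[h1 h2] := hx j; rewrite ger0_norm// ltW.
Qed.

End cell2.

(** * Integrals of periodic functions over a cell *)

Section periodic.
Context (R : realType) (d : nat) (B : 'M[R]_d).
Local Notation mu := (lebesgue_rV R d).
Local Notation point := 'rV[R]_d.
Implicit Types (V W : set point) (h : point).

Lemma lattice_periodic_comp T U (F : T -> U) (f : point -> T) :
  lattice_periodic B f -> lattice_periodic B (fun x => F (f x)).
Proof. by move=> pf k; apply: filterS (pf k) => x ->. Qed.

Lemma lattice_periodic_comp2 T U S (F : T -> U -> S) (f : point -> T) (g : point -> U) :
  lattice_periodic B f -> lattice_periodic B g ->
  lattice_periodic B (fun x => F (f x) (g x)).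
Proof. by move=> pf pg k; apply: filterS2 (pf k) (pg k) => x -> ->. Qed.

Lemma lattice_periodic_sum I (r : seq I) (F : I -> point -> R) :
  (forall i, lattice_periodic B (F i)) ->
  lattice_periodic B (fun x => \sum_(i <- r) F i x).
Proof.
move=> pF; elim: r => [|i r ih] k.
  by apply: aeW => x; rewrite !big_nil.
by apply: filterS2 (pF i k) (ih k) => x + +; rewrite !big_cons => -> ->.
Qed.

Lemma lattice_periodic_shift T (f : point -> T) h :
  lattice_periodic B f -> lattice_periodic B (fun x => f (x + h)).
Proof.
by move=> pf k; apply: filterS (ae_translation h (pf k)) => x; rewrite addrAC.
Qed.

Lemma tiling_shift V h : tiling B V -> tiling B [set x | V (x + h)].
Proof.
move=> [mV uV]; split.
  rewrite -[X in measurable X]setTI; exact: measurable_translation.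
apply: filterS (ae_translation h uV) => x [k [Vk kl]]; exists k => /=.
by rewrite addrAC; split => // l; rewrite addrAC => /kl.
Qed.

Lemma tiling_integral V W (f : point -> \bar R) :
  tiling B V -> tiling B W -> measurable_fun setT f -> lattice_periodic B f ->
  (\int[mu]_(x in V) f x = \int[mu]_(x in W) f x)%E.
Proof.
move=> tV tW mf pf; rewrite integralE [RHS]integralE; congr (_ - _)%E;
  apply: (tiling_ge0_integral tV tW) => //; try exact: measurable_funepos;
  try exact: measurable_funeneg; move=> k;
  by apply: filterS (pf k) => x; rewrite ?funeposE ?funenegE => ->.
Qed.

Lemma tiling_integral_shift V (f : point -> \bar R) h :
  tiling B V -> measurable_fun setT f -> lattice_periodic B f ->
  (\int[mu]_(x in V) f (x + h)%R = \int[mu]_(x in V) f x)%E.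
Proof.
move=> tV mf pf.
have tW := tiling_shift (- h) tV.
rewrite [RHS](tiling_integral tV tW)// integral_mkcond [RHS]integral_mkcond.
rewrite -[RHS](integral_translation h).
  apply: eq_integral => x _; rewrite !patchE /=.
  suff -> : (x + h \in [set x | V (x - h)]) = (x \in V) by [].
  by apply/idP/idP; rewrite !inE /= addrK.
by apply/(measurable_restrictT _ _).1 => //; [case: tW|exact: measurable_funTS].
Qed.

Lemma tiling_integrable V W (f : point -> \bar R) :
  tiling B V -> tiling B W -> measurable_fun setT f -> lattice_periodic B f ->
  mu.-integrable V f -> mu.-integrable W f.
Proof.
move=> tV tW mf pf /integrableP[_ fV]; apply/integrableP; split.
  exact: measurable_funTS.
rewrite (tiling_integral tW tV)//; first exact: measurableT_comp.
exact: lattice_periodic_comp.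
Qed.

Lemma Rintegral_tiling_shift V (f : point -> R) h :
  tiling B V -> measurable_fun setT f -> lattice_periodic B f ->
  \int[mu]_(x in V) f (x + h) = \int[mu]_(x in V) f x.
Proof.
move=> tV mf pf; congr fine.
apply: (@tiling_integral_shift V (EFin \o f) h) => //; first exact/measurable_EFinP.
exact: lattice_periodic_comp.
Qed.

Hypothesis uB : B \in unitmx.

Lemma tiling_lty V : tiling B V -> (mu V < +oo)%E.
Proof.
move=> tV; have [M M0 PM] := parallelepiped_cube uB.
have tP := parallelepiped_tiling uB.
rewrite -[mu V]mul1e -integral_cst; last by case: tV.
rewrite (tiling_integral tV tP) //; last by move=> k; apply: aeW.
rewrite integral_cst; last by case: tP.
rewrite mul1e; apply: le_lt_trans (cube_lty d M).
by apply: le_measure; rewrite ?inE; [case: tP|exact: measurable_cube|].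
Qed.

(** The cell [V] may be unbounded; the integral of the square is transported to
    the lattice parallelepiped, which lies in a compact cube. *)
Lemma L2per_square_integrable V (f : point -> R) :
  tiling B V -> L2per B f -> square_integrable mu V f.
Proof.
move=> tV [[mf f2] pf]; split => //.
have [M M0 PM] := parallelepiped_cube uB.
have tP := parallelepiped_tiling uB.
apply: (tiling_integrable tP tV).
- by apply/measurable_EFinP; exact: measurable_funX.
- exact: (lattice_periodic_comp (fun y => (y ^+ 2)%:E) pf).
- have := f2 _ (@cube_compact _ _ M); apply: integrableS => //.
  + exact: measurable_cube.
  + by case: tP.
Qed.

Lemma L2per_square_integrable_shift V (f : point -> R) h :
  tiling B V -> L2per B f -> square_integrable mu V (fun x => f (x + h)).
Proof.
move=> tV fL; have [mf /integrableP[_ fi]] := L2per_square_integrable tV fL.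
have [_ pf] := fL.
have mfh : measurable_fun setT (fun x : point => f (x + h)).
  exact: (measurableT_comp mf (measurable_translation h)).
split => //; apply/integrableP; split.
  by apply/measurable_EFinP; apply: measurable_funTS; exact: measurable_funX.
rewrite (@tiling_integral_shift V (fun x => `|(f x ^+ 2)%:E|)%E h)//.
- apply: measurableT_comp => //; apply/measurable_EFinP; exact: measurable_funX.
- exact: (lattice_periodic_comp (fun y => `|(y ^+ 2)%:E|%E) pf).
Qed.

End periodic.

(** * Weak convergence in L^2 *)

Section weak_convergence.
Context d (T : measurableType d) (R : realType) (mu : {measure set T -> \bar R}).
Variable D : set T.
Hypotheses (mD : measurable D) (Doo : (mu D < +oo)%E).
Implicit Types f g h : T -> R.

Local Notation L2 := (square_integrable mu D).

(** The weighted form of the Cauchy-Schwarz inequality: [t] is chosen small to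
    absorb the bounded factor. *)
Lemma young_Rintegral (t : R) h g : 0 < t -> L2 h -> L2 g ->
  `|\int[mu]_(x in D) (h x * g x)| <=
  t * \int[mu]_(x in D) (h x ^+ 2) + t^-1 * \int[mu]_(x in D) (g x ^+ 2).
Proof.
move=> t0 hL gL; have := square_integrable_mul mD hL gL => ihg.
apply: le_trans (le_normr_Rintegral mD ihg) _.
have ih := hL.2; have ig := gL.2.
rewrite -!RintegralZl// -RintegralD//; last 2 first.
- rewrite (_ : _ \o _ = fun x => (t%:E * (h x ^+ 2)%:E)%E) //; exact: integrableZl.
- rewrite (_ : _ \o _ = fun x => (t^-1%:E * (g x ^+ 2)%:E)%E) //; exact: integrableZl.
apply: le_Rintegral => //.
- exact: (integrable_norm ihg).
- rewrite (_ : _ \o _ = (fun x => (t%:E * (h x ^+ 2)%:E)) \+ (fun x => (t^-1%:E * (g x ^+ 2)%:E)))%E //.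
  by apply: integrableD => //; exact: integrableZl.
- move=> x _.
  have : 0 <= t * (`|h x| - t^-1 * `|g x|) ^+ 2 by rewrite mulr_ge0 ?sqr_ge0// ltW.
  rewrite sqrrB exprMn !real_normK ?num_real// mulrDr mulrBr.
  have -> : t * (t^-1 ^+ 2 * g x ^+ 2) = t^-1 * g x ^+ 2 by field; lra.
  have -> : t * (`|h x| * (t^-1 * `|g x|) *+ 2) = `|h x * g x| *+ 2.
    by rewrite normrM -mulrnAr; field; lra.
  by have := normr_ge0 (h x * g x); lra.
Qed.

Variables (F : nat -> T -> R) (f : T -> R) (N : R).
Hypotheses (FL : forall n, L2 (F n)) (fL : L2 f).
Hypothesis FN : forall n, \int[mu]_(x in D) (F n x ^+ 2) <= N.
Hypothesis fN : \int[mu]_(x in D) (f x ^+ 2) <= N.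

(** For a sequence [F n] bounded in [L^2], the functions [g] against which [F n]
    converges weakly to [f] form a closed subspace. The lemmas below extend it
    from indicators of a pi-system to all measurable sets, then to [L^2]. *)
Definition tested_by g :=
  (fun n => \int[mu]_(x in D) (F n x * g x)) @ \oo --> \int[mu]_(x in D) (f x * g x).

Lemma eq_tested_by g h : {in D, g =1 h} -> tested_by g -> tested_by h.
Proof.
move=> gh; rewrite /tested_by.
have E k : \int[mu]_(x in D) (k x * g x) = \int[mu]_(x in D) (k x * h x).
  by apply: eq_Rintegral => x xD; rewrite gh.
by under eq_fun do rewrite E; rewrite E.
Qed.

Lemma tested_byD g h : L2 g -> L2 h ->
  tested_by g -> tested_by h -> tested_by (fun x => g x + h x).
Proof.
move=> gL hL cg ch; rewrite /tested_by.
have E k : L2 k -> \int[mu]_(x in D) (k x * (g x + h x)) =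
    \int[mu]_(x in D) (k x * g x) + \int[mu]_(x in D) (k x * h x).
  move=> kL; under eq_Rintegral do rewrite mulrDr.
  by rewrite RintegralD//; exact: square_integrable_mul.
by under eq_fun do rewrite E//; rewrite E//; exact: cvgD.
Qed.

Lemma tested_byZ (c : R) g : L2 g -> tested_by g -> tested_by (fun x => c * g x).
Proof.
move=> gL cg; rewrite /tested_by.
have E k : L2 k -> \int[mu]_(x in D) (k x * (c * g x)) =
    c * \int[mu]_(x in D) (k x * g x).
  move=> kL; under eq_Rintegral do rewrite mulrCA.
  by rewrite RintegralZl//; exact: square_integrable_mul.
by under eq_fun do rewrite E//; rewrite E//; exact: cvgMr.
Qed.

Lemma tested_by_sum I (r : seq I) (G : I -> T -> R) :
  (forall i, L2 (G i)) -> (forall i, tested_by (G i)) ->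
  tested_by (fun x => \sum_(i <- r) G i x).
Proof.
move=> GL tG; elim: r => [|i r ih].
  rewrite (_ : (fun _ => _) = fun x => 0 * 0); last first.
    by apply/funext => x; rewrite big_nil mulr0.
  apply: (@tested_byZ 0 (fun=> 0)); first exact: square_integrable_cst.
  rewrite /tested_by; have E k : \int[mu]_(x in D) (k x * 0) = 0 :> R.
    by under eq_Rintegral do rewrite mulr0; rewrite Rintegral_cst// mul0r.
  by under eq_fun do rewrite E; rewrite E; exact: cvg_cst.
rewrite (_ : (fun _ => _) = fun x => G i x + \sum_(i <- r) G i x).
  by apply: tested_byD => //; exact: square_integrable_sum.
by apply/funext => x; rewrite big_cons.
Qed.

(** Dominated convergence gives [g_ k --> g] in [L^2], and the bound [N] makes
    the errors of replacing [g] by [g_ k] uniform in [n]. *)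
Lemma tested_by_dominated (g_ : nat -> T -> R) g h :
  (forall k, measurable_fun setT (g_ k)) -> measurable_fun setT g -> L2 h ->
  (forall k x, D x -> `|g_ k x| <= h x) ->
  (forall x, D x -> g_ ^~ x @ \oo --> g x) ->
  (forall k, tested_by (g_ k)) -> tested_by g.
Proof.
move=> mg_ mg hL g_h g_g tg_.
have gh x : D x -> `|g x| <= h x.
  move=> Dx; have gx : (fun k => `|g_ k x|) @ \oo --> `|g x|.
    by apply: cvg_norm; exact: g_g.
  rewrite -(cvg_lim (@Rhausdorff R) gx).
  apply: limr_le; first by apply/cvg_ex; eexists; exact: gx.
  by apply: nearW => k; exact: g_h.
have g_L k : L2 (g_ k).
  apply: (square_integrable_le (K := 1) _ (mg_ k) hL) => //; apply: aeW => x Dx.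
  by rewrite mul1r -[leRHS]real_normK ?num_real// -real_normK ?num_real// lerXn2r ?nnegrE// (le_trans (g_h k x Dx))// ler_norm.
have gL : L2 g.
  apply: (square_integrable_le (K := 1) _ mg hL) => //; apply: aeW => x Dx.
  by rewrite mul1r -[leRHS]real_normK ?num_real// -real_normK ?num_real// lerXn2r ?nnegrE// (le_trans (gh x Dx))// ler_norm.
have dL k : L2 (fun x => g x - g_ k x) by exact: square_integrableB.
have d0 : (fun k => \int[mu]_(x in D) ((g x - g_ k x) ^+ 2)) @ \oo --> (0 : R).
  have mdk k : measurable_fun D (fun x => ((g x - g_ k x) ^+ 2)%:E).
    by apply/measurable_EFinP/measurable_funTS/measurable_funX/measurable_funB.
  have h1 : {ae mu, forall x, D x -> (fun k => ((g x - g_ k x) ^+ 2)%:E) @ \oo --> (0%:E : \bar R)}.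
    apply: aeW => x Dx; apply: cvg_EFin; first exact: nearW.
    rewrite [X in X @ _ --> _](_ : _ = fun k => (g x - g_ k x) ^+ 2)//.
    have c1 : (fun k => g x - g_ k x) @ \oo --> g x - g x.
      by apply: cvgB; [exact: cvg_cst|exact: g_g].
    have -> : (0 : R) = (g x - g x) * (g x - g x) by rewrite subrr mulr0.
    by under eq_fun do rewrite expr2; apply: cvgM.
  have h2 : mu.-integrable D (fun x => (4 * h x ^+ 2)%:E).
    rewrite (_ : (fun _ => _) = fun x => (4%:E * (h x ^+ 2)%:E)%E) //.
    exact: integrableZl hL.2.
  have h3 : {ae mu, forall x k, D x -> (`|((g x - g_ k x) ^+ 2)%:E| <= (4 * h x ^+ 2)%:E)%E}.
    apply: aeW => x k Dx; rewrite lee_fin ger0_norm ?sqr_ge0//.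
    have := gh x Dx; have := g_h k x Dx; rewrite !ler_norml; nra.
  have [_ _] := @dominated_convergence _ _ _ mu D mD
     (fun k x => ((g x - g_ k x) ^+ 2)%:E) (cst 0%E) (fun x => (4 * h x ^+ 2)%:E)
     mdk (measurable_cst _) h1 h2 h3.
  by rewrite integral0 => /fine_cvgP[].
rewrite /tested_by; apply/cvgrPdist_le => e e0.
have N0 : 0 <= N by apply: le_trans fN; apply: Rintegral_ge0 => x _; exact: sqr_ge0.
pose t := e / (8 * (N + 1)).
have t0 : 0 < t by rewrite divr_gt0// mulr_gt0//; lra.
have tN : t * N <= e / 8.
  rewrite /t (_ : e / (8 * (N + 1)) * N = e / 8 * (N / (N + 1))); last by field; lra.
  by rewrite ler_piMr ?ler_pdivrMr; lra.
move/cvgrPdist_le : d0 => /(_ (t * (e / 8)) (mulr_gt0 t0 _)) [|k _ /(_ k (leqnn k))].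
  by rewrite divr_gt0.
rewrite sub0r normrN ger0_norm; last by apply: Rintegral_ge0 => x _; exact: sqr_ge0.
move=> dk.
have key k' : L2 k' -> \int[mu]_(x in D) (k' x ^+ 2) <= N ->
    `|\int[mu]_(x in D) (k' x * g x) - \int[mu]_(x in D) (k' x * g_ k x)| <= e / 4.
  move=> kL kN; rewrite -RintegralB//; [|exact: square_integrable_mul..].
  under eq_Rintegral do rewrite -mulrBr.
  apply: le_trans (young_Rintegral t0 kL (dL k)) _.
  have : t * \int[mu]_(x in D) (k' x ^+ 2) <= t * N by rewrite ler_pM2l.
  have : t^-1 * \int[mu]_(x in D) ((g x - g_ k x) ^+ 2) <= e / 8.
    by rewrite ler_pdivrMl// mulrC in dk *.
  lra.
have := tg_ k; rewrite /tested_by => /cvgrPdist_le /(_ (e / 4)) [|n0 _ hn0].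
  by rewrite divr_gt0.
exists n0 => // n n0n /=; have := hn0 n n0n; have := key _ (FL n) (FN n).
by have := key _ fL fN; rewrite !ler_norml; lra.
Qed.

Lemma square_integrable_indic A : measurable A -> L2 (\1_A).
Proof.
move=> mA; apply: (square_integrable_le (K := 1) _ _ (square_integrable_cst mD 1 Doo)) => //.
by apply: aeW => x _; rewrite indicE; case: (_ \in _); rewrite ?expr1n ?expr0n ?mulr1.
Qed.

(** Complements use linearity and disjoint unions use dominated convergence of
    the partial sums of the indicators, so Dynkin's theorem applies. *)
Lemma tested_by_dynkin (G : set (set T)) :
  @measurable _ T = <<s G >> -> setI_closed G ->
  tested_by (cst 1) -> (forall A, G A -> tested_by \1_A) ->
  forall A, measurable A -> tested_by \1_A.
Proof.
move=> mG GI t1 tG A; rewrite mG; apply: (@dynkin_induction _ T G (fun A => tested_by \1_A)) => //.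
- apply: eq_tested_by t1 => x _; by rewrite indicE in_setT.
- move=> S mS tS.
  apply: (@eq_tested_by (fun x => cst 1 x + -1 * \1_S x)).
    by move=> x _; rewrite !indicE in_setC; case: (_ \in S) => /=; lra.
  have iS := square_integrable_indic mS.
  apply: tested_byD => //; [exact: square_integrable_cst|exact: square_integrableZ|].
  exact: tested_byZ.
- move=> E mE tE PE.
  have mU : measurable (\bigcup_k E k) by exact: bigcup_measurable.
  have sumE x k n : E k x -> \sum_(l < n) \1_(E l) x = (k < n)%:R :> R.
    move=> Ekx; elim: n => [|n ih]; first by rewrite big_ord0.
    rewrite big_ord_recr /= ih indicE.
    have -> : (x \in E n) = (k == n).
      have [kn|kn] := eqVneq k n; first by rewrite -kn mem_set.
      rewrite memNset// => Enx; move/trivIsetP : tE => /(_ _ _ Logic.I Logic.I kn).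
      by apply/eqP/set0P; exists x.
    by rewrite [in RHS]ltnS [in RHS]leq_eqVlt; case: (ltngtP k n) => _ /=; rewrite ?addr0 ?add0r.
  have sum0 x n : ~ (\bigcup_k E k) x -> \sum_(l < n) \1_(E l) x = 0 :> R.
    move=> nE; rewrite big1// => l _; rewrite indicE memNset// => Elx.
    by apply: nE; exists (l : nat).
  apply: (@tested_by_dominated (fun n x => \sum_(k < n) \1_(E k) x) _ (cst 1)).
  + by move=> n; apply: measurable_sum => k; exact: measurable_indic.
  + exact: measurable_indic.
  + exact: square_integrable_cst.
  + move=> n x _; have [[k _ Ekx]|nE] := pselect ((\bigcup_k E k) x).
      by rewrite (sumE _ _ _ Ekx); case: (_ < _)%N; rewrite ?normr1 ?normr0.
    by rewrite sum0// normr0.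
  + move=> x _; have [[k _ Ekx]|nE] := pselect ((\bigcup_k E k) x).
      under eq_fun do rewrite (sumE _ _ _ Ekx).
      rewrite indicE mem_set; last by exists k.
      by apply: cvg_near_cst; exists k.+1 => // n /= ->.
    under eq_fun do rewrite sum0//; rewrite indicE memNset//; exact: cvg_cst.
  + by move=> n; apply: tested_by_sum => k //; exact: square_integrable_indic.
Qed.

Hypothesis tested_by_indic : forall A, measurable A -> tested_by \1_A.

Import HBNNSimple.

Lemma tested_by_L2 g : L2 g -> tested_by g.
Proof.
suff pos h : L2 h -> (forall x, 0 <= h x) -> tested_by h.
  move=> gL; have mg := gL.1.
  have gp : L2 (g^\+).
    apply: (square_integrable_le (K := 1) _ _ gL) => //; first exact: measurable_funrpos.
    apply: aeW => x _; rewrite mul1r /funrpos /= /Num.max; case: ifP => // _.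
    by rewrite expr0n sqr_ge0.
  have gn : L2 (g^\-).
    apply: (square_integrable_le (K := 1) _ _ gL) => //; first exact: measurable_funrneg.
    apply: aeW => x _; rewrite mul1r /funrneg /= /Num.max; case: ifP => // _.
      by rewrite expr0n sqr_ge0.
    by rewrite sqrrN.
  rewrite (_ : g = fun x => g^\+ x + -1 * g^\- x).
    apply: tested_byD => //; first exact: square_integrableZ.
      by apply: pos => //.
    by apply: tested_byZ => //; apply: pos.
  apply/funext => x; rewrite -[in LHS](funrposBneg g) mulN1r.
  by [].
move=> hL h0; have mh := hL.1.
have mhE : measurable_fun setT (EFin \o h) by exact/measurable_EFinP.
pose g_ := nnsfun_approx measurableT mhE.
have mg_ k : measurable_fun setT (g_ k : T -> R) by [].
apply: (@tested_by_dominated (fun k => (g_ k : T -> R)) h h mg_ mh hL).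
- move=> k x _; rewrite ger0_norm// -lee_fin nnsfun_approxE.
  by apply: le_approx => // y _; exact: h0.
- move=> x _.
  have := @cvg_nnsfun_approx _ _ _ setT measurableT (EFin \o h) mhE (fun x _ => h0 x) x Logic.I.
  by move=> H; exact: (fine_cvg H).
- move=> k; rewrite (_ : (g_ k : T -> R) = fun x => \sum_(y <- finmap.enum_fset (fset_set (range (g_ k))))
      (y * \1_(g_ k @^-1` [set y]) x)).
    apply: tested_by_sum => i.
      by apply: square_integrableZ => //; exact: square_integrable_indic.
    by apply: tested_byZ; [exact: square_integrable_indic|exact: tested_by_indic].
  by apply/funext => x; rewrite fimfunE fsbig_finite.
Qed.

End weak_convergence.

(** * Weak continuity of translations in L^2 *)

Section translation_continuity.
Context (R : realType) (d : nat).
Local Notation mu := (lebesgue_rV R d).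
Local Notation point := 'rV[R]_d.
Implicit Types (f g : point -> R).

Lemma Rintegral_translation v f : measurable_fun setT f ->
  \int[mu]_x f (x + v) = \int[mu]_x f x.
Proof.
move=> mf; congr fine; apply: (@integral_translation _ _ v (EFin \o f)).
exact/measurable_EFinP.
Qed.

Lemma Rintegral_reflection v f : measurable_fun setT f ->
  \int[mu]_x f (v - x) = \int[mu]_x f x.
Proof.
move=> mf; congr fine; apply: (@integral_reflection _ _ v (EFin \o f)).
exact/measurable_EFinP.
Qed.

Lemma L2loc_cube f M : L2loc f -> square_integrable mu (cube M) f.
Proof. by move=> [mf f2]; split => //; apply: f2; exact: cube_compact. Qed.

Lemma obox_cube (M : R) : obox (const_mx (- M)) (const_mx M) `<=` cube (d := d) M.
Proof. by move=> x h i; have := h i; rewrite !mxE => /andP[? ?]; rewrite ler_norml !ltW. Qed.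

(** Needed because the indicator of a translated box converges to that of the box
    only off the boundary. *)
Lemma lebesgue_rV_hyperplane (i : 'I_d) (c : R) :
  mu.-negligible [set x : point | x 0 i = c].
Proof.
pose E (j : 'I_d) : set R := if j == i then [set c] else setT.
have mE j : measurable (E j : set (measurableTypeR R)).
  by rewrite /E; case: ifP => _; [exact: measurable_set1|exact: measurableT].
apply: (@negligibleS _ _ _ _ [set x : point | forall j, E j (x 0 j)]).
  by move=> x /= xi j; rewrite /E; case: eqP => // ->.
apply/negligibleP.
  rewrite (_ : mkset _ = \bigcap_(j in [set: 'I_d]) (rV_coord j @^-1` (E j))).
    apply: fin_bigcap_measurable => // j _.
    by rewrite -[X in measurable X]setTI; exact: measurable_rV_coord.
  by apply/seteqP; split => x /= h j => [_|]; exact: h.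
apply: etrans (lebesgue_rV_box mE) _.
by rewrite (bigD1 i)//= {1}/E eqxx lebesgue_measure_set1 mul0e.
Qed.

Lemma indic_obox_cvg (a b x : point) (u : nat -> point) :
  (forall i, (fun n => u n 0 i) @ \oo --> (0 : R)) ->
  (forall i, x 0 i <> a 0 i /\ x 0 i <> b 0 i) ->
  (fun n => \1_(obox a b) (x - u n)) @ \oo --> (\1_(obox a b) x : R).
Proof.
move=> u0 xab.
have ux i : (fun n => (x - u n) 0 i) @ \oo --> x 0 i.
  rewrite -[x 0 i]subr0; under eq_fun do rewrite !mxE.
  by apply: cvgB; [exact: cvg_cst|exact: u0].
apply: cvg_near_cst.
have [hx|/existsNP[i hi]] := pselect (obox a b x).
  have : \forall n \near \oo, forall i, a 0 i < (x - u n) 0 i < b 0 i.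
    apply: filter_forall => i; have /andP[h1 h2] := hx i.
    near=> n; apply/andP; split; near: n.
      exact: (cvgr_gt _ (ux i) _ h1).
    exact: (cvgr_lt _ (ux i) _ h2).
  by apply: filterS => n h; rewrite !indicE !mem_set.
have : \forall n \near \oo, ~ a 0 i < (x - u n) 0 i < b 0 i.
  have [xa xb] := xab i.
  have [h|h] : x 0 i < a 0 i \/ b 0 i < x 0 i.
    move: hi xa xb; case: (ltgtP (x 0 i) (a 0 i)) => //; [by left|].
    by case: (ltgtP (x 0 i) (b 0 i)) => //; right.
    near=> n; apply/negP; rewrite negb_and -!leNgt ltW//=.
    by near: n; exact: (cvgr_lt _ (ux i) _ h).
  near=> n; apply/negP; rewrite negb_and -!leNgt orbC ltW//=.
  by near: n; exact: (cvgr_gt _ (ux i) _ h).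
apply: filterS => n hn; rewrite !indicE !memNset//.
Unshelve. all: by end_near. Qed.

(** On the indicator of a box the translation is moved from [f] to the box, where
    dominated convergence applies; the general case follows by weak convergence
    tested on a pi-system, the squares of the translates being bounded by the
    integral over a larger cube. *)
Lemma translation_weak_continuity f g (M : R) (u : nat -> point) :
  L2loc f -> square_integrable mu (obox (const_mx (- M)) (const_mx M)) g ->
  (forall n, cube 1 (u n)) ->
  (forall i, (fun n => u n 0 i) @ \oo --> (0 : R)) ->
  (fun n => \int[mu]_(x in obox (const_mx (- M)) (const_mx M)) (f (x + u n) * g x))
    @ \oo --> \int[mu]_(x in obox (const_mx (- M)) (const_mx M)) (f x * g x).
Proof.
move=> fL gL u1 u0; set K := obox _ _.
have mK : measurable K by exact: measurable_obox.
have Koo : (mu K < +oo)%E by exact: lebesgue_rV_obox_lty.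
pose C := cube (d := d) (M + 1).
have mC : measurable C by exact: measurable_cube.
have fC : square_integrable mu C f by exact: L2loc_cube.
have mf := fC.1.
have KC n x : K (x - u n) -> C x.
  move=> /obox_cube h i; have := h i; have := u1 n i.
  by rewrite !mxE !ler_norml; lra.
have KC0 x : K x -> C x.
  by move=> /obox_cube h i; have := h i; rewrite !ler_norml; lra.
have mfu n : measurable_fun setT (fun x : point => f (x + u n)).
  exact: (measurableT_comp mf (measurable_translation (u n))).
pose N := \int[mu]_(x in C) (f x ^+ 2).
have mres (A : set point) (h : point -> R) : measurable A -> measurable_fun setT h ->
    measurable_fun setT ((EFin \o h) \_ A).
  by move=> mA mh; apply: (measurable_restrictT _ mA).1; exact/measurable_funTS/measurable_EFinP.
have le_fu n : (\int[mu]_(x in K) (f (x + u n) ^+ 2)%:E <= \int[mu]_(x in C) (f x ^+ 2)%:E)%E.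
  have mr : measurable_fun setT ((fun x : point => (f (x + u n) ^+ 2)%:E) \_ K).
    by apply: (mres K (fun x : point => f (x + u n) ^+ 2)) => //; exact: measurable_funX.
  rewrite integral_mkcond -(integral_translation (- u n))//.
  rewrite [leRHS]integral_mkcond; apply: ge0_le_integral => //.
  - by move=> x _; rewrite patchE; case: ifP => // _; rewrite lee_fin sqr_ge0.
  - exact: (measurableT_comp mr (measurable_translation (- u n))).
  - by apply: (mres C (fun x => f x ^+ 2)) => //; exact: measurable_funX.
  - move=> x _; rewrite !patchE subrK; case: ifPn => [/set_mem/KC Cx|_].
      by rewrite mem_set.
    by case: ifP => // _; rewrite lee_fin sqr_ge0.
have le_f : (\int[mu]_(x in K) (f x ^+ 2)%:E <= \int[mu]_(x in C) (f x ^+ 2)%:E)%E.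
  apply: ge0_subset_integral => //.
    by apply/measurable_EFinP/measurable_funTS; exact: measurable_funX.
  by move=> x _; rewrite lee_fin sqr_ge0.
have abs2 (A : set point) (h : point -> R) :
    (\int[mu]_(x in A) `|(h x ^+ 2)%:E| = \int[mu]_(x in A) (h x ^+ 2)%:E)%E.
  by apply: eq_integral => x _; rewrite gee0_abs// lee_fin sqr_ge0.
have f2oo : (\int[mu]_(x in C) (f x ^+ 2)%:E < +oo)%E.
  by have /integrableP[_] := fC.2; rewrite abs2.
have FL n : square_integrable mu K (fun x => f (x + u n)).
  split => //; apply/integrableP; split.
    by apply/measurable_EFinP; apply: measurable_funTS; exact: measurable_funX.
  by rewrite (abs2 K (fun x => f (x + u n))); exact: le_lt_trans (le_fu n) f2oo.
have fK : square_integrable mu K f.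
  by split => //; apply: integrableS fC.2.
have fin2 (A : set point) (h : point -> R) :
    (\int[mu]_(x in A) (h x ^+ 2)%:E <= \int[mu]_(x in C) (f x ^+ 2)%:E)%E ->
    \int[mu]_(x in A) (h x ^+ 2) <= N.
  move=> hf; apply: fine_le => //; rewrite ge0_fin_numE ?integral_ge0//.
  - exact: le_lt_trans hf f2oo.
  - by move=> x _; rewrite lee_fin sqr_ge0.
  - by move=> x _; rewrite lee_fin sqr_ge0.
have FN n : \int[mu]_(x in K) (f (x + u n) ^+ 2) <= N by exact: (fin2 K (fun x => f (x + u n))).
have fN : \int[mu]_(x in K) (f x ^+ 2) <= N by exact: fin2.
apply: (tested_by_L2 mK Koo FL fK FN fN) gL.
have tbox a b : tested_by mu K (fun n x => f (x + u n)) f (\1_(obox a b)).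
  have E h : \int[mu]_(x in K) (h x * \1_(obox a b) x) = \int[mu]_x (h x * \1_(K `&` obox a b) x).
    rewrite Rintegral_mkcond; apply: eq_Rintegral => x _.
    rewrite patchE !indicE in_setI; case: ifP => //= _; by rewrite mulr0.
  rewrite /tested_by E.
  rewrite (_ : (fun _ => _) = fun n => \int[mu]_(x in C) (f x * \1_(K `&` obox a b) (x - u n))); last first.
    apply/funext => n; rewrite E -(Rintegral_translation (- u n)).
      rewrite [RHS]Rintegral_mkcond; apply: eq_Rintegral => x _; rewrite subrK patchE.
      case: ifPn => // /negP xC; rewrite indicE memNset ?mulr0// => -[/KC Cx _].
      by apply: xC; exact: mem_set.
    by apply: measurable_funM => //; apply: measurable_indic; apply: measurableI => //; exact: measurable_obox.
  rewrite (_ : \int[mu]_x _ = \int[mu]_(x in C) (f x * \1_(K `&` obox a b) x)); last first.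
    rewrite [RHS]Rintegral_mkcond; apply: eq_Rintegral => x _; rewrite patchE.
    case: ifPn => // /negP xC; rewrite indicE memNset ?mulr0// => -[/KC0 Cx _].
    by apply: xC; exact: mem_set.
  rewrite /K oboxI; set a' := \row_i _; set b' := \row_i _.
  have m1 : measurable_fun setT (\1_(obox a' b') : point -> R).
    by apply: measurable_indic; exact: measurable_obox.
  have ifC : mu.-integrable C (EFin \o f).
    have := square_integrable_mul mC fC (square_integrable_cst mC 1 (cube_lty _ _)).
    by under [X in EFin \o X]eq_fun do rewrite mulr1.
  apply: fine_cvg; rewrite fineK; last first.
    apply: integrable_fin_num => //.
    apply: (@le_integrable_ae _ _ _ mu C mC (fun x => f x * \1_(obox a' b') x) (fun x => `|f x|)).
    - exact: measurable_funM.
    - exact: integrable_norm ifC.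
    - apply: aeW => x _; rewrite normrM ler_piMr// indicE.
      by case: (_ \in _); rewrite ?normr1 ?normr0.
  have [] := @dominated_convergence _ _ _ mu C mC
     (fun n x => (f x * \1_(obox a' b') (x - u n))%:E)
     (fun x => (f x * \1_(obox a' b') x)%:E) (fun x => `|f x|%:E); last by move=> _ _.
  - move=> n; apply/measurable_EFinP/measurable_funTS; apply: measurable_funM => //.
    exact: (measurableT_comp m1 (measurable_translation (- u n))).
  - by apply/measurable_EFinP/measurable_funTS; exact: measurable_funM.
  - have : {ae mu, forall x : point, forall i, x 0 i <> a' 0 i /\ x 0 i <> b' 0 i}.
      apply: ae_forall_count => i.
      have ha := lebesgue_rV_hyperplane i (a' 0 i).
      have hb := lebesgue_rV_hyperplane i (b' 0 i).
      apply: negligibleS (negligibleU ha hb) => x /= /not_andP[] /contrapT; by [left|right].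
    apply: filterS => x hx _; apply: cvg_EFin; first exact: nearW.
    by apply: cvgMr; exact: indic_obox_cvg.
  - exact: integrable_norm.
  - apply: aeW => x n _; rewrite lee_fin normrM ler_piMr// indicE.
    by case: (_ \in _); rewrite ?normr1 ?normr0.
apply: (tested_by_dynkin mK Koo FL fK FN fN (@measurable_rV_oboxes R d) (@oboxesI R d)).
- apply: eq_tested_by (tbox _ _) => x; rewrite inE => Kx /=.
  by rewrite indicE mem_set//; exact: Kx.
- by move=> _ [[a b] _ <-]; exact: tbox.
Qed.

End translation_continuity.

(** * The flat functions t^-n exp(-1/t) *)

Section flat.
Context (R : realType).
Implicit Types t : R.

(** The family is stable under differentiation up to linear combinations, which
    is why the powers [t^-n] are included. *)
Definition flat (n : nat) t : R := if 0 < t then t^-1 ^+ n * expR (- t^-1) else 0.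

Lemma flat_ge0 n t : 0 <= flat n t.
Proof. by rewrite /flat; case: ifP => // t0; rewrite mulr_ge0 ?expR_ge0// exprn_ge0// invr_ge0 ltW. Qed.

(** From [u^(n+2) <= (n+2)! exp u] at [u = 1/t]; the quadratic bound is what makes
    the derivative at the origin exist and vanish. *)
Lemma flat_le n t : flat n t <= n.+2`!%:R * t ^+ 2.
Proof.
rewrite /flat; case: ifPn => t0; last by rewrite mulr_ge0 ?sqr_ge0.
have i0 : 0 < t^-1 by rewrite invr_gt0.
have := expR_ge1Dxn n.+1 (ltW i0); set F := _%:R => h.
have F0 : 0 < F by rewrite ltr0n fact_gt0.
have h2 : t^-1 ^+ n.+2 <= F * expR (t^-1) by rewrite -ler_pdivrMl// mulrC; lra.
rewrite expRN ler_pdivrMr ?expR_gt0// -(ler_pM2r (exprn_gt0 2 i0)).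
have -> : F * t ^+ 2 * expR t^-1 * t^-1 ^+ 2 = F * expR t^-1 by field; rewrite gt_eqF.
by rewrite -exprD addn2.
Qed.

Lemma is_derive_flat n t :
  is_derive t 1 (flat n) (flat n.+2 t - n%:R * flat n.+1 t).
Proof.
have [t0|t0|<-] := ltgtP 0 t.
- have nf : \near t, (fun x => x^-1 ^+ n * expR (- x^-1)) t = flat n t.
    near=> x; rewrite /flat ifT//; near: x; exact: lt_nbhsr.
  apply: (near_eq_is_derive nf).
  have tn0 : t != 0 by rewrite gt_eqF.
  have d1 : is_derive t 1 (fun x : R => x^-1) (- t^-2).
    have -> : - t^-2 = - t ^- 2 *: (1 : R) by rewrite /GRing.scale /= mulr1.
    exact: is_deriveV.
  have d2 := is_deriveX n d1.
  have d3 : is_derive t 1 (fun x : R => expR (- x^-1)) (expR (- t^-1) * t^-2).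
    apply: (is_derive_eq (is_derive1_comp (is_derive_expR _) (is_deriveN d1))).
    by rewrite opprK.
  rewrite (_ : (fun x => _) = ((fun x : R => x^-1) ^+ n) * (fun x : R => expR (- x^-1))); last first.
    by apply/funext => x; rewrite [RHS]/(GRing.mul _ _) /= exprfctE.
  apply: (is_derive_eq (is_deriveM d2 d3)).
  rewrite exprfctE /flat t0 /GRing.scale /= -exprVn.
  move: (expR (- t^-1)) (t^-1) => E y; case: n {nf d2} => [|n] /=; last first.
    by move: (n.+1%:R) => N; rewrite !exprS; ring.
  by rewrite !mul0r expr0; ring.
- have nf : \near t, (cst 0) t = flat n t.
    near=> x; rewrite /flat ifF//; apply/negbTE; rewrite -leNgt ltW//.
    near: x; exact: lt_nbhsl.
  apply: (near_eq_is_derive nf).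
  by rewrite /flat !ifF; [rewrite mulr0 subr0; exact: is_derive_cst|apply/negbTE; rewrite -leNgt ltW..].
- rewrite /flat ltxx mulr0 subr0.
  have c : h^-1 *: ((flat n \o shift 0) (h *: 1) - flat n 0) @[h --> 0^'] --> (0 : R).
    apply/cvgr0Pnorm_le => e e0; near=> h.
    have h0 : h != 0 by near: h; exact: nbhs_dnbhs_neq.
    have he : `|h| <= e / n.+2`!%:R.
      near: h; apply: dnbhs0_le.
      by rewrite divr_gt0// ltr0n fact_gt0.
    rewrite /= addr0 [h *: 1]mulr1 [flat n 0]/flat ltxx subr0 normrM normfV.
    rewrite (ger0_norm (flat_ge0 _ _)) ler_pdivrMl ?normr_gt0//.
    apply: le_trans (flat_le n h) _.
    rewrite -(real_normK (num_real h)) expr2 mulrCA ler_wpM2l//.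
    by rewrite mulrC -ler_pdivlMr// ltr0n fact_gt0.
  by apply: DeriveDef; [apply/cvg_ex; exists 0|apply: cvg_lim].
Unshelve. all: by end_near. Qed.

End flat.

(** * Smooth bumps *)

Section bump_algebra.
Context (R : realType) (d : nat).
Local Notation point := 'rV[R]_d.
Implicit Types (f g u : point -> R) (x v : point).

(** A class of functions that is stable under partial derivatives and whose
    members are differentiable, hence smooth; measurability and stability under
    affine changes of variable also follow by induction. *)
Inductive bump_algebra : (point -> R) -> Prop :=
| bump_cst c : bump_algebra (fun=> c)
| bump_coord i : bump_algebra (fun x => x 0 i)
| bump_flat n u : bump_algebra u -> bump_algebra (fun x => flat n (u x))
| bump_add f g : bump_algebra f -> bump_algebra g ->
    bump_algebra (fun x => f x + g x)
| bump_mul f g : bump_algebra f -> bump_algebra g ->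
    bump_algebra (fun x => f x * g x).

Lemma differentiable_flat n (t : R) : differentiable (flat n) t.
Proof. by apply/derivable1_diffP; have [] := is_derive_flat n t. Qed.

Lemma bump_differentiable f : bump_algebra f -> forall x, differentiable f x.
Proof.
elim=> {f} [c|i|n u _ du|f g _ df _ dg|f g _ df _ dg] x.
- exact: differentiable_cst.
- exact: differentiable_coord.
- by apply: (@differentiable_comp _ _ _ _ u (flat n)) => //; exact: differentiable_flat.
- exact: (differentiableD (df x) (dg x)).
- exact: (differentiableM (df x) (dg x)).
Qed.

Lemma bump_measurable f : bump_algebra f -> measurable_fun setT f.
Proof.
elim=> {f} [c|i|n u _ mu|f g _ mf _ mg|f g _ mf _ mg].
- exact: measurable_cst.
- exact: (measurable_rV_coord i).
- apply: (measurableT_comp _ mu); apply: continuous_measurable_fun => t.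
  exact/differentiable_continuous/differentiable_flat.
- exact: measurable_funD.
- exact: measurable_funM.
Qed.

(** The chain rule, in the form that keeps the result in the bump algebra and
    shows that the partial derivatives of a bump vanish where the bump does. *)
Lemma partial_flat n u j x : differentiable u x ->
  partial j (fun y => flat n (u y)) x =
  (flat n.+2 (u x) - n%:R * flat n.+1 (u x)) * partial j u x.
Proof.
move=> du; rewrite /partial deriveE; last first.
  by apply: (@differentiable_comp _ _ _ _ u (flat n)) => //; exact: differentiable_flat.
rewrite (@diff_comp _ _ _ _ u (flat n))//=; last exact: differentiable_flat.
rewrite diff1E; last exact: differentiable_flat.
by rewrite deriveE//= derive1E; have [_ ->] := is_derive_flat n (u x); rewrite /GRing.scale /= mulrC.
Qed.

Lemma bump_partial f j : bump_algebra f -> bump_algebra (partial j f).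
Proof.
elim=> {f} [c|i|n u bu bpu|f g bf pf bg pg|f g bf pf bg pg].
- rewrite (_ : partial _ _ = fun=> 0); first exact: bump_cst.
  by apply/funext => x; rewrite /partial derive_cst.
- rewrite (_ : partial _ _ = fun=> (delta_mx 0 j : point) 0 i); first exact: bump_cst.
  apply/funext => x; rewrite /partial /derive; apply: cvg_lim => //.
  apply: cvg_near_cst; near=> h.
  have h0 : h != 0 by near: h; exact: nbhs_dnbhs_neq.
  by rewrite /= !mxE addrK /GRing.scale /= mulKf.
- rewrite (_ : partial _ _ = fun x => (flat n.+2 (u x) + (- n%:R) * flat n.+1 (u x)) * partial j u x).
    apply: bump_mul => //; apply: bump_add; first exact: bump_flat.
    by apply: bump_mul; [exact: bump_cst|exact: bump_flat].
  by apply/funext => x; rewrite partial_flat ?mulNr//; exact: bump_differentiable.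
- rewrite (_ : partial _ _ = fun x => partial j f x + partial j g x).
    exact: bump_add.
  apply/funext => x; rewrite /partial; apply: deriveD;
    by apply: diff_derivable; exact: bump_differentiable.
- rewrite (_ : partial _ _ = fun x => f x * partial j g x + g x * partial j f x).
    by apply: bump_add; exact: bump_mul.
  apply/funext => x; rewrite /partial; apply: deriveM;
    by apply: diff_derivable; exact: bump_differentiable.
Unshelve. all: by end_near. Qed.

Lemma bump_smooth f : bump_algebra f -> smooth f.
Proof.
move=> bf s x; apply: bump_differentiable.
by elim: s => //= j s; exact: bump_partial.
Qed.

Lemma bump_affine f (c : R) v : bump_algebra f -> bump_algebra (fun x => f (v + c *: x)).
Proof.
elim=> {f} [a|i|n u _ bu|f g _ bf _ bg|f g _ bf _ bg].
- exact: bump_cst.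
- rewrite (_ : (fun x => _) = fun x => v 0 i + c * x 0 i).
    apply: bump_add; first exact: bump_cst.
    by apply: bump_mul; [exact: bump_cst|exact: bump_coord].
  by apply/funext => x; rewrite !mxE.
- exact: bump_flat.
- exact: bump_add.
- exact: bump_mul.
Qed.

Lemma partial_affine f (c : R) v j x : (forall y, differentiable f y) ->
  partial j (fun y => f (v + c *: y)) x = c * partial j f (v + c *: x).
Proof.
move=> df.
pose a : point -> point := cst v + c *: id.
have ida : is_diff x a (0 + c *: id : point -> point) by exact: is_diffD.
have [da dE] := ida.
rewrite /partial (_ : (fun y => f (v + c *: y)) = f \o a)//.
rewrite deriveE; last exact: (differentiable_comp da).
rewrite (diff_comp da) //= deriveE// dE.
have -> : (0 + c *: id : point -> point) (delta_mx 0 j) = c *: delta_mx 0 j.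
  by rewrite [LHS]add0r.
by rewrite linearZ.
Qed.

Lemma bump_sum I (r : seq I) (F : I -> point -> R) :
  (forall i, bump_algebra (F i)) -> bump_algebra (fun x => \sum_(i <- r) F i x).
Proof.
move=> bF; elim: r => [|i r ih].
  by rewrite (_ : (fun _ => _) = fun=> 0); [exact: bump_cst|apply/funext => x; rewrite big_nil].
rewrite (_ : (fun _ => _) = fun x => F i x + \sum_(i <- r) F i x).
  exact: bump_add.
by apply/funext => x; rewrite big_cons.
Qed.

(** Positive exactly inside the ball of squared radius [r]. *)
Definition ball_defect (r : R) x := r - \sum_i x 0 i ^+ 2.

Lemma bump_ball_defect r : bump_algebra (ball_defect r).
Proof.
rewrite (_ : ball_defect r = fun x => r + -1 * \sum_i x 0 i * x 0 i).
  apply: bump_add; first exact: bump_cst.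
  apply: bump_mul; first exact: bump_cst.
  by apply: bump_sum => i; apply: bump_mul; exact: bump_coord.
by apply/funext => x; rewrite /ball_defect mulN1r.
Qed.

Definition bump (r : R) x := flat 0 (ball_defect r x).

Lemma bump_in_bump_algebra r : bump_algebra (bump r).
Proof. by apply: bump_flat; exact: bump_ball_defect. Qed.

Lemma ball_defect_gt0 r x : 0 < ball_defect r x -> forall i, x 0 i ^+ 2 < r.
Proof.
rewrite subr_gt0 => h i; apply: le_lt_trans h; rewrite (bigD1 i)//= lerDl.
by apply: sumr_ge0 => j _; exact: sqr_ge0.
Qed.

Lemma ball_defect_cube r x : ~ cube (r + 1) x -> ball_defect r x <= 0.
Proof.
move=> nx; rewrite leNgt; apply/negP => /ball_defect_gt0 h; apply: nx => i.
have := h i; rewrite ler_norml => hi; apply/andP; split; nra.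
Qed.

Lemma bump0 r x : ~ cube (r + 1) x -> bump r x = 0.
Proof. by move=> /ball_defect_cube h; rewrite /bump /flat ltNge h. Qed.

Lemma partial_bump0 r j x : ~ cube (r + 1) x -> partial j (bump r) x = 0.
Proof.
move=> /ball_defect_cube h; rewrite partial_flat; last exact: bump_differentiable (bump_ball_defect r) x.
by rewrite /flat ltNge h /= mulr0 subrr mul0r.
Qed.

Lemma bump_ge0 r x : 0 <= bump r x. Proof. exact: flat_ge0. Qed.

Lemma bump_gt0 r x : 0 < ball_defect r x -> 0 < bump r x.
Proof. by move=> h; rewrite /bump /flat h expr0 mul1r expR_gt0. Qed.

Lemma bump_bounded f M : bump_algebra f -> (forall x, ~ cube M x -> f x = 0) ->
  exists C, forall x, `|f x| <= C.
Proof.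
move=> bf f0.
have [[x0 Mx0]|M0] := pselect (cube (d := d) M !=set0); last first.
  by exists 0 => x; rewrite f0 ?normr0// => Mx; apply: M0; exists x.
have cf : {within cube M, continuous (fun x => `|f x|)}.
  apply: continuous_subspaceT => x; apply: (@continuous_comp _ _ _ f).
    exact/differentiable_continuous/bump_differentiable.
  exact: norm_continuous.
have [c _ hc] := @EVT_max_rV _ _ _ (cube M) (ex_intro _ x0 Mx0) (@cube_compact _ _ M) cf.
exists `|f c| => x; have [Mx|Mx] := pselect (cube M x); first by apply: hc; exact: mem_set.
by rewrite f0// normr0.
Qed.

(** With [c = 1] and [c = -1] this gives the translates of a bump and of its
    reflection. *)
Lemma test_function_bump_affine r (c : R) v : c ^+ 2 = 1 ->
  test_function (fun x => bump r (v + c *: x)).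
Proof.
move=> c1; split; first by apply/bump_smooth/bump_affine/bump_in_bump_algebra.
exists (cube (r + 1 + \sum_i `|v 0 i|)); first exact: cube_compact.
by move=> x nx; apply: bump0 => h; exact: nx (cube_isometry c1 h).
Qed.

End bump_algebra.

(** * Integrals against bounded functions of bounded support *)

Section Rfubini.
Context d1 d2 (T1 : measurableType d1) (T2 : measurableType d2) (R : realType).
Variable m1 : {sigma_finite_measure set T1 -> \bar R}.
Variable m2 : {sigma_finite_measure set T2 -> \bar R}.
Variable f : T1 * T2 -> R.
Hypothesis intf : (m1 \x m2)%E.-integrable setT (EFin \o f).
Hypothesis int1 : forall x, m2.-integrable setT (EFin \o (fun y => f (x, y))).
Hypothesis int2 : forall y, m1.-integrable setT (EFin \o (fun x => f (x, y))).

Let E1 x : ((\int[m2]_y f (x, y))%:E = \int[m2]_y (EFin \o f) (x, y))%E.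
Proof. by rewrite /Rintegral fineK//; exact: (integrable_fin_num measurableT (int1 x)). Qed.

Let E2 y : ((\int[m1]_x f (x, y))%:E = \int[m1]_x (EFin \o f) (x, y))%E.
Proof. by rewrite /Rintegral fineK//; exact: (integrable_fin_num measurableT (int2 y)). Qed.

Lemma integrable_Rintegral1 :
  m1.-integrable setT (EFin \o (fun x => \int[m2]_y f (x, y))).
Proof.
rewrite (_ : _ \o _ = fun x => \int[m2]_y (EFin \o f) (x, y))%E.
  exact: integrable_fubini_F.
by apply/funext => x; exact: E1.
Qed.

Lemma integrable_Rintegral2 :
  m2.-integrable setT (EFin \o (fun y => \int[m1]_x f (x, y))).
Proof.
rewrite (_ : _ \o _ = fun y => \int[m1]_x (EFin \o f) (x, y))%E; last first.
  by apply/funext => x; exact: E2.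
have mf := measurable_int _ intf.
have mG := measurable_fubini_G intf.
apply/integrableP; split; first exact: mG.
apply: le_lt_trans ((integrable21ltyP m1 m2 mf).1 intf).
apply: ge0_le_integral => //.
- exact: measurableT_comp.
- apply: (measurable_fun_fubini_tonelli_G (m1 := m1) (abse \o (EFin \o f))) => //=.
  exact: measurableT_comp.
- move=> y _; apply: le_abse_integral => //.
  exact: (measurable_int _ (int2 y)).
Qed.

Lemma Rintegral_Fubini :
  \int[m1]_x \int[m2]_y f (x, y) = \int[m2]_y \int[m1]_x f (x, y).
Proof.
congr fine; under eq_integral do rewrite E1.
under [RHS]eq_integral do rewrite E2.
exact: Fubini.
Qed.

End Rfubini.

Section test_integrals.
Context (R : realType) (d : nat).
Local Notation mu := (lebesgue_rV R d).
Local Notation point := 'rV[R]_d.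
Implicit Types (f g phi : point -> R) (x v : point).

(** All that Fubini's theorem needs of a bump and of its partial derivatives. *)
Definition bounded_support phi := measurable_fun setT phi /\
  exists M C : R, (forall x, `|phi x| <= C) /\ (forall x, ~ cube M x -> phi x = 0).

Lemma bounded_support_affine phi (c : R) v : c ^+ 2 = 1 -> bounded_support phi ->
  bounded_support (fun x => phi (v + c *: x)).
Proof.
move=> c1 [mphi [M [C [hC hM]]]]; split.
  apply: (measurableT_comp mphi); apply: measurable_funD_rV; first exact: measurable_cst.
  apply/measurable_fun_rVP => i.
  rewrite (_ : _ \o _ = fun x => c * rV_coord i x); last first.
    by apply/funext => x; rewrite /rV_coord /= mxE.
  by apply: measurable_funM; [exact: measurable_cst|exact: measurable_rV_coord].
by exists (M + \sum_i `|v 0 i|), C; split => // x nx; apply: hM => h; exact: nx (cube_isometry c1 h).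
Qed.

Lemma bounded_support_shift phi v : bounded_support phi ->
  bounded_support (fun x => phi (x - v)).
Proof.
move=> /(bounded_support_affine (- v) (expr1n R 2)).
by under eq_fun do rewrite scale1r addrC.
Qed.

Lemma bounded_support_reflection phi v : bounded_support phi ->
  bounded_support (fun x => phi (v - x)).
Proof.
have c1 : (- 1 : R) ^+ 2 = 1 by rewrite sqrrN expr1n.
move=> /(bounded_support_affine v c1).
by under eq_fun do rewrite scaleN1r.
Qed.

Lemma bounded_support_bump r : bounded_support (bump (d := d) r).
Proof.
split; first exact: (bump_measurable (bump_in_bump_algebra d r)).
have [C hC] := bump_bounded (bump_in_bump_algebra d r) (@bump0 R d r).
by exists (r + 1), C; split => // x; exact: bump0.
Qed.

Lemma bounded_support_partial_bump r j : bounded_support (partial j (bump (d := d) r)).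
Proof.
have b := bump_partial j (bump_in_bump_algebra d r).
split; first exact: bump_measurable.
have [C hC] := bump_bounded b (@partial_bump0 R d r j).
by exists (r + 1), C; split => // x; exact: partial_bump0.
Qed.

(** The support lies in a cube of finite measure, on which both factors are
    square-integrable. *)
Lemma integrable_mul_bounded_support f phi :
  (forall M, square_integrable mu (cube M) f) -> bounded_support phi ->
  mu.-integrable setT (EFin \o (fun x => f x * phi x)).
Proof.
move=> fL [mphi [M [C [hC hM]]]].
have mC : measurable (cube (d := d) M) by exact: measurable_cube.
have fL2 := fL M.
have phiL2 : square_integrable mu (cube M) phi.
  apply: (square_integrable_le mC (K := C ^+ 2) mphi (square_integrable_cst mC 1 (cube_lty _ _))).
  apply: aeW => x _; rewrite expr1n mulr1 -real_normK ?num_real//.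
  by rewrite lerXn2r ?nnegrE// (le_trans _ (hC x)).
have := square_integrable_mul mC fL2 phiL2.
rewrite (integrable_mkcond _ mC); congr (integrable _ _ _).
apply/funext => x; rewrite patchE; case: ifPn => // /negP xM.
by rewrite /= hM ?mulr0// => Mx; apply: xM; exact: mem_set.
Qed.

Lemma integrable_L2loc_bounded_support f phi : L2loc f -> bounded_support phi ->
  mu.-integrable setT (EFin \o (fun x => f x * phi x)).
Proof. by move=> fL; apply: integrable_mul_bounded_support => M; exact: L2loc_cube. Qed.

Lemma integrable_bounded_support phi : bounded_support phi ->
  mu.-integrable setT (EFin \o phi).
Proof.
move=> hphi; have := @integrable_mul_bounded_support (fun=> 1) phi _ hphi.
under [X in EFin \o X]eq_fun do rewrite mul1r; apply => M.
by apply: square_integrable_cst; [exact: measurable_cube|exact: cube_lty].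
Qed.

Lemma integrable_translation f v : mu.-integrable setT (EFin \o f) ->
  mu.-integrable setT (EFin \o (fun x => f (x + v))).
Proof.
move=> /integrableP[mf fi]; have mfv : measurable_fun setT (EFin \o (fun x => f (x + v))).
  exact: (measurableT_comp mf (measurable_translation v)).
apply/integrableP; split => //; apply: le_lt_trans fi; rewrite le_eqVlt; apply/orP; left; apply/eqP.
apply: (@ge0_integral_translation _ _ v (fun x => `|(EFin \o f) x|%E)) => //.
exact: measurableT_comp.
Qed.

End test_integrals.

(** * Smeared correlations of periodic functions *)

Section pairing.
Context (R : realType) (d : nat) (B : 'M[R]_d) (uB : B \in unitmx).
Local Notation mu := (lebesgue_rV R d).
Local Notation point := 'rV[R]_d.
Variable Q : set point.
Hypothesis tQ : tiling B Q.
Implicit Types (f g rho : point -> R) (x h : point).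

Let mQ : measurable Q. Proof. by case: tQ. Qed.

Section fg.
Variables f g rho : point -> R.
Hypotheses (fL : L2per B f) (gL : L2per B g) (rhoB : bounded_support rho).

Let mf : measurable_fun setT f. Proof. by case: fL => -[]. Qed.
Let mg : measurable_fun setT g. Proof. by case: gL => -[]. Qed.
Let mrho : measurable_fun setT rho. Proof. by case: rhoB. Qed.
Let fQ := L2per_square_integrable uB tQ fL.
Let gQ h := L2per_square_integrable_shift uB h tQ gL.

Lemma integrable_correlation h :
  mu.-integrable Q (EFin \o (fun x => f x * g (x + h))).
Proof. exact: (square_integrable_mul mQ fQ (gQ h)). Qed.

Let F (p : point * point) := (f \_ Q) p.1 * (g (p.1 + p.2) * rho p.2).

Let mF : measurable_fun setT F.
Proof.
have mfQ : measurable_fun setT (f \_ Q).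
  by apply: (measurable_restrictT _ mQ).1; exact: measurable_funTS.
apply: measurable_funM; first exact: (measurableT_comp mfQ measurable_fst).
apply: measurable_funM; last exact: (measurableT_comp mrho measurable_snd).
by apply: (measurableT_comp mg); exact: measurable_funD_rV measurable_fst measurable_snd.
Qed.

Let F1 x : mu.-integrable setT (EFin \o (fun h => F (x, h))).
Proof.
rewrite (_ : _ \o _ = fun h => (((f \_ Q) x)%:E * (EFin \o (fun h => g (x + h) * rho h)%R) h)%E) //.
apply: integrableZl => //.
have := integrable_translation x (integrable_L2loc_bounded_support gL.1 (bounded_support_shift x rhoB)).
by under eq_fun do rewrite addrK addrC.
Qed.

Let F2 h : mu.-integrable setT (EFin \o (fun x => F (x, h))).
Proof.
have := integrableZl mQ (rho h) (integrable_correlation h).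
rewrite (integrable_mkcond _ mQ); congr (integrable _ _ _).
apply/funext => x; rewrite /F patchE /= patchE; case: ifP => _; last by rewrite mul0r.
by rewrite -EFinM; congr EFin; ring.
Qed.

(** By [2 |ab| <= a^2 + b^2] the inner integral of the absolute value at [h] is at
    most [`|rho h|] times a constant: by periodicity the integral over the cell
    of the square of a translate of [g] does not depend on the translation. *)
Let intF : (mu \x mu)%E.-integrable setT (EFin \o F).
Proof.
apply/integrable21ltyP; first exact/measurable_EFinP.
pose A := (\int[mu]_(x in Q) (f x ^+ 2)%:E + \int[mu]_(x in Q) (g x ^+ 2)%:E)%E.
have nn (k : point -> R) : (0 <= \int[mu]_(x in Q) (k x ^+ 2)%:E)%E.
  by apply: integral_ge0 => x _; rewrite lee_fin sqr_ge0.
have fin (k : point -> R) : square_integrable mu Q k -> (\int[mu]_(x in Q) (k x ^+ 2)%:E)%E \is a fin_num.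
  by move=> [_ ik]; exact: integrable_fin_num.
have gQ0 := L2per_square_integrable uB tQ gL.
have Afin : A \is a fin_num by rewrite fin_numD !fin.
have bound h : (\int[mu]_x `|(EFin \o F) (x, h)| <= `|rho h|%:E * A)%E.
  have mk (k : point -> R) : measurable_fun setT k -> measurable_fun Q (fun x => (k x ^+ 2)%:E).
    by move=> mk; apply/measurable_EFinP/measurable_funTS/measurable_funX.
  have mgh := (gQ h).1.
  have -> : A = (\int[mu]_(x in Q) ((f x ^+ 2)%:E + (g (x + h) ^+ 2)%:E))%E.
    rewrite ge0_integralD//; [|by move=> x _; rewrite lee_fin sqr_ge0|exact: mk
      |by move=> x _; rewrite lee_fin sqr_ge0|exact: mk].
    congr (_ + _)%E; rewrite (@tiling_integral_shift _ _ B Q (fun x => (g x ^+ 2)%:E) h tQ)//.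
      by apply/measurable_EFinP/measurable_funX.
    exact: (lattice_periodic_comp (fun y => (y ^+ 2)%:E) gL.2).
  rewrite -ge0_integralZl//; last 2 first.
  - by apply: emeasurable_funD; exact: mk.
  - by move=> x _; rewrite -EFinD lee_fin addr_ge0 ?sqr_ge0.
  rewrite [leRHS]integral_mkcond; apply: ge0_le_integral => //.
  - exact: (measurableT_comp _ (measurable_int _ (F2 h))).
  - apply: (measurable_restrictT _ mQ).1; apply: emeasurable_funM; first exact: measurable_cst.
    by apply: emeasurable_funD; exact: mk.
  - move=> x _; rewrite patchE /F /= patchE; case: ifP => _; last by rewrite mul0r normr0.
    rewrite -EFinD -EFinM lee_fin mulrA [leRHS]mulrC normrM ler_wpM2r//.
    by rewrite ler_norml; have := sqr_ge0 (f x - g (x+h)); have := sqr_ge0 (f x + g (x + h)); nra.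
apply: (@le_lt_trans _ _ (\int[mu]_h (`|rho h|%:E * A))%E).
  apply: ge0_le_integral => //.
  - by move=> h _; apply: integral_ge0.
  - apply: (measurable_fun_fubini_tonelli_G (m1 := mu) (abse \o (EFin \o F))) => //=.
    by apply: measurableT_comp => //; exact/measurable_EFinP.
  - apply: emeasurable_funM; last exact: measurable_cst.
    by apply/measurable_EFinP; exact: measurableT_comp.
rewrite -(fineK Afin) ge0_integralZr//; last 2 first.
- by apply/measurable_EFinP; exact: measurableT_comp.
- by rewrite lee_fin fine_ge0// adde_ge0.
have /integrableP[_ rhooo] := integrable_bounded_support rhoB.
by rewrite lte_mul_pinfty ?integral_ge0 ?ltry// ge0_fin_numE ?integral_ge0.
Qed.

Let inner1 x : \int[mu]_h F (x, h) = (f \_ Q) x * \int[mu]_z (g z * rho (z - x)).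
Proof.
have mh : measurable_fun setT (fun z => g z * rho (z - x)).
  by apply: measurable_funM => //; apply: (measurableT_comp mrho (measurable_translation (- x))).
have ih := integrable_L2loc_bounded_support gL.1 (bounded_support_shift x rhoB).
rewrite -(Rintegral_translation x mh) -RintegralZl//; last exact: (integrable_translation x ih).
by apply: eq_Rintegral => h _; rewrite /F /= addrK addrC.
Qed.

Let inner2 h : \int[mu]_x F (x, h) = rho h * \int[mu]_(x in Q) (f x * g (x + h)).
Proof.
rewrite -RintegralZl//; last exact: integrable_correlation.
rewrite [RHS]Rintegral_mkcond; apply: eq_Rintegral => x _; rewrite /F /= !patchE.
case: ifP => _ /=; last by rewrite mul0r.
by rewrite mulrA [RHS]mulrC.
Qed.

Lemma integrable_correlation_test :
  mu.-integrable Q (EFin \o (fun x => f x * \int[mu]_z (g z * rho (z - x)))).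
Proof.
have := integrable_Rintegral1 intF F1.
rewrite (integrable_mkcond _ mQ); congr (integrable _ _ _).
apply/funext => x; rewrite patchE /= inner1 patchE; case: ifP => _ //.
by rewrite mul0r.
Qed.

Lemma integrable_weighted_correlation :
  mu.-integrable setT (EFin \o (fun h => rho h * \int[mu]_(x in Q) (f x * g (x + h)))).
Proof.
have := integrable_Rintegral2 intF F2; congr (integrable _ _ _).
by apply/funext => h /=; rewrite inner2.
Qed.

(** Fubini, followed by the change of variable [z = x + h] in the inner integral;
    the average against [rho] is moved onto [g]. *)
Lemma correlation_swap :
  \int[mu]_h (rho h * \int[mu]_(x in Q) (f x * g (x + h))) =
  \int[mu]_(x in Q) (f x * \int[mu]_z (g z * rho (z - x))).
Proof.
under eq_Rintegral do rewrite -inner2.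
rewrite -(Rintegral_Fubini intF F1 F2) [RHS]Rintegral_mkcond.
apply: eq_Rintegral => x _; rewrite inner1 !patchE; case: ifP => _ //.
by rewrite mul0r.
Qed.

End fg.

(** Moving the average onto [f] instead: by periodicity the correlation of [f] and
    [g] at [h] is that of [g] and [f] at [-h]. *)
Lemma correlation_swap_reflected f g rho :
  L2per B f -> L2per B g -> bounded_support rho ->
  \int[mu]_h (rho h * \int[mu]_(x in Q) (f x * g (x + h))) =
  \int[mu]_(x in Q) (g x * \int[mu]_z (f z * rho (x - z))).
Proof.
move=> fL gL rhoB; pose rho' h := rho (0 - h).
have rhoB' : bounded_support rho' by exact: bounded_support_reflection.
have E h : \int[mu]_(x in Q) (f x * g (x + h)) = \int[mu]_(x in Q) (g x * f (x - h)).
  have := @Rintegral_tiling_shift _ _ B Q (fun x => g x * f (x - h)) h tQ _ _.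
  under eq_Rintegral do rewrite addrK mulrC; apply.
  - apply: measurable_funM; first by case: gL => -[].
    by case: fL => -[mf _] _; exact: (measurableT_comp mf (measurable_translation (- h))).
  - by apply: lattice_periodic_comp2; [exact: gL.2|exact/lattice_periodic_shift/fL.2].
have /measurable_EFinP m1 := measurable_int _ (integrable_weighted_correlation gL fL rhoB').
transitivity (\int[mu]_h (rho' h * \int[mu]_(x in Q) (g x * f (x + h)))).
  rewrite -(Rintegral_reflection 0 m1); apply: eq_Rintegral => h _.
  by rewrite E /rho' !sub0r opprK.
rewrite (correlation_swap gL fL rhoB'); apply: eq_Rintegral => x _; congr (_ * _).
by apply: eq_Rintegral => z _; rewrite /rho' sub0r opprB.
Qed.

End pairing.

(** * The Hill-Mandel lemma *)

Lemma Rintegral_sum d (T : measurableType d) (R : realType)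
  (mu : {measure set T -> \bar R}) (D : set T) I (r : seq I) (F : I -> T -> R) :
  measurable D -> (forall i, mu.-integrable D (EFin \o F i)) ->
  \int[mu]_(x in D) (\sum_(i <- r) F i x) = \sum_(i <- r) \int[mu]_(x in D) F i x.
Proof.
move=> mD iF; rewrite /Rintegral.
under eq_integral do rewrite -sumEFin.
rewrite integral_sum//; elim: r => [|i r ih]; first by rewrite !big_nil.
rewrite !big_cons fineD ?ih//; first exact: (integrable_fin_num mD (iF i)).
elim/big_ind: _ => // [x y xf yf|j _]; first by rewrite fin_numD xf.
exact: (integrable_fin_num mD (iF j)).
Qed.

Lemma integrable_Rsum d (T : measurableType d) (R : realType)
  (mu : {measure set T -> \bar R}) (D : set T) I (r : seq I) (F : I -> T -> R) :
  measurable D -> (forall i, mu.-integrable D (EFin \o F i)) ->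
  mu.-integrable D (EFin \o (fun x => \sum_(i <- r) F i x)).
Proof.
move=> mD iF; rewrite (_ : _ \o _ = fun x => (\sum_(i <- r) (EFin \o F i) x)%E).
  exact: integrable_sum.
by apply/funext => x /=; rewrite sumEFin.
Qed.

Section bump_mean.
Context (R : realType) (d : nat).
Local Notation mu := (lebesgue_rV R d).
Local Notation point := 'rV[R]_d.

Lemma ball_defect_nonnegligible (r : R) : 0 < r ->
  ~ mu.-negligible [set x : point | 0 < ball_defect r x].
Proof.
move=> r0 [N [mN N0 hN]].
pose del := r / (r + d%:R + 1).
have D0 : 0 < r + d%:R + 1 by have := ler0n R d; lra.
have del0 : 0 < del by rewrite divr_gt0.
pose K : set point := obox (const_mx (- del)) (const_mx del).
have sub : K `<=` N.
  apply: subset_trans hN => x hx /=; rewrite subr_gt0.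
  apply: (@le_lt_trans _ _ (\sum_(i < d) del ^+ 2)).
    apply: ler_sum => i _; have := hx i; rewrite !mxE -ltr_norml => h.
    by rewrite -real_normK ?num_real// lerXn2r ?nnegrE// ltW.
  rewrite sumr_const card_ord -mulr_natl.
  have d1 : del <= 1 by rewrite ler_pdivrMr// mul1r; have := ler0n R d; lra.
  have : d%:R * del ^+ 2 <= d%:R * del by rewrite ler_wpM2l// expr2 ler_piMl// ltW.
  move/le_lt_trans; apply; rewrite /del mulrA ltr_pdivrMr//.
  by rewrite mulrC ltr_pM2l//; lra.
have : (0 < mu K)%E.
  rewrite lebesgue_rV_obox; elim/big_ind: _ => [|x y|i _].
  - by rewrite lte01.
  - exact: mule_gt0.
  - by rewrite lebesgue_measure_itv /= !mxE lte_fin ifT ?lte_fin//; lra.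
apply/negP; rewrite -leNgt -N0; apply: le_measure; rewrite ?inE//.
exact: measurable_obox.
Qed.

(** Otherwise the integrand would be nonnegative, and positive on a ball, which is
    not negligible. *)
Lemma bump_mean0 (C : point -> R) (r : R) : 0 < r ->
  measurable_fun setT (fun h => bump r h * C h) ->
  \int[mu]_h (bump r h * C h) = 0 ->
  mu.-integrable setT (EFin \o (fun h => bump r h * C h)) ->
  exists h, 0 < ball_defect r h /\ C h <= 0.
Proof.
move=> r0 mC I0 iC; apply: contrapT => /forallNP nC.
have C0 h : 0 < ball_defect r h -> 0 < C h.
  by move=> h0; rewrite ltNge; apply/negP => Ch; apply: (nC h).
have nn h : 0 <= bump r h * C h.
  have [h0|h0] := ltP 0 (ball_defect r h); first by rewrite mulr_ge0 ?bump_ge0// ltW// C0.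
  by rewrite /bump /flat ltNge h0 mul0r.
apply: (ball_defect_nonnegligible r0).
have E0 : (\int[mu]_h `|(bump r h * C h)%:E| = 0)%E.
  under eq_integral do rewrite gee0_abs ?lee_fin//.
  by rewrite -[LHS]fineK ?(integrable_fin_num measurableT iC)//; congr EFin.
have mE : measurable_fun setT (fun h => (bump r h * C h)%:E) by exact/measurable_EFinP.
have := (ae_eq_integral_abs mu measurableT mE).1 E0.
apply: negligibleS => h /= h0 H; have [/eqP] := H Logic.I.
by rewrite gt_eqF// mulr_gt0 ?bump_gt0 ?C0.
Qed.

End bump_mean.

(** A symmetric matrix is orthogonal to antisymmetric ones, so it does not
    distinguish a gradient from its symmetric part. *)
Lemma sum_sym_half (R : realType) d (S : 'M[R]_d) (W : 'I_d -> 'I_d -> R) : S^T = S ->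
  \sum_i \sum_j S i j * (2^-1 * (- W i j - W j i)) = - \sum_i \sum_j S i j * W i j.
Proof.
move=> sT; have E : \sum_i \sum_j S i j * W j i = \sum_i \sum_j S i j * W i j.
  rewrite exchange_big; apply: eq_bigr => i _; apply: eq_bigr => j _.
  by rewrite -[in LHS]sT mxE.
transitivity (- 2^-1 * (\sum_i \sum_j S i j * W i j + \sum_i \sum_j S i j * W j i)).
  rewrite -big_split mulr_sumr; apply: eq_bigr => i _.
  by rewrite -big_split mulr_sumr; apply: eq_bigr => j _ /=; ring.
by rewrite E; field.
Qed.

Section hill.
Context (R : realType) (d : nat) (B : 'M[R]_d) (uB : B \in unitmx).
Local Notation mu := (lebesgue_rV R d).
Local Notation point := 'rV[R]_d.
Implicit Types (s e : point -> 'M[R]_d) (x h : point).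

Section correlation.
Variables (Q : set point) (s e : point -> 'M[R]_d).
Hypotheses (tQ : tiling B Q) (hs : equilibrated_stresses B s) (he : compatible_strains B e).

Let mQ : measurable Q. Proof. by case: tQ. Qed.
Let sL i j : L2per B (fun x => s x i j). Proof. by case: hs => -[]. Qed.
Let eL i j : L2per B (fun x => e x i j). Proof. by case: he => -[]. Qed.

Definition correlation h := \sum_i \sum_j \int[mu]_(x in Q) (s x i j * e (x + h) i j).

(** Averaged against [rho], the gradient of the displacement becomes [- W], where
    [W] averages the displacement against the partial derivatives of [rho].
    Moving this average onto [s] by Fubini gives the divergence of [s] tested
    against reflected translates of [rho], which vanishes. *)
Lemma test_correlation (rho : point -> R) : bounded_support rho ->
  (forall j, bounded_support (partial j rho)) -> (forall y, differentiable rho y) ->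
  (forall (c : R) v, c ^+ 2 = 1 -> test_function (fun x => rho (v + c *: x))) ->
  \int[mu]_h (rho h * correlation h) = 0.
Proof.
move=> brho bprho drho trho.
have [_ [w [G [wP wG eG]]]] := he.
have wL i : L2per B (fun x => w x 0 i) by have [[? _] ?] := wP i; split.
have [W WE] : exists W, forall i j x, W i j x = \int[mu]_z (w z 0 i * partial j rho (z - x)).
  by exists (fun i j x => \int[mu]_z (w z 0 i * partial j rho (z - x))).
have partial_shift j (v z : point) : partial j (fun y => rho (y - v)) z = partial j rho (z - v).
  have := @partial_affine _ _ rho 1 (- v) j z drho.
  by under [fun y => rho (- v + _)]eq_fun do rewrite scale1r addrC; rewrite scale1r mul1r addrC.
have partial_refl j (v z : point) : partial j (fun y => rho (v - y)) z = - partial j rho (v - z).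
  have := @partial_affine _ _ rho (-1) v j z drho.
  by under [fun y => rho (v + _)]eq_fun do rewrite scaleN1r; rewrite scaleN1r mulN1r.
have GW i j x : \int[mu]_z (G z i j * rho (z - x)) = - W i j x.
  have tx : test_function (fun z => rho (z - x)).
    have := trho 1 (- x) (expr1n R 2).
    by under [fun y => rho _]eq_fun do rewrite scale1r addrC.
  have [_ /(_ _ tx) wp] := wG i j; apply: oppr_inj; rewrite opprK -wp WE.
  by apply: eq_Rintegral => z _; rewrite partial_shift.
have eW x : (s x)^T = s x -> \sum_i \sum_j s x i j * (\int[mu]_z (e z i j * rho (z - x))) =
   - \sum_i \sum_j s x i j * W i j x.
  move=> sT.
  have GL i j : L2loc (fun z => G z i j) by case: (wG i j).
  have brx := bounded_support_shift x brho.
  have iG i j := integrable_L2loc_bounded_support (GL i j) brx.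
  have eE i j : \int[mu]_z (e z i j * rho (z - x)) = 2^-1 * (- W i j x - W j i x).
    have iGG : mu.-integrable setT (EFin \o (fun z => G z i j * rho (z - x) + G z j i * rho (z - x))).
      rewrite (_ : _ \o _ = (EFin \o (fun z => G z i j * rho (z - x))%R) \+ (EFin \o (fun z => G z j i * rho (z - x))%R))%E //.
      exact: (integrableD measurableT (iG i j) (iG j i)).
    transitivity (\int[mu]_z (2^-1 * (G z i j * rho (z - x) + G z j i * rho (z - x)))).
      by apply: eq_Rintegral_ae; apply: filterS eG => z -> _; rewrite !mxE; ring.
    rewrite (RintegralZl _ measurableT iGG) (RintegralD measurableT (iG i j) (iG j i)).
    by rewrite !GW.
  rewrite -(sum_sym_half (fun i j => W i j x) sT).
  by apply: eq_bigr => i _; apply: eq_bigr => j _; rewrite eE.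
transitivity (\int[mu]_(x in Q) \sum_i \sum_j s x i j * (\int[mu]_z (e z i j * rho (z - x)))).
  have i1 i j := integrable_weighted_correlation uB tQ (sL i j) (eL i j) brho.
  have i2 i j := integrable_correlation_test uB tQ (sL i j) (eL i j) brho.
  under eq_Rintegral do (rewrite mulr_sumr; under eq_bigr do rewrite mulr_sumr).
  rewrite Rintegral_sum//; last by move=> i; apply: integrable_Rsum => // j; exact: i1.
  rewrite [RHS]Rintegral_sum//; last by move=> i; apply: integrable_Rsum => // j; exact: i2.
  apply: eq_bigr => i _; rewrite !Rintegral_sum//.
  by apply: eq_bigr => j _; exact: (correlation_swap uB tQ (sL i j) (eL i j) brho).
transitivity (\int[mu]_(x in Q) - \sum_i \sum_j s x i j * W i j x).
  apply: eq_Rintegral_ae; have [[_ sT] _] := hs.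
  by apply: filterS sT => x /eW ->.
transitivity (- \sum_i \sum_j \int[mu]_(x in Q) (s x i j * W i j x)).
  have i2 i j : mu.-integrable Q (EFin \o (fun x => s x i j * W i j x)).
    have := integrable_correlation_test uB tQ (sL i j) (wL i) (bprho j).
    by under [X in EFin \o X]eq_fun do rewrite -WE.
  have i3 : mu.-integrable Q (EFin \o (fun x => \sum_i \sum_j s x i j * W i j x)).
    by apply: integrable_Rsum => // i; apply: integrable_Rsum => // j; exact: i2.
  under eq_Rintegral do rewrite -mulN1r.
  rewrite RintegralZl// mulN1r; congr (- _).
  rewrite Rintegral_sum//; last by move=> i; apply: integrable_Rsum => // j; exact: i2.
  by apply: eq_bigr => i _; rewrite Rintegral_sum// => j; exact: i2.
transitivity (- \sum_i \sum_j \int[mu]_(x in Q) (w x 0 i * \int[mu]_z (s z i j * partial j rho (x - z)))).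
  congr (- _); apply: eq_bigr => i _; apply: eq_bigr => j _.
  under eq_Rintegral do rewrite WE.
  apply: etrans (esym (correlation_swap uB tQ (sL i j) (wL i) (bprho j))) _.
  exact: (correlation_swap_reflected uB tQ (sL i j) (wL i) (bprho j)).
apply/eqP; rewrite oppr_eq0; apply/eqP; apply: big1 => i _.
have brx j x := bounded_support_reflection x (bprho j).
have i5 j x : mu.-integrable setT (EFin \o (fun z => s z i j * partial j rho (x - z))).
  exact: (integrable_L2loc_bounded_support (sL i j).1 (brx j x)).
have S0 x : \sum_j \int[mu]_z (s z i j * partial j rho (x - z)) = 0.
  have tx : test_function (fun z => rho (x - z)).
    have c1 : (- 1 : R) ^+ 2 = 1 by rewrite sqrrN expr1n.
    have := trho (-1) x c1.
    by under [fun y => rho _]eq_fun do rewrite scaleN1r.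
  have [_ /(_ _ tx i) h0] := hs.
  have isum := integrable_Rsum (index_enum 'I_d) measurableT (i5^~ x).
  transitivity (\int[mu]_z \sum_j s z i j * partial j rho (x - z)).
    by rewrite (Rintegral_sum (index_enum 'I_d) measurableT (i5^~ x)).
  have : \int[mu]_z (-1 * \sum_j s z i j * partial j rho (x - z)) = 0.
    apply: etrans h0; apply: eq_Rintegral => z _.
    rewrite mulN1r -sumrN; apply: eq_bigr => j _.
    by rewrite partial_refl mulrN.
  rewrite (RintegralZl (-1) measurableT isum) mulN1r => /eqP.
  by rewrite oppr_eq0 => /eqP.
have i6 j : mu.-integrable Q (EFin \o (fun x => w x 0 i * \int[mu]_z (s z i j * partial j rho (x - z)))).
  have i7 := integrable_correlation_test uB tQ (wL i) (sL i j) (bounded_support_reflection 0 (bprho j)).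
  apply: (@eq_integrable _ _ _ mu Q mQ _ _ _ i7); move=> x _.
  suff E : \int[mu]_z (s z i j * partial j rho (0 - (z - x))) =
    \int[mu]_z (s z i j * partial j rho (x - z)) by rewrite /comp E.
  by apply: eq_Rintegral => z _; rewrite sub0r opprB.
rewrite -(Rintegral_sum (index_enum 'I_d) mQ i6).
under eq_Rintegral do rewrite -mulr_sumr S0 mulr0.
by rewrite Rintegral_cst// mul0r.
Qed.

Lemma bump_correlation r : \int[mu]_h (bump r h * correlation h) = 0.
Proof.
apply: test_correlation.
- exact: bounded_support_bump.
- by move=> j; exact: bounded_support_partial_bump.
- exact: (bump_differentiable (bump_in_bump_algebra d r)).
- by move=> c v c1; exact: test_function_bump_affine.
Qed.

Lemma integrable_bump_correlation r :
  mu.-integrable setT (EFin \o (fun h => bump r h * correlation h)).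
Proof.
have brho : bounded_support (bump (R := R) (d := d) r) by exact: bounded_support_bump.
under [X in EFin \o X]eq_fun do rewrite mulr_sumr.
apply: integrable_Rsum => // i; under [X in EFin \o X]eq_fun do rewrite mulr_sumr.
apply: integrable_Rsum => // j.
exact: (integrable_weighted_correlation uB tQ (sL i j) (eL i j) brho).
Qed.

Lemma correlation_cvg (M : R) (u : nat -> point) : Q `<=` cube M ->
  (forall n, cube 1 (u n)) -> (forall i, (fun n => u n 0 i) @ \oo --> (0 : R)) ->
  (fun n => correlation (u n)) @ \oo --> correlation 0.
Proof.
move=> QM u1 u0.
pose K : set point := obox (const_mx (- (M + 1))) (const_mx (M + 1)).
have mK : measurable K by exact: measurable_obox.
have QK : Q `<=` K.
  by move=> x /QM h i; have := h i; rewrite !mxE ler_norml => /andP[? ?]; lra.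
apply: cvg_big => [|i _]; first exact: add_continuous.
apply: cvg_big => [|j _]; first exact: add_continuous.
have E h : \int[mu]_(x in Q) (s x i j * e (x + h) i j) =
    \int[mu]_(x in K) (e (x + h) i j * ((fun x => s x i j) \_ Q) x).
  rewrite Rintegral_mkcond [RHS]Rintegral_mkcond; apply: eq_Rintegral => x _.
  rewrite !patchE; case: ifPn => [/set_mem/QK Kx|_]; first by rewrite mem_set// mulrC.
  by case: ifP => _ //; rewrite mulr0.
rewrite E; under eq_fun do rewrite E.
have ms : measurable_fun setT ((fun x => s x i j) \_ Q).
  by apply: (measurable_restrictT _ mQ).1; apply: measurable_funTS; case: (sL i j) => -[].
have sK : square_integrable mu K ((fun x => s x i j) \_ Q).
  have [ms0 is0] := L2loc_cube (M + 1) (sL i j).1.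
  have s0 : square_integrable mu K (fun x => s x i j).
    by split => //; apply: integrableS is0 => //; [exact: measurable_cube|exact: obox_cube].
  apply: (square_integrable_le mK (K := 1) ms s0); apply: aeW => x _.
  by rewrite patchE; case: ifP => _; rewrite mul1r// expr0n sqr_ge0.
have := translation_weak_continuity (eL i j).1 sK u1 u0.
suff -> : \int[mu]_(x in K) (e (x + 0) i j * ((fun x => s x i j) \_ Q) x) =
  \int[mu]_(x in K) (e x i j * ((fun x => s x i j) \_ Q) x) by [].
by apply: eq_Rintegral => x _; rewrite addr0.
Qed.

(** Balls of radius [1/(n+1)] contain points where the correlation is nonpositive
    and points where it is nonnegative; both sequences tend to the origin. *)
Lemma correlation0 M : Q `<=` cube M -> correlation 0 = 0.
Proof.
move=> QM.
pose r n : R := n.+1%:R^-1 ^+ 2.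
have r0 n : 0 < r n by rewrite exprn_gt0// invr_gt0 ltr0n.
have small (u : nat -> point) : (forall n, 0 < ball_defect (r n) (u n)) ->
    (fun n => correlation (u n)) @ \oo --> correlation 0.
  move=> hu.
  have un n i : `|u n 0 i| <= n.+1%:R^-1.
    have := ball_defect_gt0 (hu n) i; rewrite /r -real_normK ?num_real//.
    by rewrite ltr_pXn2r ?nnegrE// ?invr_ge0// => /ltW.
  apply: (correlation_cvg QM).
    by move=> n i; apply: le_trans (un n i) _; rewrite invf_le1 ?ltr0n// ler1n.
  move=> i; apply/norm_cvg0P; apply: (@squeeze_cvgr _ _ _ _ (cst 0) harmonic).
  - by apply: nearW => n; rewrite normr_ge0 /=; exact: un.
  - exact: cvg_cst.
  - exact: cvg_harmonic.
have /choice[u hu] n : exists h, 0 < ball_defect (r n) h /\ correlation h <= 0.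
  have ib := integrable_bump_correlation (r n).
  have /measurable_EFinP mb := measurable_int _ ib.
  exact: (bump_mean0 (r0 n) mb (bump_correlation (r n)) ib).
have /choice[v hv] n : exists h, 0 < ball_defect (r n) h /\ - correlation h <= 0.
  have E : (fun h => bump (r n) h * - correlation h) = fun h => -1 * (bump (r n) h * correlation h).
    by apply/funext => h; ring.
  have ib := integrable_bump_correlation (r n).
  have ib' : mu.-integrable setT (EFin \o (fun h => bump (r n) h * - correlation h)).
    rewrite E (_ : _ \o _ = fun h => ((-1)%:E * (EFin \o (fun h => bump (r n) h * correlation h)%R) h)%E) //.
    exact: integrableZl.
  have /measurable_EFinP mb := measurable_int _ ib'.
  apply: (bump_mean0 (r0 n) mb _ ib').
  by rewrite E RintegralZl// bump_correlation mulr0.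
have cu := small u (fun n => (hu n).1).
have cv := small v (fun n => (hv n).1).
apply/eqP; rewrite eq_le; apply/andP; split.
  rewrite -(cvg_lim (@Rhausdorff R) cu); apply: limr_le.
    by apply/cvg_ex; eexists; exact: cu.
  by apply: nearW => n; exact: (hu n).2.
rewrite -(cvg_lim (@Rhausdorff R) cv); apply: limr_ge.
  by apply/cvg_ex; eexists; exact: cv.
by apply: nearW => n; rewrite -oppr_le0; exact: (hv n).2.
Qed.

End correlation.

(** The statement is first moved to the lattice parallelepiped, because weak
    continuity of translations was proved for bounded sets only. *)
Lemma hill_mandel V s e : tiling B V -> equilibrated_stresses B s ->
  compatible_strains B e -> \int[mu]_(x in V) ddot (s x) (e x) = 0.
Proof.
move=> tV hs he.
have [M M0 PM] := parallelepiped_cube uB.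
have tP := parallelepiped_tiling uB.
have sL i j : L2per B (fun x => s x i j) by case: hs => -[].
have eL i j : L2per B (fun x => e x i j) by case: he => -[].
have mse i j : measurable_fun setT (fun x => s x i j * e x i j).
  by apply: measurable_funM; [case: (sL i j) => -[]|case: (eL i j) => -[]].
have -> : \int[mu]_(x in V) ddot (s x) (e x) = \int[mu]_(x in parallelepiped B) ddot (s x) (e x).
  congr fine; apply: (tiling_integral tV tP).
    by apply/measurable_EFinP; do 2![apply: measurable_sum => ?]; exact: mse.
  apply: (lattice_periodic_comp EFin); do 2![apply: lattice_periodic_sum => ?].
  by apply: lattice_periodic_comp2; [exact: (sL _ _).2|exact: (eL _ _).2].
rewrite -(correlation0 tP hs he PM).
have [mP _] := tP.
have i1 i j : mu.-integrable (parallelepiped B) (EFin \o (fun x => s x i j * e x i j)).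
  exact: (square_integrable_mul mP (L2per_square_integrable uB tP (sL i j)) (L2per_square_integrable uB tP (eL i j))).
rewrite /ddot Rintegral_sum//; last by move=> i; apply: integrable_Rsum => // j; exact: i1.
apply: eq_bigr => i _; rewrite Rintegral_sum//; apply: eq_bigr => j _.
by apply: eq_Rintegral => x _; rewrite addr0.
Qed.

End hill.

(** * Symmetric positive definite tensors *)

Section tensors.
Context (R : realType) (d : nat).
Implicit Types (e f s t : 'M[R]_d) (C : tensor4 R d).

Lemma ddotC e f : ddot e f = ddot f e.
Proof. by apply: eq_bigr => i _; apply: eq_bigr => j _; rewrite mulrC. Qed.

Lemma ddotDl e f t : ddot (e + f) t = ddot e t + ddot f t.
Proof.
rewrite /ddot -big_split; apply: eq_bigr => i _; rewrite -big_split.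
by apply: eq_bigr => j _; rewrite mxE mulrDl.
Qed.

Lemma ddotZl (a : R) e t : ddot (a *: e) t = a * ddot e t.
Proof.
rewrite /ddot mulr_sumr; apply: eq_bigr => i _; rewrite mulr_sumr.
by apply: eq_bigr => j _; rewrite mxE mulrA.
Qed.

Lemma ddotDr e f t : ddot t (e + f) = ddot t e + ddot t f.
Proof. by rewrite ddotC ddotDl !(ddotC t). Qed.

Lemma ddotZr (a : R) e t : ddot t (a *: e) = a * ddot t e.
Proof. by rewrite ddotC ddotZl (ddotC t). Qed.

Lemma ddotNl e t : ddot (- e) t = - ddot e t.
Proof. by rewrite -scaleN1r ddotZl mulN1r. Qed.

Lemma ddotNr e t : ddot t (- e) = - ddot t e.
Proof. by rewrite ddotC ddotNl (ddotC t). Qed.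

Definition ddotE := (ddotDl, ddotDr, ddotNl, ddotNr, ddotZl, ddotZr).

Lemma ddot_ge0 e : 0 <= ddot e e.
Proof. by do 2![apply: sumr_ge0 => ? _]; rewrite -expr2 sqr_ge0. Qed.

Lemma sqr_le_ddot e i j : e i j ^+ 2 <= ddot e e.
Proof.
have ge0 (a b : 'I_d) : 0 <= e a b * e a b by rewrite -expr2 sqr_ge0.
rewrite /ddot (bigD1 i)//= (bigD1 j)//= expr2 -addrA lerDl addr_ge0//.
  by apply: sumr_ge0.
by do 2![apply: sumr_ge0 => ? _].
Qed.

Lemma tappD C e f : tapp C (e + f) = tapp C e + tapp C f.
Proof.
apply/matrixP => i j; rewrite !mxE -big_split; apply: eq_bigr => k _.
by rewrite -big_split; apply: eq_bigr => l _; rewrite mxE mulrDr.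
Qed.

Lemma tappZ C (a : R) e : tapp C (a *: e) = a *: tapp C e.
Proof.
apply/matrixP => i j; rewrite !mxE mulr_sumr; apply: eq_bigr => k _.
by rewrite mulr_sumr; apply: eq_bigr => l _; rewrite mxE mulrCA.
Qed.

Lemma tappN C e : tapp C (- e) = - tapp C e.
Proof. by rewrite -scaleN1r tappZ scaleN1r. Qed.

Lemma tapp_tr C e : major_minor_symmetric C -> (tapp C e)^T = tapp C e.
Proof.
move=> sC; apply/matrixP => i j; rewrite !mxE; apply: eq_bigr => k _.
by apply: eq_bigr => l _; have [-> _ _] := sC i j k l.
Qed.

Lemma ddot_tappC C e f : major_minor_symmetric C ->
  ddot (tapp C e) f = ddot (tapp C f) e.
Proof.
move=> sC; have E a b : ddot (tapp C a) b =
    \sum_(p : 'I_d * 'I_d) \sum_(q : 'I_d * 'I_d) C p.1 p.2 q.1 q.2 * a q.1 q.2 * b p.1 p.2.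
  rewrite /ddot pair_bigA; apply: eq_bigr => -[i j] _ /=.
  by rewrite mxE pair_bigA mulr_suml.
rewrite !E exchange_big; apply: eq_bigr => -[i j] _; apply: eq_bigr => -[k l] _ /=.
by have [_ _ ->] := sC i j k l; rewrite mulrAC.
Qed.

Definition tensor_norm C := \sum_i \sum_j \sum_k \sum_l `|C i j k l|.

Lemma tensor_norm_ge0 C : 0 <= tensor_norm C.
Proof. by do 4![apply: sumr_ge0 => ? _]. Qed.

Lemma ddot_tapp_le C e : ddot (tapp C e) e <= tensor_norm C * ddot e e.
Proof.
rewrite /ddot mulr_suml; apply: ler_sum => i _; rewrite mulr_suml; apply: ler_sum => j _.
rewrite mxE !mulr_suml; apply: ler_sum => k _; rewrite !mulr_suml; apply: ler_sum => l _.
have h1 := sqr_le_ddot e i j; have h2 := sqr_le_ddot e k l.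
rewrite -mulrA; apply: (le_trans (ler_norm _)); rewrite normrM ler_wpM2l//.
by rewrite -/(ddot e e) ler_norml; move: (ddot e e) h1 h2 => D h1 h2; nra.
Qed.

Definition sym_part e := 2^-1 *: (e + e^T).

(** The action of [C] on symmetric matrices, completed by the identity on
    antisymmetric ones. It is invertible on the space of all matrices, where
    Cramer's formula is available. *)
Definition completion C e := tapp C (sym_part e) + (e - sym_part e).

Lemma completion_linear C : linear (completion C).
Proof.
move=> a e f; rewrite /completion.
have -> : sym_part (a *: e + f) = a *: sym_part e + sym_part f.
  by rewrite /sym_part linearD linearZ /=; apply/matrixP => i j; rewrite !mxE; ring.
by rewrite tappD tappZ; apply/matrixP => i j; rewrite !mxE; ring.
Qed.

Definition completion_mx C : 'M[R]_(d * d) := lin_mx (completion C).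

(** Contrary to [invmx] this is a rational expression in the entries for every
    matrix, which makes it visibly measurable. *)
Definition cramer_inverse n (A : 'M[R]_n) : 'M[R]_n := (\det A)^-1 *: \adj A.

(** The inverse as a tensor, so that [tinv C] becomes [tapp] of it on symmetric
    matrices ([tinvE]) and the bounds on [tapp] apply to it. *)
Definition inverse_tensor C : tensor4 R d := fun i j k l =>
  cramer_inverse (completion_mx C) (mxvec_index k l) (mxvec_index i j).

Lemma mxvec_completion C e : mxvec e *m completion_mx C = mxvec (completion C e).
Proof.
pose phi : {linear 'M[R]_d -> 'M[R]_d} :=
  HB.pack (completion C) (GRing.isLinear.Build _ _ _ _ _ (completion_linear C)).
exact: (mul_vec_lin phi).
Qed.

Lemma tapp_inverse_tensor C s :
  mxvec (tapp (inverse_tensor C) s) = mxvec s *m cramer_inverse (completion_mx C).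
Proof.
apply/rowP => p; case/mxvec_indexP: p => i j; rewrite mxvecE !mxE.
rewrite (reindex _ (curry_mxvec_bij d d)) pair_bigA /=.
by apply: eq_bigr => -[k l] _ /=; rewrite mxvecE mulrC.
Qed.

Section spd.
Variable C : tensor4 R d.
Hypotheses (sC : major_minor_symmetric C) (pC : positive_definite C).

Lemma sym_part_tr e : (sym_part e)^T = sym_part e.
Proof. by apply/matrixP => i j; rewrite !mxE addrC. Qed.

(** The symmetric and the antisymmetric parts of the equation decouple. *)
Lemma completion_sym s e : s^T = s -> completion C e = s -> e^T = e /\ tapp C e = s.
Proof.
move=> sT eq.
have eT : e - sym_part e = 0.
  have := congr1 (fun m : 'M[R]_d => m - m^T) eq; rewrite sT subrr /completion.
  have := tapp_tr (sym_part e) sC; have := sym_part_tr e.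
  move=> h1 h2 /matrixP h; apply/matrixP => i j; have := h i j.
  have := congr1 (fun m : 'M[R]_d => m i j) h2; rewrite !mxE; lra.
have eE : e = sym_part e by apply/eqP; rewrite -subr_eq0 eT.
by split; [rewrite eE sym_part_tr|rewrite -eq /completion eT addr0 -eE].
Qed.

Lemma tapp_inj0 e : e^T = e -> tapp C e = 0 -> e = 0.
Proof.
move=> eT e0; apply/eqP; apply: contrapT => /negP en0.
have := pC eT en0; rewrite e0 /ddot big1 ?ltxx// => i _; rewrite big1// => j _.
by rewrite mxE mul0r.
Qed.

Lemma completion_mx_unit : completion_mx C \in unitmx.
Proof.
rewrite -row_free_unit; apply: inj_row_free => v.
rewrite -[v]vec_mxK mxvec_completion => /eqP; rewrite mxvec_eq0 => /eqP h.
have [eT e0] := completion_sym (trmx0 _ _ _) h.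
by rewrite (tapp_inj0 eT e0) linear0.
Qed.

Lemma inverse_tensorK s : s^T = s -> (tapp (inverse_tensor C) s)^T = tapp (inverse_tensor C) s /\
  tapp C (tapp (inverse_tensor C) s) = s.
Proof.
move=> sT; apply: completion_sym => //; apply: (can_inj mxvecK).
rewrite -mxvec_completion tapp_inverse_tensor; have uC := completion_mx_unit.
have -> : cramer_inverse (completion_mx C) = invmx (completion_mx C) by rewrite /invmx uC.
by rewrite mulmxKV.
Qed.

Lemma tinvE s : s^T = s -> tinv C s = tapp (inverse_tensor C) s.
Proof.
move=> sT; have [iT iK] := inverse_tensorK sT; rewrite /tinv.
case: xgetP => [e -> [eT eK]|/(_ (tapp (inverse_tensor C) s))]; last by case.
apply/eqP; rewrite -subr_eq0; apply/eqP; apply: tapp_inj0.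
  by rewrite linearB /= eT iT.
by rewrite tappD tappN eK iK subrr.
Qed.

Lemma inverse_tensor_tapp e : e^T = e -> tapp (inverse_tensor C) (tapp C e) = e.
Proof.
move=> eT; have [iT iK] := inverse_tensorK (tapp_tr e sC).
apply/eqP; rewrite -subr_eq0; apply/eqP; apply: tapp_inj0.
  by rewrite linearB /= eT iT.
by rewrite tappD tappN iK subrr.
Qed.

Lemma ddot_tapp_ge0 e : e^T = e -> 0 <= ddot (tapp C e) e.
Proof.
move=> eT; have [->|e0] := eqVneq e 0; last exact/ltW/pC.
by rewrite /ddot big1// => i _; rewrite big1// => j _; rewrite [in X in _ * X]mxE mulr0.
Qed.

Local Notation D := (inverse_tensor C).

Lemma ddot_inverse_tensorC s t : s^T = s -> t^T = t ->
  ddot s (tapp D t) = ddot t (tapp D s).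
Proof.
move=> sT tT; have [sI sK] := inverse_tensorK sT; have [tI tK] := inverse_tensorK tT.
by rewrite -{1}sK ddot_tappC// tK.
Qed.

Lemma ddot_inverse_tensor_ge0 s : s^T = s -> 0 <= ddot s (tapp D s).
Proof.
by move=> sT; have [sI sK] := inverse_tensorK sT; rewrite -{1}sK ddot_tapp_ge0.
Qed.

(** Three times the sum of the squares minus the square of the sum is the sum of
    the squares of the pairwise differences. *)
Lemma ddot_inverse_tensor3 s t u : s^T = s -> t^T = t -> u^T = u ->
  ddot (s + t + u) (tapp D (s + t + u)) <=
  3 * (ddot s (tapp D s) + ddot t (tapp D t) + ddot u (tapp D u)).
Proof.
move=> sT tT uT.
have sub_tr (a b : 'M[R]_d) : a^T = a -> b^T = b -> (a - b)^T = a - b.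
  by move=> aT bT; rewrite linearB /= aT bT.
have h1 := ddot_inverse_tensor_ge0 (sub_tr _ _ sT tT).
have h2 := ddot_inverse_tensor_ge0 (sub_tr _ _ tT uT).
have h3 := ddot_inverse_tensor_ge0 (sub_tr _ _ sT uT).
move: h1 h2 h3; rewrite !(tappD, tappN) !ddotE.
by rewrite (ddot_inverse_tensorC tT sT) (ddot_inverse_tensorC uT sT) (ddot_inverse_tensorC uT tT); lra.
Qed.

Lemma ddot_tapp_young (a : R) e f : 0 < a -> e^T = e -> f^T = f ->
  2 * ddot (tapp C e) f <= a * ddot (tapp C e) e + a^-1 * ddot (tapp C f) f.
Proof.
move=> a0 eT fT.
have gT : (a *: e - f)^T = a *: e - f by rewrite linearB linearZ /= eT fT.
have := ddot_tapp_ge0 gT; rewrite !(tappD, tappN, tappZ) !ddotE.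
rewrite (ddot_tappC f e sC) => h.
have : 0 <= a^-1 * (a * (a * ddot (tapp C e) e) - a * ddot (tapp C e) f - (a * ddot (tapp C e) f - ddot (tapp C f) f)).
  rewrite mulr_ge0 ?invr_ge0 ?(ltW a0)//; move: h; lra.
have an0 : a != 0 by rewrite gt_eqF.
rewrite !mulrBr !mulrA mulVf// !mul1r; lra.
Qed.

(** With [f = C^-1 s], apply the Young inequality to [s : s = C f : s] and absorb
    [C s : s] into the left-hand side. *)
Lemma ddot_le_inverse_tensor s : s^T = s ->
  ddot s s <= (tensor_norm C + 1) * ddot s (tapp D s).
Proof.
move=> sT; have [fT fK] := inverse_tensorK sT; set f := tapp D s in fT fK *.
have K0 : 0 < tensor_norm C + 1 by have := tensor_norm_ge0 C; lra.
have := ddot_tapp_young K0 fT sT; rewrite fK.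
have h : ddot (tapp C s) s <= (tensor_norm C + 1) * ddot s s.
  by have := ddot_tapp_le C s; have := ddot_ge0 s; lra.
have : (tensor_norm C + 1)^-1 * ddot (tapp C s) s <= ddot s s by rewrite ler_pdivrMl.
lra.
Qed.

(** A coercivity constant for [C] without compactness: with [w = C^-1 e], apply the
    Young inequality to [e : e = C e : w] and absorb [C w : w = e : w]. *)
Lemma ddot_le_tapp e : e^T = e ->
  ddot e e <= (tensor_norm D + 1) * ddot (tapp C e) e.
Proof.
move=> eT; have [wT wK] := inverse_tensorK eT; set w := tapp D e in wT wK *.
have K0 : 0 < tensor_norm D + 1 by have := tensor_norm_ge0 D; lra.
have := ddot_tapp_young K0 eT wT.
rewrite (ddot_tappC e w sC) wK.
have h : ddot e w <= (tensor_norm D + 1) * ddot e e.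
  by rewrite ddotC; have := ddot_tapp_le D e; have := ddot_ge0 e; rewrite -/w; lra.
have : (tensor_norm D + 1)^-1 * ddot e w <= ddot e e by rewrite ler_pdivrMl.
lra.
Qed.

Section coercive.
Variable m : R.
Hypotheses (m0 : 0 < m) (coC : forall e, e^T = e -> m * ddot e e <= ddot (tapp C e) e).

Lemma ddot_inverse_tensor_le s : s^T = s -> ddot s (tapp D s) <= m^-1 * ddot s s.
Proof.
move=> sT; have [fT fK] := inverse_tensorK sT; set f := tapp D s in fT fK *.
have h := coC fT; rewrite fK in h.
have : 0 <= m^-1 * ddot (s - m *: f) (s - m *: f).
  by rewrite mulr_ge0 ?ddot_ge0// invr_ge0 ltW.
rewrite !ddotE (ddotC f s) => h2.
have mn0 : m != 0 by rewrite gt_eqF.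
move: h2; rewrite !mulrDr !mulrN !mulrA mulVf// !mul1r; lra.
Qed.

Lemma ddot_inverse_tensor2_le s : s^T = s ->
  ddot (tapp D s) (tapp D s) <= m^-1 ^+ 2 * ddot s s.
Proof.
move=> sT; have [fT fK] := inverse_tensorK sT; set f := tapp D s in fT fK *.
have h := coC fT; rewrite fK in h.
have := ddot_inverse_tensor_le sT; rewrite -/f => h2.
have : m * ddot f f <= m^-1 * ddot s s by lra.
by rewrite -ler_pdivlMl// mulrA expr2.
Qed.

End coercive.
End spd.
End tensors.

(** * Measurability of the inverse tensor and almost everywhere bounds *)

Section measurability.
Context dd (T : measurableType dd) (R : realType).

(** The inverse is discontinuous at 0 only, where both sides are 0; off 0 it is
    expressed with the power function, whose measurability is known. *)
Lemma measurable_funV (f : T -> R) : measurable_fun setT f ->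
  measurable_fun setT (fun x => (f x)^-1).
Proof.
move=> mf; rewrite (_ : (fun x => _) = fun x => f x * (f x ^+ 2) `^ (-1)).
  apply: measurable_funM => //.
  by apply: (measurableT_comp (measurable_powR _)); exact: measurable_funX.
apply/funext => x; rewrite powR_inv1 ?sqr_ge0//.
by have [->|fx] := eqVneq (f x) 0; [rewrite invr0 mul0r|field].
Qed.

Lemma measurable_det n (M : T -> 'M[R]_n) :
  (forall i j, measurable_fun setT (fun x => M x i j)) ->
  measurable_fun setT (fun x => \det (M x)).
Proof.
move=> mM; apply: measurable_sum => s; apply: measurable_funM; first exact: measurable_cst.
by apply: measurable_prod => i _; exact: mM.
Qed.

Lemma measurable_cramer_inverse n (M : T -> 'M[R]_n) i j :
  (forall i j, measurable_fun setT (fun x => M x i j)) ->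
  measurable_fun setT (fun x => cramer_inverse (M x) i j).
Proof.
move=> mM; rewrite (_ : (fun x => _) = fun x => (\det (M x))^-1 * ((-1) ^+ (j + i) * \det (row' j (col' i (M x))))).
  apply: measurable_funM; first exact/measurable_funV/measurable_det.
  apply: measurable_funM; first exact: measurable_cst.
  apply: measurable_det => k l; rewrite (_ : (fun x => _) = fun x => M x (lift j k) (lift i l)) //.
  by apply/funext => x; rewrite !mxE.
by apply/funext => x; rewrite !mxE.
Qed.

Lemma measurable_inverse_tensor d (C : T -> tensor4 R d) i j k l :
  (forall i j k l, measurable_fun setT (fun x => C x i j k l)) ->
  measurable_fun setT (fun x => inverse_tensor (C x) i j k l).
Proof.
move=> mC; apply: measurable_cramer_inverse => p q.
case/mxvec_indexP: q => a b.
rewrite (_ : (fun x => _) = fun x => completion (C x) (vec_mx (delta_mx 0 p)) a b).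
  rewrite (_ : (fun x => _) = fun x => (\sum_k \sum_l C x a b k l * sym_part (vec_mx (delta_mx 0 p)) k l)
      + (vec_mx (delta_mx 0 p) - sym_part (vec_mx (delta_mx 0 p))) a b).
    apply: measurable_funD; last exact: measurable_cst.
    do 2![apply: measurable_sum => ?]; apply: measurable_funM; last exact: measurable_cst.
    exact: mC.
  by apply/funext => x; rewrite /completion 2!mxE.
apply/funext => x; rewrite -[RHS]mxvecE -mxvec_completion vec_mxK -rowE.
by rewrite [RHS]mxE.
Qed.

End measurability.

Section ae_integral.
Context dd (T : measurableType dd) (R : realType) (mu : {measure set T -> \bar R}).
Variable D : set T.
Hypothesis mD : measurable D.
Implicit Types f g : T -> R.

Lemma Rintegral_ge0_ae f : {ae mu, forall x, D x -> 0 <= f x} ->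
  0 <= \int[mu]_(x in D) f x.
Proof.
move=> f0; rewrite (@eq_Rintegral_ae _ _ _ mu D f (fun x => `|f x|)).
  by apply: Rintegral_ge0.
by apply: filterS f0 => x /[apply] fx; rewrite ger0_norm.
Qed.

Lemma le_Rintegral_ae f g : mu.-integrable D (EFin \o f) -> mu.-integrable D (EFin \o g) ->
  {ae mu, forall x, D x -> f x <= g x} ->
  \int[mu]_(x in D) f x <= \int[mu]_(x in D) g x.
Proof.
move=> fi gi fg; rewrite -subr_ge0 -RintegralB//; apply: Rintegral_ge0_ae.
by apply: filterS fg => x /[apply]; rewrite subr_ge0.
Qed.

Lemma square_integrable_bound f (g : T -> R) : measurable_fun setT f ->
  mu.-integrable D (EFin \o g) -> {ae mu, forall x, D x -> f x ^+ 2 <= g x} ->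
  square_integrable mu D f.
Proof.
move=> mf gi fg; split => //; apply: (le_integrable_ae mD _ gi).
  exact: measurable_funX.
by apply: filterS fg => x /[apply]; rewrite ger0_norm ?sqr_ge0.
Qed.

Lemma square_integrable_mul_bounded (h f : T -> R) M : measurable_fun setT h ->
  square_integrable mu D f -> {ae mu, forall x, D x -> `|h x| <= M} ->
  square_integrable mu D (fun x => h x * f x).
Proof.
move=> mh fL hM; apply: (square_integrable_le mD (K := M ^+ 2) _ fL).
  by apply: measurable_funM => //; exact: fL.1.
apply: filterS hM => x /[apply] hM; rewrite exprMn ler_wpM2r ?sqr_ge0//.
by rewrite -real_normK ?num_real// lerXn2r ?nnegrE// (le_trans _ hM).
Qed.

End ae_integral.

Section L2loc_cubes.
Context (R : realType) (d : nat).
Local Notation mu := (lebesgue_rV R d).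
Local Notation point := 'rV[R]_d.

Lemma compact_cube (K : set point) : compact K -> exists M, K `<=` cube M.
Proof.
move=> /compact_bounded [M [Mr hM]]; exists (M + 1) => x Kx i.
have xM : `|x| <= M + 1 by apply: hM => //; rewrite ltrDl.
apply: le_trans xM; rewrite [leRHS]/Num.norm /= mx_normrE.
by apply/bigmax_geP; right => /=; exists (ord0, i).
Qed.

(** The compact set in the definition of local integrability need not be known to
    be measurable, hence the comparison of integrals without measurability. *)
Lemma L2loc_cubes (f : point -> R) :
  (forall M, square_integrable mu (cube M) f) -> L2loc f.
Proof.
move=> fL; split => [|K /compact_cube[M KM]]; first exact: (fL 0).1.
have mf := (fL 0).1; have /integrableP[_ fi] := (fL M).2.
apply/integrableP; split.
  by apply/measurable_EFinP; apply: measurable_funTS; exact: measurable_funX.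
apply: le_lt_trans fi; rewrite [leLHS]integral_mkcond [leRHS]integral_mkcond.
apply: (@ge0_le_integral_ae _ _ _ mu) => [x|x|].
- by rewrite patchE; case: ifP.
- by rewrite patchE; case: ifP.
apply: aeW => x; rewrite !patchE; case: ifPn => [/set_mem/KM Mx|_].
  by rewrite mem_set.
by case: ifP => _; [exact: abse_ge0|exact: lexx].
Qed.

Lemma L2perB (B : 'M[R]_d) (f g : point -> R) : L2per B f -> L2per B g ->
  L2per B (fun x => f x - g x).
Proof.
move=> [fL pf] [gL pg]; split; last exact: (lattice_periodic_comp2 (fun a b => a - b) pf pg).
apply: L2loc_cubes => M; apply: square_integrableB; first exact: measurable_cube.
  exact: L2loc_cube.
exact: L2loc_cube.
Qed.

Lemma tensor_fieldsB (B : 'M[R]_d) (s t : point -> 'M[R]_d) :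
  tensor_fields B s -> tensor_fields B t -> tensor_fields B (s \- t).
Proof.
move=> [sL sT] [tL tT]; split => [i j|].
  rewrite (_ : (fun x => _) = fun x => s x i j - t x i j); first exact: L2perB.
  by apply/funext => x; rewrite !mxE.
by apply: filterS2 sT tT => x sx tx; rewrite linearB /= sx tx.
Qed.

End L2loc_cubes.

(** * The energies and the duality gap *)

Lemma ddot_gt0 (R : realType) d (e : 'M[R]_d) : e != 0 -> 0 < ddot e e.
Proof.
move=> e0; rewrite lt_neqAle ddot_ge0 andbT eq_sym; apply: contra e0 => /eqP e0.
apply/eqP/matrixP => i j; rewrite mxE; apply/eqP; rewrite -sqrf_eq0 eq_le sqr_ge0 andbT.
by rewrite -e0 sqr_le_ddot.
Qed.

Lemma coercive_positive_definite (R : realType) d (C : tensor4 R d) (m : R) : 0 < m ->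
  (forall e : 'M[R]_d, e^T = e -> m * ddot e e <= ddot (tapp C e) e) -> positive_definite C.
Proof. by move=> m0 hC e eT e0; apply: lt_le_trans (hC e eT); rewrite mulr_gt0// ddot_gt0. Qed.

Section symmetric_fields.
Context (R : realType) (d : nat).
Local Notation mu := (lebesgue_rV R d).
Local Notation point := 'rV[R]_d.
Local Notation field := (point -> 'M[R]_d).
Variable V : set point.
Hypotheses (mV : measurable V) (Voo : (mu V < +oo)%E).
Implicit Types (s t : field) (C : point -> tensor4 R d).

Definition L2_symmetric s := (forall i j, square_integrable mu V (fun x => s x i j)) /\
  {ae mu, forall x, (s x)^T = s x}.

Lemma L2_symmetric_cst (e : 'M[R]_d) : e^T = e -> L2_symmetric (cst e).
Proof. by move=> eT; split => [i j|]; [exact: square_integrable_cst|exact: aeW]. Qed.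

Lemma L2_symmetricD s t : L2_symmetric s -> L2_symmetric t -> L2_symmetric (fun x => s x + t x).
Proof.
move=> [sL sT] [tL tT]; split => [i j|].
  by under eq_fun do rewrite mxE; exact: square_integrableD.
by apply: filterS2 sT tT => x sx tx; rewrite linearD /= sx tx.
Qed.

Lemma L2_symmetricB s t : L2_symmetric s -> L2_symmetric t -> L2_symmetric (fun x => s x - t x).
Proof.
move=> [sL sT] [tL tT]; split => [i j|].
  by under eq_fun do rewrite !mxE; exact: square_integrableB.
by apply: filterS2 sT tT => x sx tx; rewrite linearB /= sx tx.
Qed.

Lemma integrable_ddot s t : L2_symmetric s -> L2_symmetric t ->
  mu.-integrable V (EFin \o (fun x => ddot (s x) (t x))).
Proof.
move=> [sL _] [tL _]; apply: integrable_Rsum => // i; apply: integrable_Rsum => // j.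
exact: (square_integrable_mul mV (sL i j) (tL i j)).
Qed.

Lemma L2_symmetric_tapp C s (M : R) :
  (forall i j k l, measurable_fun setT (fun x => C x i j k l)) ->
  {ae mu, forall x, major_minor_symmetric (C x)} ->
  {ae mu, forall x, V x -> forall i j k l, `|C x i j k l| <= M} ->
  L2_symmetric s -> L2_symmetric (fun x => tapp (C x) (s x)).
Proof.
move=> mC sC CM [sL sT]; split => [i j|]; last by apply: filterS sC => x; exact: tapp_tr.
under eq_fun do rewrite mxE.
do 2![apply: square_integrable_sum => // ?].
apply: (square_integrable_mul_bounded mV (M := M)) => //.
by apply: filterS CM => x /[apply].
Qed.

(** The uniform lower bound of the quadratic form of [C] is an upper bound of
    that of the inverse. *)
Lemma L2_symmetric_inverse C s (m : R) : 0 < m ->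
  (forall i j k l, measurable_fun setT (fun x => C x i j k l)) ->
  {ae mu, forall x, major_minor_symmetric (C x)} ->
  {ae mu, forall x, forall e : 'M[R]_d, e^T = e -> m * ddot e e <= ddot (tapp (C x) e) e} ->
  L2_symmetric s -> L2_symmetric (fun x => tapp (inverse_tensor (C x)) (s x)).
Proof.
move=> m0 mC sC Cm sL2; have [sL sT] := sL2.
have iss := integrable_ddot sL2 sL2.
split => [i j|]; last first.
  near=> x; have Cx : major_minor_symmetric (C x) by near: x.
  have Cmx : forall e : 'M[R]_d, e^T = e -> m * ddot e e <= ddot (tapp (C x) e) e by near: x.
  have sx : (s x)^T = s x by near: x.
  by have [] := inverse_tensorK Cx (coercive_positive_definite m0 Cmx) sx.
apply: (@square_integrable_bound _ _ _ mu V mV _ (fun x => m^-1 ^+ 2 * ddot (s x) (s x))).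
- under eq_fun do rewrite mxE.
  do 2![apply: measurable_sum => ?]; apply: measurable_funM; last exact: (sL _ _).1.
  exact: measurable_inverse_tensor.
- rewrite (_ : _ \o _ = fun x => ((m^-1 ^+ 2)%:E * (EFin \o (fun x => ddot (s x) (s x))) x)%E) //.
  exact: integrableZl.
- near=> x => Vx; have Cx : major_minor_symmetric (C x) by near: x.
  have Cmx : forall e : 'M[R]_d, e^T = e -> m * ddot e e <= ddot (tapp (C x) e) e by near: x.
  have sx : (s x)^T = s x by near: x.
  apply: le_trans (sqr_le_ddot _ i j) _.
  exact: (ddot_inverse_tensor2_le Cx (coercive_positive_definite m0 Cmx) m0 Cmx sx).
Unshelve. all: by end_near. Qed.

End symmetric_fields.

Section energies.
Context (R : realType) (d : nat) (B : 'M[R]_d) (V : set 'rV[R]_d).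
Local Notation mu := (lebesgue_rV R d).
Local Notation point := 'rV[R]_d.
Local Notation field := (point -> 'M[R]_d).
Hypotheses (uB : B \in unitmx) (tV : tiling B V).
Implicit Types (s t e : field).

Let mV : measurable V. Proof. by case: tV. Qed.
Let Voo : (mu V < +oo)%E := tiling_lty uB tV.
Local Notation L2s := (L2_symmetric V).
Local Notation volV := ((fine (mu V))^-1).

Lemma tensor_fields_L2_symmetric s : tensor_fields B s -> L2s s.
Proof.
by move=> [sL sT]; split => // i j; exact: (L2per_square_integrable uB tV (sL i j)).
Qed.

Lemma volV_ge0 : 0 <= volV. Proof. by rewrite invr_ge0 fine_ge0. Qed.

Section stress_product.
Variable L0 : tensor4 R d.
Hypotheses (sL0 : major_minor_symmetric L0) (pL0 : positive_definite L0).
Local Notation D0 := (inverse_tensor L0).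

Lemma stress_ipE s t : L2s t ->
  stress_ip V L0 s t = volV * \int[mu]_(x in V) ddot (s x) (tapp D0 (t x)).
Proof.
move=> [_ tT]; congr (_ * _); apply: eq_Rintegral_ae; apply: filterS tT => x tx _.
by rewrite tinvE.
Qed.

Lemma L2_symmetric_inverse_cst t : L2s t -> L2s (fun x => tapp D0 (t x)).
Proof.
have K0 : 0 < tensor_norm D0 + 1 by have := tensor_norm_ge0 D0; lra.
have i0 : 0 < (tensor_norm D0 + 1)^-1 by rewrite invr_gt0.
apply: (@L2_symmetric_inverse _ _ V mV (fun=> L0) t _ i0).
- by move=> i j k l; exact: measurable_cst.
- exact: aeW.
- by apply: aeW => x e eT; rewrite ler_pdivrMl//; exact: ddot_le_tapp.
Qed.

Lemma stress_ipC s t : L2s s -> L2s t -> stress_ip V L0 s t = stress_ip V L0 t s.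
Proof.
move=> sL tL; rewrite !stress_ipE//; congr (_ * _); apply: eq_Rintegral_ae.
by apply: filterS2 sL.2 tL.2 => x sx tx _; exact: ddot_inverse_tensorC.
Qed.

Lemma stress_ipBl s t u : L2s s -> L2s t -> L2s u ->
  stress_ip V L0 (s \- t) u = stress_ip V L0 s u - stress_ip V L0 t u.
Proof.
move=> sL tL uL; rewrite !stress_ipE// -mulrBr; congr (_ * _).
have iuL := L2_symmetric_inverse_cst uL.
rewrite -RintegralB//; [|exact: integrable_ddot..].
by apply: eq_Rintegral => x _; rewrite !ddotE.
Qed.

(** Both [tau - PS tau] and [PSc tau] are the component of [tau] on the orthogonal
    complement. They are not compared as functions, since orthogonality only
    determines them up to null sets: the two norms are equal by expanding the
    scalar products. *)
Lemma norm_projection_complement (PS PSc : field -> field) tau :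
  orthogonal_projector (tensor_fields B) (stress_ip V L0) (equilibrated_stresses B) PS ->
  orthogonal_projector (tensor_fields B) (stress_ip V L0)
    (orthogonal_complement (tensor_fields B) (stress_ip V L0) (equilibrated_stresses B)) PSc ->
  tensor_fields B tau ->
  stress_ip V L0 (PSc tau) (PSc tau) = stress_ip V L0 (tau \- PS tau) (tau \- PS tau).
Proof.
move=> hPS hPSc tauH; have [Ss sperp] := hPS _ tauH; have [[bH bS] bperp] := hPSc _ tauH.
have sH : tensor_fields B (PS tau) by case: Ss.
have aH : tensor_fields B (tau \- PS tau) by exact: tensor_fieldsB.
have toL := tensor_fields_L2_symmetric.
have h1 := bperp (tau \- PS tau) (conj aH sperp).
have h2 := bperp _ (conj bH bS).
have h3 := sperp _ Ss; have h4 := bS _ Ss.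
have tL := toL _ tauH; have sL := toL _ sH; have aL := toL _ aH; have bL := toL _ bH.
rewrite stress_ipBl// in h1; rewrite stress_ipBl// in h2.
have e1 := stress_ipBl tL sL aL; have e2 := stress_ipBl tL sL bL.
have c1 := stress_ipC aL sL; have c2 := stress_ipC bL sL; have c3 := stress_ipC aL bL.
lra.
Qed.

End stress_product.

Section gap.
Variables (L : point -> tensor4 R d) (M m : R).
Hypotheses (mL : forall i j k l, measurable_fun setT (fun x => L x i j k l))
  (sL : {ae mu, forall x, major_minor_symmetric (L x)})
  (LM : {ae mu, forall x, V x -> forall i j k l, `|L x i j k l| <= M})
  (m0 : 0 < m)
  (Lm : {ae mu, forall x, forall e : 'M[R]_d, e^T = e ->
    m * ddot e e <= ddot (tapp (L x) e) e}).
Local Notation D x := (inverse_tensor (L x)).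

Let pL : {ae mu, forall x, positive_definite (L x)}.
Proof. by apply: filterS Lm => x; exact: coercive_positive_definite. Qed.

(** Expanding the square produces the mean of [2 s : (eps + e)], and the mean of
    [s : e] vanishes by the Hill-Mandel lemma. *)
Lemma energy_gapE eps s e : eps^T = eps -> equilibrated_stresses B s ->
  compatible_strains B e ->
  complementary_energy V L eps s + potential_energy V L eps e =
  2^-1 * (volV * \int[mu]_(x in V)
    ddot (s x - tapp (L x) (eps + e x)) (tapp (D x) (s x - tapp (L x) (eps + e x)))).
Proof.
move=> epsT hs he.
have sL2 := tensor_fields_L2_symmetric (proj1 hs).
have eL2 := tensor_fields_L2_symmetric (proj1 he).
have epsL2 : L2s (cst eps) by exact: L2_symmetric_cst.
have e'L2 : L2s (fun x => eps + e x) by exact: (L2_symmetricD mV epsL2 eL2).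
have Le'L2 : L2s (fun x => tapp (L x) (eps + e x)) by exact: (L2_symmetric_tapp mV mL sL LM).
have DsL2 : L2s (fun x => tapp (D x) (s x)) by exact: (L2_symmetric_inverse mV m0 mL sL Lm).
have i1 := integrable_ddot mV sL2 DsL2.
have i2 := integrable_ddot mV Le'L2 e'L2.
have i3 := integrable_ddot mV sL2 epsL2.
have i4 := integrable_ddot mV sL2 eL2.
have -> : \int[mu]_(x in V)
    ddot (s x - tapp (L x) (eps + e x)) (tapp (D x) (s x - tapp (L x) (eps + e x))) =
  \int[mu]_(x in V) (ddot (s x) (tapp (D x) (s x)) + ddot (tapp (L x) (eps + e x)) (eps + e x)
    - 2 * (ddot (s x) eps + ddot (s x) (e x))).
  apply: eq_Rintegral_ae; near=> x => _.
  have sx : (s x)^T = s x by near: x; exact: sL2.2.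
  have ex : (eps + e x)^T = eps + e x by near: x; exact: e'L2.2.
  have Lsx : major_minor_symmetric (L x) by near: x.
  have Lpx : positive_definite (L x) by near: x.
  rewrite -ddotDr; move: (eps + e x) ex => f fT.
  have LfT := tapp_tr f Lsx.
  rewrite tappD tappN !ddotE inverse_tensor_tapp//.
  by rewrite (ddot_inverse_tensorC Lsx Lpx LfT sx) inverse_tensor_tapp//; lra.
have -> : \int[mu]_(x in V) (ddot (s x) (tapp (D x) (s x)) + ddot (tapp (L x) (eps + e x)) (eps + e x)
    - 2 * (ddot (s x) eps + ddot (s x) (e x))) =
  \int[mu]_(x in V) ddot (s x) (tapp (D x) (s x)) +
  \int[mu]_(x in V) ddot (tapp (L x) (eps + e x)) (eps + e x)
  - 2 * \int[mu]_(x in V) ddot (s x) eps.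
  have i34 : mu.-integrable V (EFin \o (fun x => ddot (s x) eps + ddot (s x) (e x))).
    exact: (integrableD mV i3 i4).
  have i34' : mu.-integrable V (EFin \o (fun x => 2 * (ddot (s x) eps + ddot (s x) (e x)))).
    exact: (integrableZl mV 2 i34).
  have i12 : mu.-integrable V (EFin \o (fun x => ddot (s x) (tapp (D x) (s x)) +
      ddot (tapp (L x) (eps + e x)) (eps + e x))).
    exact: (integrableD mV i1 i2).
  rewrite (RintegralB mV i12 i34') (RintegralD mV i1 i2) (RintegralZl 2 mV i34).
  by rewrite (RintegralD mV i3 i4) (hill_mandel uB tV hs he) addr0.
have -> : complementary_energy V L eps s = 2^-1 * (volV * \int[mu]_(x in V) ddot (s x) (tapp (D x) (s x)))
    - volV * \int[mu]_(x in V) ddot (s x) eps.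
  rewrite /complementary_energy /average; congr (_ * (_ * _) - _).
    apply: eq_Rintegral_ae; near=> x => _.
    have sx : (s x)^T = s x by near: x; exact: sL2.2.
    have Lsx : major_minor_symmetric (L x) by near: x.
    have Lpx : positive_definite (L x) by near: x.
    by rewrite tinvE.
  have isc i j : mu.-integrable V (EFin \o (fun x => s x i j * eps i j)).
    exact: (square_integrable_mul mV (sL2.1 i j) (epsL2.1 i j)).
  have is1 i j : mu.-integrable V (EFin \o (fun x => s x i j)).
    have := square_integrable_mul mV (sL2.1 i j) (square_integrable_cst mV 1 Voo).
    by under [X in EFin \o X]eq_fun do rewrite mulr1.
  rewrite {2}/ddot Rintegral_sum//; last by move=> i; apply: integrable_Rsum => // j; exact: isc.
  rewrite mulr_sumr; apply: eq_bigr => i _; rewrite Rintegral_sum// mulr_sumr.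
  by apply: eq_bigr => j _; rewrite mxE /average (RintegralZr _ mV (is1 i j)) mulrA.
rewrite /potential_energy /average.
move: (\int[mu]_(x in V) ddot (s x) (tapp (D x) (s x))) => I1.
move: (\int[mu]_(x in V) ddot (tapp (L x) (eps + e x)) (eps + e x)) => I2.
move: (\int[mu]_(x in V) ddot (s x) eps) => I3.
move: volV => a; field.
Unshelve. all: by end_near. Qed.

Lemma compliance_energy_ge0 s : L2s s ->
  0 <= \int[mu]_(x in V) ddot (s x) (tapp (D x) (s x)).
Proof.
move=> sL2; apply: Rintegral_ge0_ae => //; near=> x => _.
have sx : (s x)^T = s x by near: x; exact: sL2.2.
have Lsx : major_minor_symmetric (L x) by near: x.
have Lpx : positive_definite (L x) by near: x.
exact: (ddot_inverse_tensor_ge0 Lsx Lpx).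
Unshelve. all: by end_near. Qed.

Variable L0 : tensor4 R d.
Hypotheses (sL0 : major_minor_symmetric L0) (pL0 : positive_definite L0).
Local Notation D0 := (inverse_tensor L0).
Local Notation KM := (\sum_(i < d) \sum_(j < d) \sum_(k < d) \sum_(l < d) `|M|).
Local Notation kappa := (tensor_norm D0 + 1).
Local Notation kappa' := (tensor_norm L0 + 1).

(** The middle constant compares [y : L^-1 y] with [y : y] and then with
    [y : L0^-1 y]; the last one compares [L z : z] with [z : z] and then with
    [L0 z : z]. *)
Lemma energy_gap_le eps s e tau eta : eps^T = eps -> L2s s -> L2s e -> L2s tau -> L2s eta ->
  \int[mu]_(x in V)
    ddot (s x - tapp (L x) (eps + e x)) (tapp (D x) (s x - tapp (L x) (eps + e x))) <=
  3 * (\int[mu]_(x in V)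
         ddot (tau x - tapp (L x) (eta x)) (tapp (D x) (tau x - tapp (L x) (eta x)))
     + m^-1 * kappa' * \int[mu]_(x in V) ddot (tau x - s x) (tapp D0 (tau x - s x))
     + KM * kappa * \int[mu]_(x in V)
         ddot (tapp L0 (eta x - e x - eps)) (eta x - e x - eps)).
Proof.
move=> epsT sL2 eL2 tauL2 etaL2.
have epsL2 : L2s (cst eps) by exact: L2_symmetric_cst.
have e'L2 : L2s (fun x => eps + e x) by exact: (L2_symmetricD mV epsL2 eL2).
have Le'L2 : L2s (fun x => tapp (L x) (eps + e x)) by exact: (L2_symmetric_tapp mV mL sL LM).
have tL2 : L2s (fun x => s x - tapp (L x) (eps + e x)) by exact: (L2_symmetricB mV sL2 Le'L2).
have LetaL2 : L2s (fun x => tapp (L x) (eta x)) by exact: (L2_symmetric_tapp mV mL sL LM).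
have rL2 : L2s (fun x => tau x - tapp (L x) (eta x)) by exact: (L2_symmetricB mV tauL2 LetaL2).
have yL2 : L2s (fun x => tau x - s x) by exact: (L2_symmetricB mV tauL2 sL2).
have zL2 : L2s (fun x => eta x - e x - eps).
  exact: (L2_symmetricB mV (L2_symmetricB mV etaL2 eL2) epsL2).
have L0zL2 : L2s (fun x => tapp L0 (eta x - e x - eps)).
  apply: (@L2_symmetric_tapp _ _ V mV (fun=> L0) _ (tensor_norm L0)) zL2.
  - by move=> i j k l; exact: measurable_cst.
  - exact: aeW.
  - apply: aeW => x _ i j k l; rewrite /tensor_norm (bigD1 i)//= (bigD1 j)//= (bigD1 k)//= (bigD1 l)//=.
    rewrite -!addrA lerDl !addr_ge0//; do 4?[apply: sumr_ge0 => ? _] => //.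
have Dt := L2_symmetric_inverse mV m0 mL sL Lm tL2.
have Dr := L2_symmetric_inverse mV m0 mL sL Lm rL2.
have Dy := L2_symmetric_inverse_cst sL0 pL0 yL2.
have it := integrable_ddot mV tL2 Dt.
have ir := integrable_ddot mV rL2 Dr.
have iy := integrable_ddot mV yL2 Dy.
have iz := integrable_ddot mV L0zL2 zL2.
have iy' := integrableZl mV (m^-1 * kappa') iy.
have iz' := integrableZl mV (KM * kappa) iz.
rewrite -(RintegralZl _ mV iy) -(RintegralZl _ mV iz).
rewrite -(RintegralD mV ir iy').
have iry := integrableD mV ir iy'.
rewrite -(RintegralD mV iry iz').
have iryz := integrableD mV iry iz'.
rewrite -(RintegralZl 3 mV iryz).
apply: le_Rintegral_ae => //; first exact: (integrableZl mV 3 iryz).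
near=> x => Vx.
have sx : (s x)^T = s x by near: x; exact: sL2.2.
have taux : (tau x)^T = tau x by near: x; exact: tauL2.2.
have rx : (tau x - tapp (L x) (eta x))^T = tau x - tapp (L x) (eta x) by near: x; exact: rL2.2.
have zx : (eta x - e x - eps)^T = eta x - e x - eps by near: x; exact: zL2.2.
have yx : (tau x - s x)^T = tau x - s x by near: x; exact: yL2.2.
have Lsx : major_minor_symmetric (L x) by near: x.
have Lpx : positive_definite (L x) by near: x.
have Lmx : forall e : 'M[R]_d, e^T = e -> m * ddot e e <= ddot (tapp (L x) e) e by near: x.
have LMx : forall i j k l, `|L x i j k l| <= M by move: Vx; near: x.
have normL : tensor_norm (L x) <= KM.
  do 4![apply: ler_sum => ? _]; exact: (le_trans (LMx _ _ _ _) (ler_norm _)).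
have yx' : (- (tau x - s x))^T = - (tau x - s x) by rewrite linearN /= yx.
have Lzx := tapp_tr (eta x - e x - eps) Lsx.
have -> : s x - tapp (L x) (eps + e x) = tau x - tapp (L x) (eta x) + - (tau x - s x)
    + tapp (L x) (eta x - e x - eps).
  rewrite !(tappD, tappN).
  move: (tapp _ eps) (tapp _ (e x)) (tapp _ (eta x)) => t1 t2 t3.
  by apply/matrixP => i j; rewrite !mxE; ring.
apply: le_trans (ddot_inverse_tensor3 Lsx Lpx rx yx' Lzx) _; rewrite ler_pM2l//.
apply: lerD; first (apply: lerD => //).
  rewrite tappN ddotNl ddotNr opprK.
  apply: le_trans (ddot_inverse_tensor_le Lsx Lpx m0 Lmx yx) _.
  by rewrite -mulrA ler_pM2l ?invr_gt0//; exact: ddot_le_inverse_tensor.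
rewrite inverse_tensor_tapp//.
apply: le_trans (ddot_tapp_le _ _) _.
apply: (@le_trans _ _ (KM * ddot (eta x - e x - eps) (eta x - e x - eps))).
  by rewrite ler_wpM2r// ddot_ge0.
rewrite -mulrA ler_wpM2l//; last exact: ddot_le_tapp.
by do 4![apply: sumr_ge0 => ? _].
Unshelve. all: by end_near. Qed.

Lemma two_field_functionalE (PE PS PSc : field -> field) eps tau eta :
  orthogonal_projector (tensor_fields B) (strain_ip V L0) (compatible_strains B) PE ->
  orthogonal_projector (tensor_fields B) (stress_ip V L0) (equilibrated_stresses B) PS ->
  orthogonal_projector (tensor_fields B) (stress_ip V L0)
    (orthogonal_complement (tensor_fields B) (stress_ip V L0) (equilibrated_stresses B)) PSc ->
  eps^T = eps -> tensor_fields B tau -> tensor_fields B eta ->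
  let z x := eta x - PE eta x - eps in
  let y x := tau x - PS tau x in
  let r x := tau x - tapp (L x) (eta x) in
  [/\ two_field_functional V L0 L PE PSc eps tau eta =
        2^-1 * volV * (\int[mu]_(x in V) ddot (tapp L0 (z x)) (z x)
          + \int[mu]_(x in V) ddot (r x) (tapp (D x) (r x))
          + \int[mu]_(x in V) ddot (y x) (tapp D0 (y x))),
      0 <= \int[mu]_(x in V) ddot (tapp L0 (z x)) (z x),
      0 <= \int[mu]_(x in V) ddot (r x) (tapp (D x) (r x)) &
      0 <= \int[mu]_(x in V) ddot (y x) (tapp D0 (y x))].
Proof.
move=> hPE hPS hPSc epsT tauH etaH z y r.
have toL := tensor_fields_L2_symmetric.
have tauL2 := toL _ tauH; have etaL2 := toL _ etaH.
have eL2 := toL _ (proj1 (proj1 (hPE _ etaH))).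
have sL2 := toL _ (proj1 (proj1 (hPS _ tauH))).
have epsL2 : L2s (cst eps) by exact: L2_symmetric_cst.
have zL2 : L2s z by exact: (L2_symmetricB mV (L2_symmetricB mV etaL2 eL2) epsL2).
have yL2 : L2s y by exact: (L2_symmetricB mV tauL2 sL2).
have LetaL2 : L2s (fun x => tapp (L x) (eta x)) by exact: (L2_symmetric_tapp mV mL sL LM).
have rL2 : L2s r by exact: (L2_symmetricB mV tauL2 LetaL2).
have Iz0 : 0 <= \int[mu]_(x in V) ddot (tapp L0 (z x)) (z x).
  by apply: Rintegral_ge0_ae => //; apply: filterS zL2.2 => x zx _; exact: ddot_tapp_ge0.
have Ir0 : 0 <= \int[mu]_(x in V) ddot (r x) (tapp (D x) (r x)) by exact: compliance_energy_ge0.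
have Iy0 : 0 <= \int[mu]_(x in V) ddot (y x) (tapp D0 (y x)).
  by apply: Rintegral_ge0_ae => //; apply: filterS yL2.2 => x yx _; exact: ddot_inverse_tensor_ge0.
split => //; rewrite /two_field_functional /ip_norm.
have -> : strain_ip V L0 ((eta \- PE eta) \- cst eps) ((eta \- PE eta) \- cst eps) =
  volV * \int[mu]_(x in V) ddot (tapp L0 (z x)) (z x) by [].
rewrite (norm_projection_complement sL0 pL0 hPS hPSc tauH).
rewrite (stress_ipE sL0 pL0 _ yL2).
rewrite !sqr_sqrtr ?mulr_ge0 ?volV_ge0//.
have -> : average V (residual L tau eta) =
    2^-1 * (volV * \int[mu]_(x in V) ddot (r x) (tapp (D x) (r x))).
  have Dr := L2_symmetric_inverse mV m0 mL sL Lm rL2.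
  rewrite mulrCA -(RintegralZl _ mV (integrable_ddot mV rL2 Dr)); congr (_ * _).
  apply: eq_Rintegral_ae; near=> x => _.
  have rx : (r x)^T = r x by near: x; exact: rL2.2.
  have Lsx : major_minor_symmetric (L x) by near: x.
  have Lpx : positive_definite (L x) by near: x.
  by rewrite /residual -/(r x) tinvE.
rewrite /= -/(y _).
move: (\int[mu]_(x in V) ddot (tapp L0 (z x)) (z x)) => I1.
move: (\int[mu]_(x in V) ddot (r x) (tapp (D x) (r x))) => I2.
move: (\int[mu]_(x in V) ddot (y x) (tapp D0 (y x))) => I3.
move: volV => a; field.
Unshelve. all: by end_near. Qed.

End gap.
End energies.

Unset Implicit Arguments.

Theorem proposition6 (R : realType) (d : nat) (hd : (0 < d)%N)
    (B : 'M[R]_d) (hB : B \in unitmx)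
    (V : set 'rV[R]_d) (hV : unit_cell B V)
    (L0 : tensor4 R d) (L0_sym : major_minor_symmetric L0)
    (L0_pos : positive_definite L0)
    (L : 'rV[R]_d -> tensor4 R d) (hL : stiffness_field B V L) :
  exists2 c : R, 0 < c &
    forall (PE PS PSc : ('rV[R]_d -> 'M[R]_d) -> ('rV[R]_d -> 'M[R]_d)),
      orthogonal_projector (tensor_fields B) (strain_ip V L0)
        (compatible_strains B) PE ->
      orthogonal_projector (tensor_fields B) (stress_ip V L0)
        (equilibrated_stresses B) PS ->
      orthogonal_projector (tensor_fields B) (stress_ip V L0)
        (orthogonal_complement (tensor_fields B) (stress_ip V L0)
          (equilibrated_stresses B)) PSc ->
    forall eps : 'M[R]_d, eps^T = eps ->
    forall tau eta : 'rV[R]_d -> 'M[R]_d,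
      tensor_fields B tau -> tensor_fields B eta ->
      0 <= complementary_energy V L eps (PS tau)
           + potential_energy V L eps (PE eta)
        <= c * two_field_functional V L0 L PE PSc eps tau eta.
Proof.
have tV := unit_cell_tiling hV; have [mV _] := tV.
have [mL pL sL [M LM] [m m0 Lm]] := hL.
pose cz : R := (\sum_(i < d) \sum_(j < d) \sum_(k < d) \sum_(l < d) `|M|) *
  (tensor_norm (inverse_tensor L0) + 1).
pose cy : R := m^-1 * (tensor_norm L0 + 1).
have cz0 : 0 <= cz.
  apply: mulr_ge0; last by rewrite addr_ge0 ?tensor_norm_ge0.
  by do 4![apply: sumr_ge0 => ? _].
have cy0 : 0 <= cy by rewrite mulr_ge0 ?invr_ge0 ?(ltW m0)// addr_ge0 ?tensor_norm_ge0.
exists (3 * (1 + cy + cz)) => [|PE PS PSc hPE hPS hPSc eps epsT tau eta tauH etaH].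
  by rewrite mulr_gt0//; lra.
have [Ps _] := hPS _ tauH; have [Pe _] := hPE _ etaH.
have toL := tensor_fields_L2_symmetric hB tV.
have tauL2 := toL _ tauH; have etaL2 := toL _ etaH.
have sL2 := toL _ (proj1 Ps); have eL2 := toL _ (proj1 Pe).
rewrite (energy_gapE hB tV mL sL LM m0 Lm epsT Ps Pe).
have [-> Iz0 Ir0 Iy0] := two_field_functionalE hB tV mL sL LM m0 Lm L0_sym L0_pos
  hPE hPS hPSc epsT tauH etaH.
have Ile := energy_gap_le hB tV mL sL LM m0 Lm L0_sym L0_pos epsT sL2 eL2 tauL2 etaL2.
have It0 := compliance_energy_ge0 sL m0 Lm (L2_symmetricB mV sL2
  (L2_symmetric_tapp mV mL sL LM (L2_symmetricD mV
    (L2_symmetric_cst mV (tiling_lty hB tV) epsT) eL2))).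
have vol0 := volV_ge0 V.
rewrite -/cy -/cz in Ile.
move: It0 Ile Iz0 Ir0 Iy0 vol0; clear -cy0 cz0.
set It := Rintegral _ _ _; set Ir := Rintegral _ _ _; set Iy := Rintegral _ _ _; set Iz := Rintegral _ _ _.
set a := _^-1.
move: It Ir Iy Iz a cy cz cy0 cz0 => It Ir Iy Iz a cy cz cy0 cz0 It0 Ile Iz0 Ir0 Iy0 a0.
rewrite mulrA; apply/andP; split; first by rewrite !mulr_ge0// invr_ge0.
rewrite [leRHS](_ : _ = 2^-1 * a * (3 * (1 + cy + cz) * (Iz + Ir + Iy))); last by ring.
rewrite ler_wpM2l ?mulr_ge0 ?invr_ge0//; apply: (le_trans Ile).
rewrite -mulrA ler_pM2l//.
have := mulr_ge0 cy0 Iz0; have := mulr_ge0 cy0 Ir0; have := mulr_ge0 cz0 Ir0; have := mulr_ge0 cz0 Iy0.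
by lra.
Qed.
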